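(* Let $P$ be a ProP and $\phi:\mathbf{Gr}_{\mathrm{ind}}\to P$ a morphism of $\mathfrak S\times\mathfrak S^{op}$-modules. There exists a unique ProP morphism $\Phi:\mathbf{Gr}\to P$ such that $\Phi|_{\mathbf{Gr}_{\mathrm{ind}}}=\phi$. In other words, $\mathbf{Gr}$ is the free ProP generated by $\mathbf{Gr}_{\mathrm{ind}}$.
   Context: Vector spaces are over $\mathbb K\in\{\mathbb R,\mathbb C\}$, $[n]=\{1,\dots,n\}$. Graphs. A graph is a tuple $G=(V(G),E(G),I(G),O(G),IO(G),L(G),s,t,\alpha,\beta)$ where $V(G)$ (vertices), $E(G)$ (internal edges), $I(G)$ (input edges), $O(G)$ (output edges), $IO(G)$ (input-output edges), $L(G)$ (loops) are finite sets, $s:E(G)\sqcup O(G)\to V(G)$, $t:E(G)\sqcup I(G)\to V(G)$, $\alpha:I(G)\sqcup IO(G)\to[i(G)]$ a bijection with $i(G)=|I(G)|+|IO(G)|$, $\beta:O(G)\sqcup IO(G)\to[o(G)]$ a bijection with $o(G)=|O(G)|+|IO(G)|$. Isomorphisms are bijections of the six sets compatible with $s,t,\alpha,\beta$. $\mathbf{Gr}(k,l)$ is the vector space with basis the isoclasses of graphs with $i(G)=k$, $o(G)=l$. ProP structure on $\mathbf{Gr}$: $\sigma\cdot G$ is $G$ with $\beta$ replaced by $\sigma\circ\beta$ and $G\cdot\tau$ is $G$ with $\alpha$ replaced by $\tau^{-1}\circ\alpha$. $G*G'$: all six sets are disjoint unions, input and output indices of $G'$ shifted by $i(G)$, resp.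 $o(G)$; unit $I_0$ the empty graph. For $o(G)=i(G')$, $G'\circ G$ has $V=V(G)\sqcup V(G')$, $L=L(G)\sqcup L(G')$, $E=E(G)\sqcup E(G')\sqcup\{(f,e)\in O(G)\times I(G'):\beta(f)=\alpha'(e)\}$, $I=I(G)\sqcup\{(f,e)\in IO(G)\times I(G'):\beta(f)=\alpha'(e)\}$, $O=O(G')\sqcup\{(f,e)\in O(G)\times IO(G'):\beta(f)=\alpha'(e)\}$, $IO=\{(f,e)\in IO(G)\times IO(G'):\beta(f)=\alpha'(e)\}$; a new pair $(f,e)$ has source $s(f)$ and target $t'(e)$ when defined, input index $\alpha(f)$ and output index $\beta'(e)$; other data are inherited. Unit $I_1$: the graph with a single input-output edge. Indecomposable graphs: $G$ is indecomposable if (1) $V(G)\ne\emptyset$; (2) $IO(G)=\emptyset$; (3) $L(G)=\emptyset$ or $G$ is reduced to a single loop; (4) $G=G'\circ G''$ implies $V(G')=\emptyset$ or $V(G'')=\emptyset$; (5) $G=\sigma\cdot(G'*G'')\cdot\tau$ implies $V(G')=\emptyset$ or $V(G'')=\emptyset$. $\mathbf{Gr}_{\mathrm{ind}}(k,l)\subseteq\mathbf{Gr}(k,l)$ is the subspace spanned by isoclasses of indecomposable graphs; it is stable under the symmetric group actions. ProP. A ProP is a family $P=(P(k,l))_{k,l\ge0}$ of vector spaces such that: (i) each $P(k,l)$ carries commuting left $\mathfrak S_l$- and right $\mathfrak S_k$-actions; (ii) an associative horizontal concatenation $*:P(k,l)\otimes P(k',l')\to P(k+k',l+l')$ with unit $I_0\in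 P(0,0)$; (iii) an associative vertical concatenation $\circ:P(l,m)\otimes P(k,l)\to P(k,m)$ with $I_1\in P(1,1)$, $p\circ I_k=I_l\circ p=p$, $I_n=I_1^{*n}$; (iv) $(p*p')\circ(q*q')=(p\circ q)*(p'\circ q')$; (v) $\sigma\cdot(p\circ q)=(\sigma\cdot p)\circ q$, $(p\circ q)\cdot\nu=p\circ(q\cdot\nu)$, $(p\cdot\tau)\circ q=p\circ(\tau\cdot q)$; (vi) $(\sigma\cdot p)*(\sigma'\cdot p')=(\sigma\otimes\sigma')\cdot(p*p')$, $(p\cdot\tau)*(p'\cdot\tau')=(p*p')\cdot(\tau\otimes\tau')$, $c_{l,l'}\cdot(p*p')=(p'*p)\cdot c_{k,k'}$ for $p\in P(k,l)$, $p'\in P(k',l')$, where $\alpha\otimes\beta$ is $\alpha$ on $[m]$ and $i\mapsto\beta(i-m)+m$ for $i>m$, and $c_{m,n}(i)=i+n$ ($i\le m$), $c_{m,n}(i)=i-m$ ($i>m$). A ProP morphism is a family of linear maps $P(k,l)\to Q(k,l)$ compatible with the actions and both concatenations and sending $I_0,I_1$ to the units. A morphism of $\mathfrak S\times\mathfrak S^{op}$-modules is a family of linear maps compatible with the symmetric group actions.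
   Formalization: Condition (1) of indecomposability is read as ''V(G) is nonempty or G is reduced to a single loop'', so that the single loop is indecomposable; with (1) taken literally the loop is not generated by indecomposables and uniqueness fails. *)

(* Defs.v *)
From HB Require Import structures.
From mathcomp Require Import all_boot all_algebra perm.
From mathcomp Require Import generic_quotient freeg.
From mathcomp Require Import boolp classical_sets functions cardinality reals.
From mathcomp Require Import complex.

Set Implicit Arguments.
Unset Strict Implicit.
Unset Printing Implicit Defensive.

Import GRing.Theory.
Local Open Scope ring_scope.
Local Open Scope quotient_scope.

(* The carriers live in [Set], so that the graphs with given numbers of inputs
   and outputs form a small type, whose isoclasses can index a basis.  The
   index set [n] = {1, ..., n} is rendered by 'I_n (indices start at 0).
   Bijectivity of [inidx] and [outidx] forces k = |I| + |IO| and
   l = |O| + |IO|, hence also the finiteness of I, O and IO. *)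
Record graph (k l : nat) := Graph {
  vert : Set;
  edge : Set;
  inp : Set;
  outp : Set;
  thru : Set;  (* input-output edges *)
  loop : Set;
  src : edge + outp -> vert;
  tgt : edge + inp -> vert;
  inidx : inp + thru -> 'I_k;
  outidx : outp + thru -> 'I_l;
  vert_fin : finite_set [set: vert];
  edge_fin : finite_set [set: edge];
  loop_fin : finite_set [set: loop];
  inidx_bij : bijective inidx;
  outidx_bij : bijective outidx
}.

Arguments src {k l} g x.
Arguments tgt {k l} g x.
Arguments inidx {k l} g x.
Arguments outidx {k l} g x.

Definition sum_map (A B C D : Type) (f : A -> C) (g : B -> D) (x : A + B) :
    C + D :=
  match x with inl a => inl (f a) | inr b => inr (g b) end.

(* Indices are compared as natural numbers, so that graphs whose numbers of
   inputs and outputs are equal, but not convertible, can be compared. *)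
Record is_giso (k l k' l' : nat) (G : graph k l) (H : graph k' l')
    (fV : vert G -> vert H) (fE : edge G -> edge H) (fI : inp G -> inp H)
    (fO : outp G -> outp H) (fT : thru G -> thru H) (fL : loop G -> loop H) :
    Prop := IsGiso {
  giso_vert : bijective fV;
  giso_edge : bijective fE;
  giso_inp : bijective fI;
  giso_outp : bijective fO;
  giso_thru : bijective fT;
  giso_loop : bijective fL;
  giso_src : forall x, src H (sum_map fE fO x) = fV (src G x);
  giso_tgt : forall x, tgt H (sum_map fE fI x) = fV (tgt G x);
  giso_in : forall x, inidx H (sum_map fI fT x) = inidx G x :> nat;
  giso_out : forall x, outidx H (sum_map fO fT x) = outidx G x :> nat
}.

Definition giso (k l k' l' : nat) (G : graph k l) (H : graph k' l') : Prop :=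
  exists fV fE fI fO fT fL, @is_giso k l k' l' G H fV fE fI fO fT fL.

Lemma giso_refl k l (G : graph k l) : giso G G.
Proof.
exists id, id, id, id, id, id; split; try by exists id.
all: by case.
Qed.

Lemma giso_sym k l k' l' (G : graph k l) (H : graph k' l') :
  giso G H -> giso H G.
Proof.
move=> [fV [fE [fI [fO [fT [fL [[gV kV k'V] [gE kE k'E] [gI kI k'I]
  [gO kO k'O] [gT kT k'T] [gL kL k'L] Hs Ht Hi Ho]]]]]]].
exists gV, gE, gI, gO, gT, gL; split.
- by exists fV.
- by exists fE.
- by exists fI.
- by exists fO.
- by exists fT.
- by exists fL.
- move=> x; have {2}-> : x = sum_map fE fO (sum_map gE gO x).
    by case: x => x /=; rewrite ?k'E ?k'O.
  by rewrite Hs kV.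
- move=> x; have {2}-> : x = sum_map fE fI (sum_map gE gI x).
    by case: x => x /=; rewrite ?k'E ?k'I.
  by rewrite Ht kV.
- by move=> x; rewrite -Hi; case: x => x /=; rewrite ?k'I ?k'T.
- by move=> x; rewrite -Ho; case: x => x /=; rewrite ?k'O ?k'T.
Qed.

Lemma giso_trans k l k' l' k'' l'' (G : graph k l) (H : graph k' l')
    (K : graph k'' l'') : giso G H -> giso H K -> giso G K.
Proof.
move=> [fV [fE [fI [fO [fT [fL [bV bE bI bO bT bL Hs Ht Hi Ho]]]]]]].
move=> [gV [gE [gI [gO [gT [gL [cV cE cI cO cT cL Ks Kt Ki Ko]]]]]]].
exists (gV \o fV), (gE \o fE), (gI \o fI), (gO \o fO), (gT \o fT), (gL \o fL).
split; try exact: bij_comp.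
- by move=> x; rewrite /= -Hs -Ks; case: x.
- by move=> x; rewrite /= -Ht -Kt; case: x.
- by move=> x; rewrite -Hi -Ki; case: x.
- by move=> x; rewrite -Ho -Ko; case: x.
Qed.

Lemma inj_surj_bij (A B : Type) (f : A -> B) :
  injective f -> (forall y, exists x, f x = y) -> bijective f.
Proof.
move=> inj_f surj_f; exists (fun y => projT1 (cid (surj_f y))).
  by move=> x; apply: inj_f; case: cid.
by move=> y; case: cid.
Qed.

Lemma finite_sum (A B : Type) : finite_set [set: A] -> finite_set [set: B] ->
  finite_set [set: A + B].
Proof.
move=> finA finB.
apply: (@sub_finite_set _ _ ((inl @` [set: A]) `|` (inr @` [set: B]))).
  by case=> [a|b] _; [left; exists a | right; exists b].
by rewrite finite_setU; split; apply: finite_image.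
Qed.

Lemma finite_inj (A B : Type) (f : A -> B) :
  injective f -> finite_set [set: B] -> finite_set [set: A].
Proof.
move=> inj_f finB.
have : finite_set (f @` [set: A]) by apply: sub_finite_set finB.
by apply: contraPP => infA; rewrite (eq_finite_set (inj_card_eq _)) // => x y _ _ /inj_f.
Qed.

Lemma finite_void : finite_set [set: Empty_set].
Proof. by apply: (@sub_finite_set _ _ set0); [case|exact: finite_set0]. Qed.

Lemma finite_ord_bij (A B : Set) k (f : A + B -> 'I_k) :
  bijective f -> finite_set [set: A] /\ finite_set [set: B].
Proof.
move=> bij_f.
have fk : finite_set [set: 'I_k] by exact: finite_finset.
by split; [apply: (@finite_inj _ _ (f \o inl)) fk|
           apply: (@finite_inj _ _ (f \o inr)) fk];
  apply: inj_comp => [|x y [//]]; exact: bij_inj.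
Qed.

Section Units.

Definition ord0_of_void (x : Empty_set + Empty_set) : 'I_0 :=
  match x with inl y | inr y => match y with end end.

Lemma ord0_of_void_bij : bijective ord0_of_void.
Proof. by apply: inj_surj_bij; [case|case]. Qed.

Definition void_elim (T : Type) (x : Empty_set + Empty_set) : T :=
  match x with inl y | inr y => match y with end end.

Definition empty_graph : graph 0 0 :=
  @Graph 0 0 Empty_set Empty_set Empty_set Empty_set Empty_set Empty_set
    (void_elim _) (void_elim _) ord0_of_void ord0_of_void
    finite_void finite_void finite_void ord0_of_void_bij ord0_of_void_bij.

Definition ord1_of_unit (x : Empty_set + unit) : 'I_1 := ord0.

Lemma ord1_of_unit_bij : bijective ord1_of_unit.
Proof.
apply: inj_surj_bij; first by move=> [[]|[]] [[]|[]].
by move=> y; exists (inr tt); rewrite [y]ord1.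
Qed.

Definition edge_graph : graph 1 1 :=
  @Graph 1 1 Empty_set Empty_set Empty_set Empty_set unit Empty_set
    (void_elim _) (void_elim _) ord1_of_unit ord1_of_unit
    finite_void finite_void finite_void ord1_of_unit_bij ord1_of_unit_bij.

End Units.

Section Actions.
Variables (k l : nat).

Lemma lactg_bij (s : 'S_l) (G : graph k l) :
  bijective (fun x => s (outidx G x)).
Proof. exact: bij_comp (injF_bij (@perm_inj _ s)) (outidx_bij G). Qed.

Definition lactg (s : 'S_l) (G : graph k l) : graph k l :=
  Graph (src G) (tgt G) (vert_fin G) (edge_fin G) (loop_fin G)
    (inidx_bij G) (lactg_bij s G).

Lemma ractg_bij (G : graph k l) (t : 'S_k) :
  bijective (fun x => (t^-1)%g (inidx G x)).
Proof. exact: bij_comp (injF_bij (@perm_inj _ _)) (inidx_bij G). Qed.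

Definition ractg (G : graph k l) (t : 'S_k) : graph k l :=
  Graph (src G) (tgt G) (vert_fin G) (edge_fin G) (loop_fin G)
    (ractg_bij G t) (outidx_bij G).

End Actions.

Section Horizontal.
Variables (k l k' l' : nat) (G : graph k l) (G' : graph k' l').

Definition hcompg_src (x : (edge G + edge G') + (outp G + outp G')) :
    vert G + vert G' :=
  match x with
  | inl (inl e) => inl (src G (inl e))
  | inl (inr e) => inr (src G' (inl e))
  | inr (inl f) => inl (src G (inr f))
  | inr (inr f) => inr (src G' (inr f))
  end.

Definition hcompg_tgt (x : (edge G + edge G') + (inp G + inp G')) :
    vert G + vert G' :=
  match x with
  | inl (inl e) => inl (tgt G (inl e))
  | inl (inr e) => inr (tgt G' (inl e))
  | inr (inl e) => inl (tgt G (inr e))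
  | inr (inr e) => inr (tgt G' (inr e))
  end.

Definition hcompg_in (x : (inp G + inp G') + (thru G + thru G')) :
    'I_(k + k') :=
  match x with
  | inl (inl e) => lshift k' (inidx G (inl e))
  | inl (inr e) => rshift k (inidx G' (inl e))
  | inr (inl e) => lshift k' (inidx G (inr e))
  | inr (inr e) => rshift k (inidx G' (inr e))
  end.

Definition hcompg_out (x : (outp G + outp G') + (thru G + thru G')) :
    'I_(l + l') :=
  match x with
  | inl (inl f) => lshift l' (outidx G (inl f))
  | inl (inr f) => rshift l (outidx G' (inl f))
  | inr (inl f) => lshift l' (outidx G (inr f))
  | inr (inr f) => rshift l (outidx G' (inr f))
  end.

Lemma hcompg_in_bij : bijective hcompg_in.
Proof.
have iG := bij_inj (inidx_bij G); have iG' := bij_inj (inidx_bij G').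
have [g _ gK] := inidx_bij G; have [g' _ g'K] := inidx_bij G'.
apply: inj_surj_bij => [x y|].
  by move: x y => [[x|x]|[x|x]] [[y|y]|[y|y]] /eqP /=;
    rewrite ?(eq_lrshift, eq_rlshift) // ?(eq_lshift, eq_rshift) => /eqP;
    first [by move=> /iG [] // -> | by move=> /iG' [] // ->].
move=> i; case: (split_ordP i) => j ->.
  by case E: (g j) (gK j) => [x|x] <-; [exists (inl (inl x))|exists (inr (inl x))].
by case E: (g' j) (g'K j) => [x|x] <-; [exists (inl (inr x))|exists (inr (inr x))].
Qed.

Lemma hcompg_out_bij : bijective hcompg_out.
Proof.
have iG := bij_inj (outidx_bij G); have iG' := bij_inj (outidx_bij G').
have [g _ gK] := outidx_bij G; have [g' _ g'K] := outidx_bij G'.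
apply: inj_surj_bij => [x y|].
  by move: x y => [[x|x]|[x|x]] [[y|y]|[y|y]] /eqP /=;
    rewrite ?(eq_lrshift, eq_rlshift) // ?(eq_lshift, eq_rshift) => /eqP;
    first [by move=> /iG [] // -> | by move=> /iG' [] // ->].
move=> i; case: (split_ordP i) => j ->.
  by case E: (g j) (gK j) => [x|x] <-; [exists (inl (inl x))|exists (inr (inl x))].
by case E: (g' j) (g'K j) => [x|x] <-; [exists (inl (inr x))|exists (inr (inr x))].
Qed.

Definition hcompg : graph (k + k') (l + l') :=
  Graph hcompg_src hcompg_tgt
    (finite_sum (vert_fin G) (vert_fin G'))
    (finite_sum (edge_fin G) (edge_fin G'))
    (finite_sum (loop_fin G) (loop_fin G'))
    hcompg_in_bij hcompg_out_bij.

End Horizontal.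

Definition matched (n : nat) (A B : Set) (b : A -> 'I_n) (a : B -> 'I_n) : Set :=
  {fe : A * B | b (fst fe) == a (snd fe)}.

Section Matched.
Variables (n : nat) (A B : Set) (b : A -> 'I_n) (a : B -> 'I_n).

Definition match_out (fe : matched b a) : A := fst (sval fe).
Definition match_in (fe : matched b a) : B := snd (sval fe).

Lemma matchP (fe : matched b a) : b (match_out fe) = a (match_in fe).
Proof. exact/eqP/(svalP fe). Qed.

Lemma matched_eq (x y : matched b a) :
  match_out x = match_out y -> match_in x = match_in y -> x = y.
Proof.
case: x y => [[f e] p] [[f' e'] p']; rewrite /match_out /match_in /= => ef ee.
by move: p p'; rewrite ef ee => p p'; rewrite (eq_irrelevance p p').
Qed.

Lemma matched_fin : finite_set [set: A] -> finite_set [set: B] ->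
  finite_set [set: matched b a].
Proof.
move=> finA finB.
apply: (@finite_inj _ (A * B)%type sval).
  by move=> [[f e] p] [[f' e'] p'] /= [ef ee]; apply: matched_eq.
by rewrite -setXTT; apply: finite_setX.
Qed.

End Matched.

Section Vertical.
Variables (k l m : nat) (G' : graph l m) (G : graph k l).

Let OI' := matched (outidx G \o inl) (inidx G' \o inl).
Let OT' := matched (outidx G \o inl) (inidx G' \o inr).
Let TI' := matched (outidx G \o inr) (inidx G' \o inl).
Let TT' := matched (outidx G \o inr) (inidx G' \o inr).

Definition vcompg_src (x : (edge G + edge G' + OI') + (outp G' + OT')) :
    vert G + vert G' :=
  match x with
  | inl (inl (inl e)) => inl (src G (inl e))
  | inl (inl (inr e)) => inr (src G' (inl e))
  | inl (inr fe) => inl (src G (inr (match_out fe)))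
  | inr (inl f) => inr (src G' (inr f))
  | inr (inr fe) => inl (src G (inr (match_out fe)))
  end.

Definition vcompg_tgt (x : (edge G + edge G' + OI') + (inp G + TI')) :
    vert G + vert G' :=
  match x with
  | inl (inl (inl e)) => inl (tgt G (inl e))
  | inl (inl (inr e)) => inr (tgt G' (inl e))
  | inl (inr fe) => inr (tgt G' (inr (match_in fe)))
  | inr (inl e) => inl (tgt G (inr e))
  | inr (inr fe) => inr (tgt G' (inr (match_in fe)))
  end.

Definition vcompg_in (x : (inp G + TI') + TT') : 'I_k :=
  match x with
  | inl (inl e) => inidx G (inl e)
  | inl (inr fe) => inidx G (inr (match_out fe))
  | inr fe => inidx G (inr (match_out fe))
  end.

Definition vcompg_out (x : (outp G' + OT') + TT') : 'I_m :=
  match x with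
  | inl (inl f) => outidx G' (inl f)
  | inl (inr fe) => outidx G' (inr (match_in fe))
  | inr fe => outidx G' (inr (match_in fe))
  end.

Lemma vcompg_in_bij : bijective vcompg_in.
Proof.
have iG := bij_inj (inidx_bij G); have iG' := bij_inj (inidx_bij G').
have [g _ gK] := inidx_bij G; have [g' _ g'K] := inidx_bij G'.
apply: inj_surj_bij => [x y|i].
  case: x => [[x|x]|x]; case: y => [[y|y]|y] /= /iG => -[] // e.
  - by rewrite e.
  - congr (inl (inr _)); apply: matched_eq => //.
    by have /iG' [] := etrans (etrans (esym (matchP x)) (congr1 (outidx G \o inr) e)) (matchP y).
  - by have /iG' := etrans (etrans (esym (matchP x)) (congr1 (outidx G \o inr) e)) (matchP y).
  - by have /iG' := etrans (etrans (esym (matchP x)) (congr1 (outidx G \o inr) e)) (matchP y).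
  - congr inr; apply: matched_eq => //.
    by have /iG' [] := etrans (etrans (esym (matchP x)) (congr1 (outidx G \o inr) e)) (matchP y).
case: (g i) (gK i) => x <-; first by exists (inl (inl x)).
case E: (g' (outidx G (inr x))) (g'K (outidx G (inr x))) => [y|y] /esym/eqP p.
  by exists (inl (inr (exist _ (x, y) p))).
by exists (inr (exist _ (x, y) p)).
Qed.

Lemma vcompg_out_bij : bijective vcompg_out.
Proof.
have iG := bij_inj (outidx_bij G); have iG' := bij_inj (outidx_bij G').
have [g _ gK] := outidx_bij G; have [g' _ g'K] := outidx_bij G'.
apply: inj_surj_bij => [x y|i].
  case: x => [[x|x]|x]; case: y => [[y|y]|y] /= /iG' => -[] // e.
  - by rewrite e.
  - congr (inl (inr _)); apply: matched_eq => //.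
    by have /iG [] := etrans (etrans (matchP x) (congr1 (inidx G' \o inr) e)) (esym (matchP y)).
  - by have /iG := etrans (etrans (matchP x) (congr1 (inidx G' \o inr) e)) (esym (matchP y)).
  - by have /iG := etrans (etrans (matchP x) (congr1 (inidx G' \o inr) e)) (esym (matchP y)).
  - congr inr; apply: matched_eq => //.
    by have /iG [] := etrans (etrans (matchP x) (congr1 (inidx G' \o inr) e)) (esym (matchP y)).
case: (g' i) (g'K i) => x <-; first by exists (inl (inl x)).
case E: (g (inidx G' (inr x))) (gK (inidx G' (inr x))) => [y|y] /eqP p.
  by exists (inl (inr (exist _ (y, x) p))).
by exists (inr (exist _ (y, x) p)).
Qed.

Lemma vcompg_edge_fin : finite_set [set: edge G + edge G' + OI'].
Proof.
apply: finite_sum; first exact: finite_sum (edge_fin G) (edge_fin G').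
have [? _] := finite_ord_bij (outidx_bij G).
by have [? _] := finite_ord_bij (inidx_bij G'); apply: matched_fin.
Qed.

(* The composite G' o G: first G, then G' *)
Definition vcompg : graph k m :=
  Graph vcompg_src vcompg_tgt
    (finite_sum (vert_fin G) (vert_fin G'))
    vcompg_edge_fin
    (finite_sum (loop_fin G) (loop_fin G'))
    vcompg_in_bij vcompg_out_bij.

End Vertical.

Fixpoint id_graph n : graph n n :=
  if n is n'.+1 then hcompg edge_graph (id_graph n') else empty_graph.

Section Permutations.
Variables m n : nat.

Lemma tensor_perm_inj (s : 'S_m) (t : 'S_n) :
  injective (fun i : 'I_(m + n) => unsplit (sum_map s t (fintype.split i))).
Proof.
apply: inj_comp (can_inj unsplitK) _; apply: inj_comp (can_inj fintype.splitK).
by move=> [i|i] [j|j] //= [/perm_inj->].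
Qed.

Definition tensor_perm (s : 'S_m) (t : 'S_n) : 'S_(m + n) :=
  perm (@tensor_perm_inj s t).

Lemma tensor_perm_lshift s t i :
  tensor_perm s t (lshift n i) = lshift n (s i).
Proof. by rewrite permE -[lshift n i]/(unsplit (inl i)) unsplitK. Qed.

Lemma tensor_perm_rshift s t i :
  tensor_perm s t (rshift m i) = rshift m (t i).
Proof. by rewrite permE -[rshift m i]/(unsplit (inr i)) unsplitK. Qed.

Lemma tensor_permV s t : ((tensor_perm s t)^-1 = tensor_perm s^-1 t^-1)%g.
Proof.
apply/permP => i; apply: (@perm_inj _ (tensor_perm s t)); rewrite permKV.
by case: (split_ordP i) => j ->;
  rewrite !(tensor_perm_lshift, tensor_perm_rshift) permKV.
Qed.

Definition block_swap (i : 'I_(m + n)) : 'I_(m + n) :=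
  cast_ord (addnC n m)
    (match fintype.split i with inl j => rshift n j | inr j => lshift m j end).

Lemma block_swap_inj : injective block_swap.
Proof.
apply: inj_comp (@cast_ord_inj _ _ _) _ => i j.
case: (split_ordP i) => i' ->; case: (split_ordP j) => j' -> => /eqP;
  by rewrite ?(eq_lrshift, eq_rlshift, eq_lshift, eq_rshift) // => /eqP ->.
Qed.

(* c_{m,n} : i |-> i + n on the first m indices, i |-> i - m on the others *)
Definition swap_perm : 'S_(m + n) := perm block_swap_inj.

Lemma swap_perm_lshift i : swap_perm (lshift n i) = (n + i)%N :> nat.
Proof. by rewrite permE /block_swap -[lshift n i]/(unsplit (inl i)) unsplitK. Qed.

Lemma swap_perm_rshift i : swap_perm (rshift m i) = i :> nat.
Proof. by rewrite permE /block_swap -[rshift m i]/(unsplit (inr i)) unsplitK. Qed.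

End Permutations.

Ltac gcases := unfold cancel; intros; repeat match goal with
  | x : ?T |- _ => let T' := eval hnf in T in
    lazymatch T' with
    | Empty_set => destruct x
    | sum _ _ => destruct x
    | sig _ => destruct x as [[? ?] ?]
    end
  end.

Lemma sum_map_bij (A B C D : Type) (f : A -> C) (g : B -> D) :
  bijective f -> bijective g -> bijective (sum_map f g).
Proof.
move=> [f' fK f'K] [g' gK g'K]; exists (sum_map f' g') => -[x|x] /=;
  by rewrite ?fK ?f'K ?gK ?g'K.
Qed.

Definition matched_map (n n' : nat) (A B A' B' : Set) (b : A -> 'I_n)
    (a : B -> 'I_n) (b' : A' -> 'I_n') (a' : B' -> 'I_n') (f : A -> A')
    (g : B -> B') (H : forall x y, b x = a y -> b' (f x) = a' (g y))
    (fe : matched b a) : matched b' a' :=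
  exist (fun p => b' (fst p) == a' (snd p)) (f (match_out fe), g (match_in fe))
    (introT eqP (H _ _ (matchP fe))).

Lemma matched_map_bij (n n' : nat) (A B A' B' : Set) (b : A -> 'I_n)
    (a : B -> 'I_n) (b' : A' -> 'I_n') (a' : B' -> 'I_n') (f : A -> A')
    (g : B -> B') (H : forall x y, b x = a y -> b' (f x) = a' (g y)) :
  bijective f -> bijective g ->
  (forall x y, b' (f x) = a' (g y) -> b x = a y) ->
  bijective (matched_map H).
Proof.
move=> bf bg H'; apply: inj_surj_bij => [x y e|[[x y] p]].
  apply: matched_eq; [apply: (bij_inj bf)|apply: (bij_inj bg)].
    exact: (congr1 (@match_out _ _ _ b' a') e).
  exact: (congr1 (@match_in _ _ _ b' a') e).
have [f' _ fK] := bf; have [g' _ gK] := bg.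
have q : b (f' x) == a (g' y) by apply/eqP/H'; rewrite fK gK; apply/eqP.
exists (exist _ (f' x, g' y) q).
by apply: matched_eq; [exact: fK|exact: gK].
Qed.

Lemma match_in_bij (n : nat) (A B : Set) (b : A -> 'I_n) (a : B -> 'I_n) :
  injective b -> (forall y, exists x, b x = a y) ->
  bijective (@match_in _ _ _ b a).
Proof.
move=> ib H; apply: inj_surj_bij => [x y e|y].
  by apply: matched_eq => //; apply: ib; rewrite !matchP e.
by have [x /eqP p] := H y; exists (exist _ (x, y) p).
Qed.

Lemma match_out_bij (n : nat) (A B : Set) (b : A -> 'I_n) (a : B -> 'I_n) :
  injective a -> (forall x, exists y, b x = a y) ->
  bijective (@match_out _ _ _ b a).
Proof.
move=> ia H; apply: inj_surj_bij => [x y e|x].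
  by apply: matched_eq => //; apply: ia; rewrite -!matchP e.
by have [y /eqP p] := H x; exists (exist _ (x, y) p).
Qed.

Lemma giso_lactg k l (s : 'S_l) (G H : graph k l) :
  giso G H -> giso (lactg s G) (lactg s H).
Proof.
move=> [fV [fE [fI [fO [fT [fL []]]]]]] *.
exists fV, fE, fI, fO, fT, fL; split=> //= x.
by congr (nat_of_ord (s _)); apply: val_inj => /=; auto.
Qed.

Lemma giso_ractg k l (t : 'S_k) (G H : graph k l) :
  giso G H -> giso (ractg G t) (ractg H t).
Proof.
move=> [fV [fE [fI [fO [fT [fL []]]]]]] *.
exists fV, fE, fI, fO, fT, fL; split=> //= x.
by congr (nat_of_ord ((t^-1)%g _)); apply: val_inj => /=; auto.
Qed.

Lemma giso_hcompg k l k' l' (G H : graph k l) (G' H' : graph k' l') :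
  giso G H -> giso G' H' -> giso (hcompg G G') (hcompg H H').
Proof.
move=> [fV [fE [fI [fO [fT [fL [bV bE bI bO bT bL Hs Ht Hi Ho]]]]]]].
move=> [gV [gE [gI [gO [gT [gL [cV cE cI cO cT cL Ks Kt Ki Ko]]]]]]].
exists (sum_map fV gV), (sum_map fE gE), (sum_map fI gI), (sum_map fO gO),
  (sum_map fT gT), (sum_map fL gL).
split; try exact: sum_map_bij.
- by move=> [[x|x]|[x|x]] /=; rewrite -(Hs, Ks).
- by move=> [[x|x]|[x|x]] /=; rewrite -(Ht, Kt).
- by move=> [[x|x]|[x|x]] /=; rewrite -(Hi, Ki).
- by move=> [[x|x]|[x|x]] /=; rewrite -(Ho, Ko).
Qed.

Lemma giso_vcompg k l m (G' H' : graph l m) (G H : graph k l) :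
  giso G' H' -> giso G H -> giso (vcompg G' G) (vcompg H' H).
Proof.
move=> [gV [gE [gI [gO [gT [gL [cV cE cI cO cT cL Ks Kt Ki Ko]]]]]]].
move=> [fV [fE [fI [fO [fT [fL [bV bE bI bO bT bL Hs Ht Hi Ho]]]]]]].
have Hi' x : inidx H (sum_map fI fT x) = inidx G x by exact/val_inj/Hi.
have Ho' x : outidx H (sum_map fO fT x) = outidx G x by exact/val_inj/Ho.
have Ki' x : inidx H' (sum_map gI gT x) = inidx G' x by exact/val_inj/Ki.
have Ko' x : outidx H' (sum_map gO gT x) = outidx G' x by exact/val_inj/Ko.
have hO x : outidx H (inl (fO x)) = outidx G (inl x) by rewrite -Ho'.
have hT x : outidx H (inr (fT x)) = outidx G (inr x) by rewrite -Ho'.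
have kI x : inidx H' (inl (gI x)) = inidx G' (inl x) by rewrite -Ki'.
have kT x : inidx H' (inr (gT x)) = inidx G' (inr x) by rewrite -Ki'.
have OI x y : (outidx G \o inl) x = (inidx G' \o inl) y ->
  (outidx H \o inl) (fO x) = (inidx H' \o inl) (gI y) by rewrite /= hO kI.
have OT x y : (outidx G \o inl) x = (inidx G' \o inr) y ->
  (outidx H \o inl) (fO x) = (inidx H' \o inr) (gT y) by rewrite /= hO kT.
have TI x y : (outidx G \o inr) x = (inidx G' \o inl) y ->
  (outidx H \o inr) (fT x) = (inidx H' \o inl) (gI y) by rewrite /= hT kI.
have TT x y : (outidx G \o inr) x = (inidx G' \o inr) y ->
  (outidx H \o inr) (fT x) = (inidx H' \o inr) (gT y) by rewrite /= hT kT.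
exists (sum_map fV gV), (sum_map (sum_map fE gE) (matched_map OI)),
  (sum_map fI (matched_map TI)), (sum_map gO (matched_map OT)),
  (matched_map TT), (sum_map fL gL).
split; rewrite /=.
- exact: sum_map_bij.
- apply: sum_map_bij; first exact: sum_map_bij.
  by apply: matched_map_bij; rewrite // => x y /=; rewrite hO kI.
- apply: sum_map_bij => //.
  by apply: matched_map_bij; rewrite // => x y /=; rewrite hT kI.
- apply: sum_map_bij => //.
  by apply: matched_map_bij; rewrite // => x y /=; rewrite hO kT.
- by apply: matched_map_bij; rewrite // => x y /=; rewrite hT kT.
- exact: sum_map_bij.
- by move=> [[[x|x]|x]|[x|x]] /=; rewrite -(Hs, Ks).
- by move=> [[[x|x]|x]|[x|x]] /=; rewrite -(Ht, Kt).
- by move=> [[x|x]|x] /=; rewrite -Hi.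
- by move=> [[x|x]|x] /=; rewrite -Ko.
Qed.

Lemma lactg1 k l (G : graph k l) : giso (lactg 1%g G) G.
Proof.
exists id, id, id, id, id, id; split; try by exists id.
all: by case=> x /=; rewrite ?perm1.
Qed.

Lemma lactgM k l (s t : 'S_l) (G : graph k l) :
  giso (lactg (t * s)%g G) (lactg s (lactg t G)).
Proof.
exists id, id, id, id, id, id; split; try by exists id.
all: by case=> x /=; rewrite ?permM.
Qed.

Lemma ractg1 k l (G : graph k l) : giso (ractg G 1%g) G.
Proof.
exists id, id, id, id, id, id; split; try by exists id.
all: by case=> x /=; rewrite ?invg1 ?perm1.
Qed.

Lemma ractgM k l (s t : 'S_k) (G : graph k l) :
  giso (ractg G (t * s)%g) (ractg (ractg G s) t).
Proof.
exists id, id, id, id, id, id; split; try by exists id.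
all: by case=> x //=; rewrite -permM -invgM.
Qed.

Lemma lractgC k l (s : 'S_l) (t : 'S_k) (G : graph k l) :
  giso (lactg s (ractg G t)) (ractg (lactg s G) t).
Proof.
exists id, id, id, id, id, id; split; try by exists id.
all: by case.
Qed.

Definition sumA (A B C : Type) (x : A + (B + C)) : (A + B) + C :=
  match x with
  | inl a => inl (inl a)
  | inr (inl b) => inl (inr b)
  | inr (inr c) => inr c
  end.

Definition sumA' (A B C : Type) (x : (A + B) + C) : A + (B + C) :=
  match x with
  | inl (inl a) => inl a
  | inl (inr b) => inr (inl b)
  | inr c => inr (inr c)
  end.

Lemma sumA_bij (A B C : Type) : bijective (@sumA A B C).
Proof. by exists (@sumA' A B C); gcases. Qed.

Definition sumC (A B : Type) (x : A + B) : B + A :=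
  match x with inl a => inr a | inr b => inl b end.

Lemma sumC_bij (A B : Type) : bijective (@sumC A B).
Proof. by exists (@sumC B A); gcases. Qed.

Lemma hcompgA k l k' l' k'' l'' (G : graph k l) (G' : graph k' l')
    (G'' : graph k'' l'') :
  giso (hcompg G (hcompg G' G'')) (hcompg (hcompg G G') G'').
Proof.
exists (@sumA _ _ _), (@sumA _ _ _), (@sumA _ _ _), (@sumA _ _ _),
  (@sumA _ _ _), (@sumA _ _ _); split; try exact: sumA_bij.
all: by move=> [[x|[x|x]]|[x|[x|x]]] //=; rewrite ?addnA.
Qed.

Definition sum0l (A : Type) (x : Empty_set + A) : A :=
  match x with inl y => match y with end | inr a => a end.

Lemma sum0l_bij (A : Type) : bijective (@sum0l A).
Proof. by exists inr; gcases. Qed.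

Definition sum0r (A : Type) (x : A + Empty_set) : A :=
  match x with inr y => match y with end | inl a => a end.

Lemma sum0r_bij (A : Type) : bijective (@sum0r A).
Proof. by exists inl; gcases. Qed.

Lemma hcompg0 k l (G : graph k l) : giso (hcompg empty_graph G) G.
Proof.
exists (@sum0l _), (@sum0l _), (@sum0l _), (@sum0l _),
  (@sum0l _), (@sum0l _); split; try exact: sum0l_bij.
all: by move=> [[[]|x]|[[]|x]].
Qed.

Lemma hcomp0g k l (G : graph k l) : giso (hcompg G empty_graph) G.
Proof.
exists (@sum0r _), (@sum0r _), (@sum0r _), (@sum0r _),
  (@sum0r _), (@sum0r _); split; try exact: sum0r_bij.
all: by move=> [[x|[]]|[x|[]]].
Qed.

Record id_like n (J : graph n n) : Prop := IdLike {
  il_vert : vert J -> False;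
  il_edge : edge J -> False;
  il_inp : inp J -> False;
  il_outp : outp J -> False;
  il_loop : loop J -> False;
  il_idx : forall x, inidx J (inr x) = outidx J (inr x)
}.

Lemma id_graphP n : id_like (id_graph n).
Proof.
elim: n => [|n [hV hE hI hO hL hT]]; first by split=> // -[].
split => /=; try by case=> // -[].
by case=> x //=; rewrite hT.
Qed.

Lemma vcompg_id k l (G : graph k l) (J : graph k k) :
  id_like J -> giso (vcompg G J) G.
Proof.
move=> [hV hE hI hO hL hT].
pose nil (A B : Type) (h : A -> False) (x : A + B) : B :=
  match x with inl a => False_rect _ (h a) | inr b => b end.
have nilB A B h : bijective (@nil A B h) by exists inr => [[]|].
have T_surj i : exists x, outidx J (inr x) = i.
  by have [g _ gK] := outidx_bij J; case: (g i) (gK i) => x <-; [case: (hO x)|exists x].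
have T_inj : injective (outidx J \o inr) by apply: inj_comp (bij_inj (outidx_bij J)) _ => x y [].
pose fE (x : edge (vcompg G J)) : edge G := match x with
  | inl (inl e) => False_rect _ (hE e) | inl (inr e) => e
  | inr fe => False_rect _ (hO (match_out fe)) end.
pose fO (x : outp (vcompg G J)) : outp G := match x with
  | inl f => f | inr fe => False_rect _ (hO (match_out fe)) end.
exists (@nil _ _ hV), fE, (fun x => match x with
  | inl e => False_rect _ (hI e) | inr fe => match_in fe end), fO,
  (@match_in _ _ _ _ _), (@nil _ _ hL).
split; rewrite /=.
- exact: nilB.
- exists (fun e => inl (inr e)) => // -[[e|e]|fe] //=.
  by case: (hO (match_out fe)).
- have [|g gK g'K] := @match_in_bij _ _ _ (outidx J \o inr) (inidx G \o inl) T_inj.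
    by move=> y; exact: T_surj.
  by exists (inr \o g) => [[x|x]|x] //=; rewrite gK.
- exists inl => // -[f|fe] //=; by case: (hO (match_out fe)).
- by apply: match_in_bij => // y; exact: T_surj.
- exact: nilB.
- move=> [[[e|e]|fe]|[f|fe]] //=; by case: (hO (match_out fe)).
- move=> [[[e|e]|fe]|[f|fe]] //=; by case: (hO (match_out fe)).
- by move=> [[e|fe]|fe] //=; rewrite hT; exact: (esym (congr1 (@nat_of_ord _) (matchP fe))).
- by move=> [[f|fe]|fe] //=; case: (hO (match_out fe)).
Qed.

Lemma vcomp_idg k l (G : graph k l) (J : graph l l) :
  id_like J -> giso (vcompg J G) G.
Proof.
move=> [hV hE hI hO hL hT].
pose nil (A B : Type) (h : A -> False) (x : B + A) : B :=
  match x with inr a => False_rect _ (h a) | inl b => b end.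
have nilB A B h : bijective (@nil A B h) by exists inl => [[]|].
have T_surj i : exists x, i = inidx J (inr x).
  by have [g _ gK] := inidx_bij J; case: (g i) (gK i) => x <-; [case: (hI x)|exists x].
have T_inj : injective (inidx J \o inr) by apply: inj_comp (bij_inj (inidx_bij J)) _ => x y [].
pose fE (x : edge (vcompg J G)) : edge G := match x with
  | inl (inr e) => False_rect _ (hE e) | inl (inl e) => e
  | inr fe => False_rect _ (hI (match_in fe)) end.
pose fI (x : inp (vcompg J G)) : inp G := match x with
  | inl f => f | inr fe => False_rect _ (hI (match_in fe)) end.
exists (@nil _ _ hV), fE, fI, (fun x => match x with
  | inl e => False_rect _ (hO e) | inr fe => match_out fe end),
  (@match_out _ _ _ _ _), (@nil _ _ hL).
split; rewrite /=.
- exact: nilB.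
- exists (fun e => inl (inl e)) => // -[[e|e]|fe] //=.
  by case: (hI (match_in fe)).
- exists inl => // -[f|fe] //=; by case: (hI (match_in fe)).
- have [|g gK g'K] := @match_out_bij _ _ _ (outidx G \o inl) (inidx J \o inr) T_inj.
    by move=> y; exact: T_surj.
  by exists (inr \o g) => [[x|x]|x] //=; rewrite gK.
- by apply: match_out_bij => // y; exact: T_surj.
- exact: nilB.
- move=> [[[e|e]|fe]|[f|fe]] //=; by case: (hI (match_in fe)).
- move=> [[[e|e]|fe]|[f|fe]] //=; by case: (hI (match_in fe)).
- by move=> [[f|fe]|fe] //=; case: (hI (match_in fe)).
- by move=> [[e|fe]|fe] //=; rewrite -hT; exact: (congr1 (@nat_of_ord _) (matchP fe)).
Qed.

Section VcompA.
Variables (k l m n : nat).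
Variables (G'' : graph m n) (G' : graph l m) (G : graph k l).

Let L := vcompg (vcompg G'' G') G.
Let R := vcompg G'' (vcompg G' G).

Definition vcompA_edge (x : edge R) : edge L :=
  match x with
  | inl (inl (inl (inl e))) => inl (inl e)
  | inl (inl (inl (inr e))) => inl (inr (inl (inl e)))
  | inl (inl (inr (exist (f, i) p))) => inr (exist _ (f, inl i) p)
  | inl (inr e) => inl (inr (inl (inr e)))
  | inr (exist (inl f, i) p) => inl (inr (inr (exist _ (f, i) p)))
  | inr (exist (inr (exist (f, e) p), i) q) =>
      inr (exist _ (f, inr (exist _ (e, i) q)) p)
  end.

Definition vcompA_edge' (x : edge L) : edge R :=
  match x with
  | inl (inl e) => inl (inl (inl (inl e)))
  | inl (inr (inl (inl e))) => inl (inl (inl (inr e)))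
  | inr (exist (f, inl i) p) => inl (inl (inr (exist _ (f, i) p)))
  | inl (inr (inl (inr e))) => inl (inr e)
  | inl (inr (inr (exist (f, i) p))) => inr (exist _ (inl f, i) p)
  | inr (exist (f, inr (exist (e, i) q)) p) =>
      inr (exist _ (inr (exist _ (f, e) p), i) q)
  end.

Definition vcompA_inp (x : inp R) : inp L :=
  match x with
  | inl (inl i) => inl i
  | inl (inr (exist (f, i) p)) => inr (exist _ (f, inl i) p)
  | inr (exist (exist (f, e) p, i) q) =>
      inr (exist _ (f, inr (exist _ (e, i) q)) p)
  end.

Definition vcompA_inp' (x : inp L) : inp R :=
  match x with
  | inl i => inl (inl i)
  | inr (exist (f, inl i) p) => inl (inr (exist _ (f, i) p))
  | inr (exist (f, inr (exist (e, i) q)) p) =>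
      inr (exist _ (exist _ (f, e) p, i) q)
  end.

Definition vcompA_outp (x : outp R) : outp L :=
  match x with
  | inl f => inl (inl f)
  | inr (exist (inl f, i) p) => inl (inr (exist _ (f, i) p))
  | inr (exist (inr (exist (f, e) p), i) q) =>
      inr (exist _ (f, exist _ (e, i) q) p)
  end.

Definition vcompA_outp' (x : outp L) : outp R :=
  match x with
  | inl (inl f) => inl f
  | inl (inr (exist (f, i) p)) => inr (exist _ (inl f, i) p)
  | inr (exist (f, exist (e, i) q) p) =>
      inr (exist _ (inr (exist _ (f, e) p), i) q)
  end.

Definition vcompA_thru (x : thru R) : thru L :=
  match x with
  | exist (exist (f, e) p, i) q => exist _ (f, exist _ (e, i) q) p
  end.

Definition vcompA_thru' (x : thru L) : thru R :=
  match x with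
  | exist (f, exist (e, i) q) p => exist _ (exist _ (f, e) p, i) q
  end.

Lemma vcompgA : giso (vcompg G'' (vcompg G' G)) (vcompg (vcompg G'' G') G).
Proof.
exists (@sumA' _ _ _), vcompA_edge, vcompA_inp, vcompA_outp, vcompA_thru,
  (@sumA' _ _ _); split.
- by exists (@sumA _ _ _); gcases.
- by exists vcompA_edge'; gcases.
- by exists vcompA_inp'; gcases.
- by exists vcompA_outp'; gcases.
- by exists vcompA_thru'; gcases.
- by exists (@sumA _ _ _); gcases.
all: by gcases.
Qed.

End VcompA.

Section MatchedSum.
Variables (m n : nat) (A B A' B' : Set).
Variables (b : A -> 'I_m) (a : B -> 'I_m) (b' : A' -> 'I_n) (a' : B' -> 'I_n).
Variables (bb : A + A' -> 'I_(m + n)) (aa : B + B' -> 'I_(m + n)).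
Hypothesis hb : forall x, bb (inl x) = lshift n (b x).
Hypothesis hb' : forall x, bb (inr x) = rshift m (b' x).
Hypothesis ha : forall x, aa (inl x) = lshift n (a x).
Hypothesis ha' : forall x, aa (inr x) = rshift m (a' x).

Lemma matched_suml (x : matched b a) :
  bb (inl (match_out x)) == aa (inl (match_in x)).
Proof. by rewrite hb ha matchP. Qed.

Lemma matched_sumr (x : matched b' a') :
  bb (inr (match_out x)) == aa (inr (match_in x)).
Proof. by rewrite hb' ha' matchP. Qed.

Definition matched_sum (x : matched b a + matched b' a') : matched bb aa :=
  match x with
  | inl x => exist (fun fe => bb (fst fe) == aa (snd fe))
               (inl (match_out x), inl (match_in x)) (matched_suml x)
  | inr x => exist (fun fe => bb (fst fe) == aa (snd fe))
               (inr (match_out x), inr (match_in x)) (matched_sumr x)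
  end.

Lemma matched_sum_bij : bijective matched_sum.
Proof.
apply: inj_surj_bij => [x y e|[[x y] p]].
  have := congr1 (@match_out _ _ _ _ _) e; have := congr1 (@match_in _ _ _ _ _) e.
  by case: x y {e} => x [] y // [ei] [eo]; congr (_ _); apply: matched_eq.
case: x y p => [x|x] [y|y] p.
- have q : b x == a y by rewrite -(eq_lshift n) -hb -ha.
  by exists (inl (exist _ (x, y) q)); apply: matched_eq.
- by exfalso; move: p; rewrite /= hb ha' eq_lrshift.
- by exfalso; move: p; rewrite /= hb' ha eq_rlshift.
- have q : b' x == a' y by rewrite -(eq_rshift m) -hb' -ha'.
  by exists (inr (exist _ (x, y) q)); apply: matched_eq.
Qed.

End MatchedSum.

Definition sumACA (A B C D : Type) (x : (A + B) + (C + D)) : (A + C) + (B + D) :=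
  match x with
  | inl (inl a) => inl (inl a)
  | inl (inr b) => inr (inl b)
  | inr (inl c) => inl (inr c)
  | inr (inr d) => inr (inr d)
  end.

Lemma sumACA_bij (A B C D : Type) : bijective (@sumACA A B C D).
Proof. by exists (@sumACA A C B D); gcases. Qed.

Lemma interchangeg k l m k' l' m' (P : graph l m) (Q : graph k l)
    (P' : graph l' m') (Q' : graph k' l') :
  giso (vcompg (hcompg P P') (hcompg Q Q')) (hcompg (vcompg P Q) (vcompg P' Q')).
Proof.
apply: giso_sym.
pose OI := @matched_sum l l' _ _ _ _ (outidx Q \o inl) (inidx P \o inl)
  (outidx Q' \o inl) (inidx P' \o inl) (outidx (hcompg Q Q') \o inl)
  (inidx (hcompg P P') \o inl) (fun=> erefl) (fun=> erefl) (fun=> erefl) (fun=> erefl).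
pose OT := @matched_sum l l' _ _ _ _ (outidx Q \o inl) (inidx P \o inr)
  (outidx Q' \o inl) (inidx P' \o inr) (outidx (hcompg Q Q') \o inl)
  (inidx (hcompg P P') \o inr) (fun=> erefl) (fun=> erefl) (fun=> erefl) (fun=> erefl).
pose TI := @matched_sum l l' _ _ _ _ (outidx Q \o inr) (inidx P \o inl)
  (outidx Q' \o inr) (inidx P' \o inl) (outidx (hcompg Q Q') \o inr)
  (inidx (hcompg P P') \o inl) (fun=> erefl) (fun=> erefl) (fun=> erefl) (fun=> erefl).
pose TT := @matched_sum l l' _ _ _ _ (outidx Q \o inr) (inidx P \o inr)
  (outidx Q' \o inr) (inidx P' \o inr) (outidx (hcompg Q Q') \o inr)
  (inidx (hcompg P P') \o inr) (fun=> erefl) (fun=> erefl) (fun=> erefl) (fun=> erefl).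
exists (@sumACA _ _ _ _),
  (fun x => sum_map (@sumACA _ _ _ _) OI (sumACA x)),
  (fun x => sum_map id TI (sumACA x)), (fun x => sum_map id OT (sumACA x)),
  TT, (@sumACA _ _ _ _).
have id_bij T : bijective (@id T) by exists id.
split; rewrite /=.
- exact: sumACA_bij.
- apply: (@bij_comp _ _ _ (sum_map (@sumACA _ _ _ _) OI) (@sumACA _ _ _ _)).
    by apply: sum_map_bij; [exact: sumACA_bij|exact: matched_sum_bij].
  exact: sumACA_bij.
- apply: (@bij_comp _ _ _ (sum_map id TI) (@sumACA _ _ _ _)).
    by apply: sum_map_bij => //; exact: matched_sum_bij.
  exact: sumACA_bij.
- apply: (@bij_comp _ _ _ (sum_map id OT) (@sumACA _ _ _ _)).
    by apply: sum_map_bij => //; exact: matched_sum_bij.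
  exact: sumACA_bij.
- exact: matched_sum_bij.
- exact: sumACA_bij.
all: by gcases.
Qed.

Lemma lactg_vcompg k l m (s : 'S_m) (P : graph l m) (Q : graph k l) :
  giso (lactg s (vcompg P Q)) (vcompg (lactg s P) Q).
Proof.
exists id, id, id, id, id, id; split; try by exists id.
all: by gcases.
Qed.

Lemma ractg_vcompg k l m (P : graph l m) (Q : graph k l) (t : 'S_k) :
  giso (ractg (vcompg P Q) t) (vcompg P (ractg Q t)).
Proof.
exists id, id, id, id, id, id; split; try by exists id.
all: by gcases.
Qed.

Lemma vcompg_act k l m (P : graph l m) (t : 'S_l) (Q : graph k l) :
  giso (vcompg (ractg P t) Q) (vcompg P (lactg t Q)).
Proof.
have H (i j : 'I_l) : i = (t^-1)%g j -> t i = j by move=> ->; rewrite permKV.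
have H' (i j : 'I_l) : t i = j -> i = (t^-1)%g j by move=> <-; rewrite permK.
pose OI := @matched_map _ _ _ _ _ _ (outidx Q \o inl) (inidx (ractg P t) \o inl)
  (outidx (lactg t Q) \o inl) (inidx P \o inl) id id (fun x y => @H _ _).
pose OT := @matched_map _ _ _ _ _ _ (outidx Q \o inl) (inidx (ractg P t) \o inr)
  (outidx (lactg t Q) \o inl) (inidx P \o inr) id id (fun x y => @H _ _).
pose TI := @matched_map _ _ _ _ _ _ (outidx Q \o inr) (inidx (ractg P t) \o inl)
  (outidx (lactg t Q) \o inr) (inidx P \o inl) id id (fun x y => @H _ _).
pose TT := @matched_map _ _ _ _ _ _ (outidx Q \o inr) (inidx (ractg P t) \o inr)
  (outidx (lactg t Q) \o inr) (inidx P \o inr) id id (fun x y => @H _ _).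
have id_bij T : bijective (@id T) by exists id.
exists id, (sum_map id OI), (sum_map id TI), (sum_map id OT), TT, id.
split; rewrite /= //.
- by apply: sum_map_bij => //; apply: matched_map_bij => // x y; apply: H'.
- by apply: sum_map_bij => //; apply: matched_map_bij => // x y; apply: H'.
- by apply: sum_map_bij => //; apply: matched_map_bij => // x y; apply: H'.
- by apply: matched_map_bij => // x y; apply: H'.
all: by gcases.
Qed.

Lemma lactg_hcompg k l k' l' (s : 'S_l) (s' : 'S_l') (P : graph k l)
    (P' : graph k' l') :
  giso (hcompg (lactg s P) (lactg s' P'))
       (lactg (tensor_perm s s') (hcompg P P')).
Proof.
exists id, id, id, id, id, id; split; try by exists id.
all: by move=> [[x|x]|[x|x]] //=; rewrite ?tensor_perm_lshift ?tensor_perm_rshift.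
Qed.

Lemma ractg_hcompg k l k' l' (P : graph k l) (P' : graph k' l') (t : 'S_k)
    (t' : 'S_k') :
  giso (hcompg (ractg P t) (ractg P' t'))
       (ractg (hcompg P P') (tensor_perm t t')).
Proof.
exists id, id, id, id, id, id; split; try by exists id.
all: by move=> [[x|x]|[x|x]] //=;
  rewrite ?tensor_permV ?tensor_perm_lshift ?tensor_perm_rshift.
Qed.

Lemma swapg k l k' l' (P : graph k l) (P' : graph k' l')
    (H : graph (k + k') (l + l')) :
  giso (hcompg P' P) H ->
  giso (lactg (swap_perm l l') (hcompg P P')) (ractg H (swap_perm k k')).
Proof.
move=> [fV [fE [fI [fO [fT [fL [bV bE bI bO bT bL Hs Ht Hi Ho]]]]]]].
exists (fV \o @sumC _ _), (fE \o @sumC _ _), (fI \o @sumC _ _),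
  (fO \o @sumC _ _), (fT \o @sumC _ _), (fL \o @sumC _ _).
split; try by apply: bij_comp => //; exact: sumC_bij.
- move=> x; have := Hs (sum_map (@sumC _ _) (@sumC _ _) x).
  by case: x => [[x|x]|[x|x]].
- move=> x; have := Ht (sum_map (@sumC _ _) (@sumC _ _) x).
  by case: x => [[x|x]|[x|x]].
- move=> x.
  congr nat_of_ord; apply: (@perm_inj _ (swap_perm k k')); rewrite permKV.
  apply: val_inj => /=.
  have -> : inidx H (sum_map (fI \o @sumC _ _) (fT \o @sumC _ _) x) =
    inidx (hcompg P' P) (sum_map (@sumC _ _) (@sumC _ _) x) :> nat.
    by rewrite -Hi; case: x => [[x|x]|[x|x]].
  by case: x => [[x|x]|[x|x]] /=;
    rewrite ?swap_perm_lshift ?swap_perm_rshift.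
- move=> x.
  have -> : outidx (ractg H (swap_perm k k'))
      (sum_map (fO \o @sumC _ _) (fT \o @sumC _ _) x) =
    outidx (hcompg P' P) (sum_map (@sumC _ _) (@sumC _ _) x) :> nat.
    by rewrite -Ho; case: x => [[x|x]|[x|x]].
  by case: x => [[x|x]|[x|x]] /=;
    rewrite ?swap_perm_lshift ?swap_perm_rshift.
Qed.

Section ProPs.
Variable K : fieldType.

(* Products in 'S_n compose from left to right: (t * s)%g is the composite
   "s after t", whence the apparent reversal in [lactM] and [ractM]. *)
Record SSmodule := {
  ss_carrier :> nat -> nat -> lmodType K;
  lact : forall k l, 'S_l -> ss_carrier k l -> ss_carrier k l;
  ract : forall k l, ss_carrier k l -> 'S_k -> ss_carrier k l;
  lact_linear : forall k l s, linear (@lact k l s);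
  ract_linear : forall k l t, linear ((@ract k l)^~ t);
  lact1 : forall k l p, @lact k l 1%g p = p;
  lactM : forall k l s t p, @lact k l (t * s)%g p = lact s (lact t p);
  ract1 : forall k l p, @ract k l p 1%g = p;
  ractM : forall k l s t p, @ract k l p (t * s)%g = ract (ract p s) t;
  lractC : forall k l s t p, lact s (@ract k l p t) = ract (lact s p) t
}.

Arguments lact {_ _ _}.
Arguments ract {_ _ _}.

Definition cast2 (P : SSmodule) k l k' l' (ek : k = k') (el : l = l')
    (p : P k l) : P k' l' :=
  ecast j (P k' j) el (ecast i (P i l) ek p).

Record ProP_ops := {
  ops_module :> SSmodule;
  hcomp : forall k l k' l', ops_module k l -> ops_module k' l' ->
    ops_module (k + k') (l + l');
  vcomp : forall k l m, ops_module l m -> ops_module k l -> ops_module k m;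
  unit0 : ops_module 0 0;
  unit1 : ops_module 1 1
}.

Arguments hcomp {_ _ _ _ _}.
Arguments vcomp {_ _ _ _}.
Arguments unit0 {_}.
Arguments unit1 {_}.

Fixpoint unitn (P : ProP_ops) n : P n n :=
  if n is n'.+1 then hcomp unit1 (unitn P n') else unit0.

Record is_ProP (P : ProP_ops) : Prop := {
  hcomp_linl : forall k l k' l' (q : P k' l'),
    linear (fun p : P k l => hcomp p q);
  hcomp_linr : forall k l k' l' (p : P k l),
    linear (fun q : P k' l' => hcomp p q);
  hcompA : forall k l k' l' k'' l'' (p : P k l) (q : P k' l') (r : P k'' l''),
    cast2 (addnA k k' k'') (addnA l l' l'') (hcomp p (hcomp q r))
      = hcomp (hcomp p q) r;
  hcomp0p : forall k l (p : P k l), hcomp unit0 p = p;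
  hcompp0 : forall k l (p : P k l),
    cast2 (addn0 k) (addn0 l) (hcomp p unit0) = p;
  vcomp_linl : forall k l m (q : P k l), linear (fun p : P l m => vcomp p q);
  vcomp_linr : forall k l m (p : P l m), linear (fun q : P k l => vcomp p q);
  vcompA : forall k l m n (p : P m n) (q : P l m) (r : P k l),
    vcomp p (vcomp q r) = vcomp (vcomp p q) r;
  vcompp1 : forall k l (p : P k l), vcomp p (unitn P k) = p;
  vcomp1p : forall k l (p : P k l), vcomp (unitn P l) p = p;
  interchange : forall k l m k' l' m' (p : P l m) (p' : P l' m') (q : P k l)
      (q' : P k' l'),
    vcomp (hcomp p p') (hcomp q q') = hcomp (vcomp p q) (vcomp p' q');
  lact_vcomp : forall k l m s (p : P l m) (q : P k l),
    lact s (vcomp p q) = vcomp (lact s p) q;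
  ract_vcomp : forall k l m (p : P l m) (q : P k l) t,
    ract (vcomp p q) t = vcomp p (ract q t);
  vcomp_act : forall k l m (p : P l m) t (q : P k l),
    vcomp (ract p t) q = vcomp p (lact t q);
  lact_hcomp : forall k l k' l' s s' (p : P k l) (p' : P k' l'),
    hcomp (lact s p) (lact s' p') = lact (tensor_perm s s') (hcomp p p');
  ract_hcomp : forall k l k' l' (p : P k l) (p' : P k' l') t t',
    hcomp (ract p t) (ract p' t') = ract (hcomp p p') (tensor_perm t t');
  hcompC : forall k l k' l' (p : P k l) (p' : P k' l'),
    lact (swap_perm l l') (hcomp p p')
      = ract (cast2 (addnC k' k) (addnC l' l) (hcomp p' p)) (swap_perm k k')
}.

Record ProP := { prop_ops :> ProP_ops; ProP_axioms : is_ProP prop_ops }.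

Record SS_morphism (M N : SSmodule) (f : forall k l, M k l -> N k l) : Prop := {
  ss_mor_linear : forall k l, linear (@f k l);
  ss_mor_lact : forall k l s (x : M k l), f k l (lact s x) = lact s (f k l x);
  ss_mor_ract : forall k l (x : M k l) t, f k l (ract x t) = ract (f k l x) t
}.

Record ProP_morphism (P Q : ProP) (f : forall k l, P k l -> Q k l) : Prop := {
  prop_mor_ss :> SS_morphism f;
  prop_mor_hcomp : forall k l k' l' (p : P k l) (q : P k' l'),
    f _ _ (hcomp p q) = hcomp (f k l p) (f k' l' q);
  prop_mor_vcomp : forall k l m (p : P l m) (q : P k l),
    f _ _ (vcomp p q) = vcomp (f l m p) (f k l q);
  prop_mor_unit0 : f 0 0 unit0 = unit0;
  prop_mor_unit1 : f 1 1 unit1 = unit1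
}.

End ProPs.

Arguments lact {_ _ _ _}.
Arguments ract {_ _ _ _}.
Arguments hcomp {_ _ _ _ _ _}.
Arguments vcomp {_ _ _ _ _}.
Arguments unit0 {_ _}.
Arguments unit1 {_ _}.

HB.instance Definition _ k l := gen_eqMixin (graph k l).
HB.instance Definition _ k l := gen_choiceMixin (graph k l).

Definition giso_rel k l : rel (graph k l) := fun G H => `[< giso G H >].

Lemma giso_rel_refl k l : reflexive (@giso_rel k l).
Proof. by move=> G; apply/asboolP/giso_refl. Qed.

Lemma giso_rel_sym k l : symmetric (@giso_rel k l).
Proof. by move=> G H; apply/asboolP/asboolP; apply: giso_sym. Qed.

Lemma giso_rel_trans k l : transitive (@giso_rel k l).
Proof.
by move=> G H J /asboolP GH /asboolP HJ; apply/asboolP/(giso_trans GH).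
Qed.

Canonical giso_equiv k l :=
  EquivRel (@giso_rel k l) (@giso_rel_refl k l) (@giso_rel_sym k l)
    (@giso_rel_trans k l).

Definition isoclass k l := {eq_quot (@giso_rel k l)}.
HB.instance Definition _ k l := Quotient.on (isoclass k l).
HB.instance Definition _ k l := Choice.on (isoclass k l).
HB.instance Definition _ k l : EqQuotient _ (@giso_rel k l) (isoclass k l) :=
  EqQuotient.on (isoclass k l).

Definition iso_class k l (G : graph k l) : isoclass k l := \pi_(isoclass k l) G.

Lemma iso_classP k l (G H : graph k l) : iso_class G = iso_class H <-> giso G H.
Proof. by split=> [/eqquotP/asboolP|GH]; last exact/eqquotP/asboolP. Qed.

Section GraphProP.
Variable K : fieldType.

Definition gr (k l : nat) : lmodType K := {freeg (isoclass k l) / K}.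

Definition graph_vec k l (G : graph k l) : gr k l := Freeg [:: (1, iso_class G)].

Lemma graph_vec_eq k l (G H : graph k l) :
  giso G H -> graph_vec G = graph_vec H.
Proof. by move=> /iso_classP; rewrite /graph_vec => ->. Qed.

Definition lin_ext k l (M : lmodType K) (f : isoclass k l -> M) (x : gr k l) : M :=
  @fglift K M (isoclass k l) f x.

Lemma lin_ext_linear k l (M : lmodType K) (f : isoclass k l -> M) :
  linear (lin_ext f).
Proof.
rewrite /lin_ext.
have addf x y : fglift f (x + y) = fglift f x + fglift f y.
  have addN u v := lift_is_additive f u v.
  have N0 : fglift f 0 = 0 by rewrite -[X in fglift f X](subrr 0) addN subrr.
  have N u : fglift f (- u) = - fglift f u by rewrite -[- u]add0r addN N0 add0r.
  by rewrite -{1}[y]opprK addN N opprK.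
have f0 : fglift f 0 = 0.
  by apply: (addrI (fglift f 0)); rewrite -addf !addr0.
move=> a x y; rewrite addf; congr (_ + _).
rewrite -[x in LHS]freeg_sumE -[x in RHS]freeg_sumE.
rewrite scaler_sumr !(big_morph _ addf f0) scaler_sumr.
apply: eq_bigr => z _.
have -> : a *: Freeg [:: (coeff z x, z)] = Freeg [:: (a * coeff z x, z)].
  by apply/eqP/freeg_eqP => c; rewrite coeffZ !coeffU mulrA.
by rewrite !liftU scalerA.
Qed.

Lemma lin_ext_vec k l (M : lmodType K) (f : isoclass k l -> M) (G : graph k l) :
  lin_ext f (graph_vec G) = f (iso_class G).
Proof. by rewrite /lin_ext fglift_Freeg prelift_seq1 scale1r. Qed.

Lemma gr_sumE k l (x : gr k l) : exists s : seq (K * graph k l),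
  x = \sum_(c <- s) c.1 *: graph_vec c.2.
Proof.
exists [seq (coeff z x, repr z) | z <- dom x]; rewrite big_map /=.
rewrite -[x in LHS]freeg_sumE; apply: eq_bigr => z _.
apply/eqP/freeg_eqP => c; rewrite coeffZ !coeffU mul1r.
by rewrite /iso_class reprK.
Qed.

Lemma linear_sum_eq k l (M : lmodType K) (f : gr k l -> M) : linear f ->
  forall s : seq (K * graph k l), f (\sum_(c <- s) c.1 *: graph_vec c.2)
    = \sum_(c <- s) c.1 *: f (graph_vec c.2).
Proof.
move=> lf s; have f0 : f 0 = 0.
  have := lf 0 0 0; rewrite !scale0r !addr0 add0r => <-.
  by have := lf (- 1) 0 0; rewrite scaler0 addr0 scaleN1r addNr.
elim: s => [|c s IH]; first by rewrite !big_nil.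
by rewrite !big_cons lf IH.
Qed.

Lemma gr_ext k l (M : lmodType K) (f g : gr k l -> M) :
  linear f -> linear g -> (forall G, f (graph_vec G) = g (graph_vec G)) ->
  f =1 g.
Proof.
move=> lf lg fg x; have [s ->] := gr_sumE x.
by rewrite !linear_sum_eq //; apply: eq_bigr => c _; rewrite fg.
Qed.

Lemma linear_comp (U V W : lmodType K) (f : V -> W) (g : U -> V) :
  linear f -> linear g -> linear (fun x => f (g x)).
Proof. by move=> lf lg a x y; rewrite lg lf. Qed.

Lemma linear_id (U : lmodType K) : linear (fun x : U => x).
Proof. by []. Qed.

Definition gr_lact k l (s : 'S_l) (x : gr k l) : gr k l :=
  lin_ext (fun c => graph_vec (lactg s (repr c))) x.

Definition gr_ract k l (x : gr k l) (t : 'S_k) : gr k l :=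
  lin_ext (fun c => graph_vec (ractg (repr c) t)) x.

Definition gr_hcomp k l k' l' (x : gr k l) (y : gr k' l') :
    gr (k + k') (l + l') :=
  lin_ext (fun c => lin_ext (fun d => graph_vec (hcompg (repr c) (repr d))) y) x.

Definition gr_vcomp k l m (x : gr l m) (y : gr k l) : gr k m :=
  lin_ext (fun c => lin_ext (fun d => graph_vec (vcompg (repr c) (repr d))) y) x.

Lemma repr_iso_class k l (G : graph k l) : giso (repr (iso_class G)) G.
Proof. by apply/iso_classP; rewrite [in LHS]/iso_class reprK. Qed.

Lemma gr_lact_vec k l s (G : graph k l) :
  gr_lact s (graph_vec G) = graph_vec (lactg s G).
Proof.
rewrite /gr_lact lin_ext_vec; apply: graph_vec_eq.
exact/giso_lactg/repr_iso_class.
Qed.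

Lemma gr_ract_vec k l t (G : graph k l) :
  gr_ract (graph_vec G) t = graph_vec (ractg G t).
Proof.
rewrite /gr_ract lin_ext_vec; apply: graph_vec_eq.
exact/giso_ractg/repr_iso_class.
Qed.

Lemma gr_hcomp_vec k l k' l' (G : graph k l) (H : graph k' l') :
  gr_hcomp (graph_vec G) (graph_vec H) = graph_vec (hcompg G H).
Proof.
rewrite /gr_hcomp !lin_ext_vec; apply: graph_vec_eq.
by apply: giso_hcompg; exact: repr_iso_class.
Qed.

Lemma gr_vcomp_vec k l m (G : graph l m) (H : graph k l) :
  gr_vcomp (graph_vec G) (graph_vec H) = graph_vec (vcompg G H).
Proof.
rewrite /gr_vcomp !lin_ext_vec; apply: graph_vec_eq.
by apply: giso_vcompg; exact: repr_iso_class.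
Qed.

Lemma gr_lact_linear k l s : linear (@gr_lact k l s).
Proof. exact: lin_ext_linear. Qed.

Lemma gr_ract_linear k l t : linear ((@gr_ract k l)^~ t).
Proof. exact: lin_ext_linear. Qed.

Lemma gr_hcomp_linl k l k' l' (y : gr k' l') :
  linear (fun x : gr k l => gr_hcomp x y).
Proof. exact: lin_ext_linear. Qed.

Lemma lin_ext_linear_fun k l (U M : lmodType K) (f : isoclass k l -> U -> M) x :
  (forall c, linear (f c)) -> linear (fun y => lin_ext (f^~ y) x).
Proof.
move=> lf a y z; have [s ->] := gr_sumE x.
rewrite !(linear_sum_eq (lin_ext_linear _)) scaler_sumr -big_split /=.
apply: eq_bigr => c _; rewrite !lin_ext_vec lf scalerDr !scalerA.
by rewrite [a * _]mulrC.
Qed.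

Lemma gr_hcomp_linr k l k' l' (x : gr k l) :
  linear (fun y : gr k' l' => gr_hcomp x y).
Proof. by apply: lin_ext_linear_fun => c; exact: lin_ext_linear. Qed.

Lemma gr_vcomp_linl k l m (y : gr k l) :
  linear (fun x : gr l m => gr_vcomp x y).
Proof. exact: lin_ext_linear. Qed.

Lemma gr_vcomp_linr k l m (x : gr l m) :
  linear (fun y : gr k l => gr_vcomp x y).
Proof. by apply: lin_ext_linear_fun => c; exact: lin_ext_linear. Qed.

Lemma gr_lact1 k l (x : gr k l) : gr_lact 1%g x = x.
Proof.
move: x; apply: gr_ext; [exact: gr_lact_linear|exact: linear_id|move=> G].
by rewrite gr_lact_vec; apply/graph_vec_eq/lactg1.
Qed.

Lemma gr_lactM k l s t (x : gr k l) :
  gr_lact (t * s)%g x = gr_lact s (gr_lact t x).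
Proof.
move: x; apply: gr_ext.
- exact: gr_lact_linear.
- exact: (linear_comp (gr_lact_linear s) (gr_lact_linear t)).
by move=> G; rewrite !gr_lact_vec; apply/graph_vec_eq/lactgM.
Qed.

Lemma gr_ract1 k l (x : gr k l) : gr_ract x 1%g = x.
Proof.
move: x; apply: gr_ext; [exact: gr_ract_linear|exact: linear_id|move=> G].
by rewrite gr_ract_vec; apply/graph_vec_eq/ractg1.
Qed.

Lemma gr_ractM k l s t (x : gr k l) :
  gr_ract x (t * s)%g = gr_ract (gr_ract x s) t.
Proof.
move: x; apply: gr_ext.
- exact: gr_ract_linear.
- exact: (linear_comp (gr_ract_linear t) (gr_ract_linear s)).
by move=> G; rewrite !gr_ract_vec; apply/graph_vec_eq/ractgM.
Qed.

Lemma gr_lractC k l s t (x : gr k l) :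
  gr_lact s (gr_ract x t) = gr_ract (gr_lact s x) t.
Proof.
move: x; apply: gr_ext.
- exact: (linear_comp (gr_lact_linear s) (gr_ract_linear t)).
- exact: (linear_comp (gr_ract_linear t) (gr_lact_linear s)).
move=> G; rewrite gr_lact_vec !gr_ract_vec gr_lact_vec.
exact/graph_vec_eq/lractgC.
Qed.

Definition gr_SSmodule : SSmodule K := {|
  lact_linear := gr_lact_linear;
  ract_linear := gr_ract_linear;
  lact1 := gr_lact1;
  lactM := gr_lactM;
  ract1 := gr_ract1;
  ractM := gr_ractM;
  lractC := gr_lractC
|}.

Definition gr_ops : ProP_ops K := {|
  ops_module := gr_SSmodule;
  hcomp := gr_hcomp;
  vcomp := gr_vcomp;
  unit0 := graph_vec empty_graph;
  unit1 := graph_vec edge_graph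
|}.

Lemma gr_unitn n : unitn gr_ops n = graph_vec (id_graph n).
Proof. by elim: n => //= n ->; rewrite [LHS]gr_hcomp_vec. Qed.

Lemma gr_cast_vec k l k' l' (ek : k = k') (el : l = l') (G : graph k l)
    (H : graph k' l') :
  giso G H -> @cast2 K gr_SSmodule _ _ _ _ ek el (graph_vec G) = graph_vec H.
Proof.
case: k' / ek H; case: l' / el => H; exact: graph_vec_eq.
Qed.

Lemma cast2_linear (M : SSmodule K) k l k' l' (ek : k = k') (el : l = l') :
  linear (@cast2 K M _ _ _ _ ek el).
Proof. by case: k' / ek; case: l' / el. Qed.

Lemma cast2_giso k l k' l' (ek : k = k') (el : l = l') (G : graph k l) :
  exists H : graph k' l', giso G H.
Proof. by case: k' / ek; case: l' / el; exists G; exact: giso_refl. Qed.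

Lemma gr_is_ProP : is_ProP gr_ops.
Proof.
split=> /=.
- exact: gr_hcomp_linl.
- exact: gr_hcomp_linr.
- move=> k l k' l' k'' l'' p q r; set ek := addnA _ _ _; set el := addnA _ _ _.
  have lc := @cast2_linear gr_SSmodule _ _ _ _ ek el.
  move: r; apply: gr_ext => [||H3].
  + exact: (linear_comp lc (linear_comp (gr_hcomp_linr p) (gr_hcomp_linr q))).
  + exact: gr_hcomp_linr.
  move: q; apply: gr_ext => [||H2].
  + exact: (linear_comp lc (linear_comp (gr_hcomp_linr p) (gr_hcomp_linl _))).
  + exact: (linear_comp (gr_hcomp_linl _) (gr_hcomp_linr p)).
  move: p; apply: gr_ext => [||H1].
  + exact: (linear_comp lc (gr_hcomp_linl _)).
  + exact: (linear_comp (gr_hcomp_linl _) (gr_hcomp_linl _)).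
  by rewrite !gr_hcomp_vec; apply/gr_cast_vec/hcompgA.
- move=> k l; apply: gr_ext; [exact: gr_hcomp_linr|exact: linear_id|move=> G].
  by rewrite gr_hcomp_vec; apply/graph_vec_eq/hcompg0.
- move=> k l; set ek := addn0 _; set el := addn0 _.
  have lc := @cast2_linear gr_SSmodule _ _ _ _ ek el.
  apply: gr_ext; [|exact: linear_id|move=> G].
    exact: (linear_comp lc (gr_hcomp_linl _)).
  by rewrite gr_hcomp_vec; apply/gr_cast_vec/hcomp0g.
- exact: gr_vcomp_linl.
- exact: gr_vcomp_linr.
- move=> k l m n p q r.
  move: r; apply: gr_ext => [||H3].
  + exact: (linear_comp (gr_vcomp_linr p) (gr_vcomp_linr q)).
  + exact: gr_vcomp_linr.
  move: q; apply: gr_ext => [||H2].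
  + exact: (linear_comp (gr_vcomp_linr p) (gr_vcomp_linl _)).
  + exact: (linear_comp (gr_vcomp_linl _) (gr_vcomp_linr p)).
  move: p; apply: gr_ext => [||H1].
  + exact: gr_vcomp_linl.
  + exact: (linear_comp (gr_vcomp_linl _) (gr_vcomp_linl _)).
  by rewrite !gr_vcomp_vec; apply/graph_vec_eq/vcompgA.
- move=> k l; rewrite gr_unitn.
  apply: gr_ext; [exact: gr_vcomp_linl|exact: linear_id|move=> G].
  by rewrite gr_vcomp_vec; apply/graph_vec_eq/vcompg_id/id_graphP.
- move=> k l; rewrite gr_unitn.
  apply: gr_ext; [exact: gr_vcomp_linr|exact: linear_id|move=> G].
  by rewrite gr_vcomp_vec; apply/graph_vec_eq/vcomp_idg/id_graphP.
- move=> k l m k' l' m' p p' q q'.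
  move: q'; apply: gr_ext => [||G4].
  + exact: (linear_comp (gr_vcomp_linr _) (gr_hcomp_linr _)).
  + exact: (linear_comp (gr_hcomp_linr _) (gr_vcomp_linr _)).
  move: q; apply: gr_ext => [||G3].
  + exact: (linear_comp (gr_vcomp_linr _) (gr_hcomp_linl _)).
  + exact: (linear_comp (gr_hcomp_linl _) (gr_vcomp_linr _)).
  move: p'; apply: gr_ext => [||G2].
  + exact: (linear_comp (gr_vcomp_linl _) (gr_hcomp_linr _)).
  + exact: (linear_comp (gr_hcomp_linr _) (gr_vcomp_linl _)).
  move: p; apply: gr_ext => [||G1].
  + exact: (linear_comp (gr_vcomp_linl _) (gr_hcomp_linl _)).
  + exact: (linear_comp (gr_hcomp_linl _) (gr_vcomp_linl _)).
  rewrite !(gr_hcomp_vec, gr_vcomp_vec); exact/graph_vec_eq/interchangeg.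
- move=> k l m s p q.
  move: q; apply: gr_ext => [||H2].
  + exact: (linear_comp (gr_lact_linear s) (gr_vcomp_linr p)).
  + exact: gr_vcomp_linr.
  move: p; apply: gr_ext => [||H1].
  + exact: (linear_comp (gr_lact_linear s) (gr_vcomp_linl _)).
  + exact: (linear_comp (gr_vcomp_linl _) (gr_lact_linear s)).
  rewrite !(gr_vcomp_vec, gr_lact_vec); exact/graph_vec_eq/lactg_vcompg.
- move=> k l m p q t.
  move: q; apply: gr_ext => [||H2].
  + exact: (linear_comp (gr_ract_linear t) (gr_vcomp_linr p)).
  + exact: (linear_comp (gr_vcomp_linr _) (gr_ract_linear t)).
  move: p; apply: gr_ext => [||H1].
  + exact: (linear_comp (gr_ract_linear t) (gr_vcomp_linl _)).
  + exact: gr_vcomp_linl.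
  rewrite !(gr_vcomp_vec, gr_ract_vec); exact/graph_vec_eq/ractg_vcompg.
- move=> k l m p t q.
  move: q; apply: gr_ext => [||H2].
  + exact: gr_vcomp_linr.
  + exact: (linear_comp (gr_vcomp_linr _) (gr_lact_linear t)).
  move: p; apply: gr_ext => [||H1].
  + exact: (linear_comp (gr_vcomp_linl _) (gr_ract_linear t)).
  + exact: gr_vcomp_linl.
  rewrite !(gr_vcomp_vec, gr_ract_vec, gr_lact_vec).
  exact/graph_vec_eq/vcompg_act.
- move=> k l k' l' s s' p p'.
  move: p'; apply: gr_ext => [||H2].
  + exact: (linear_comp (gr_hcomp_linr _) (gr_lact_linear s')).
  + exact: (linear_comp (gr_lact_linear _) (gr_hcomp_linr _)).
  move: p; apply: gr_ext => [||H1].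
  + exact: (linear_comp (gr_hcomp_linl _) (gr_lact_linear s)).
  + exact: (linear_comp (gr_lact_linear _) (gr_hcomp_linl _)).
  rewrite !(gr_hcomp_vec, gr_lact_vec); exact/graph_vec_eq/lactg_hcompg.
- move=> k l k' l' p p' t t'.
  move: p'; apply: gr_ext => [||H2].
  + exact: (linear_comp (gr_hcomp_linr _) (gr_ract_linear t')).
  + exact: (linear_comp (gr_ract_linear _) (gr_hcomp_linr _)).
  move: p; apply: gr_ext => [||H1].
  + exact: (linear_comp (gr_hcomp_linl _) (gr_ract_linear t)).
  + exact: (linear_comp (gr_ract_linear _) (gr_hcomp_linl _)).
  rewrite !(gr_hcomp_vec, gr_ract_vec); exact/graph_vec_eq/ractg_hcompg.
- move=> k l k' l' p p'; set ek := addnC _ _; set el := addnC _ _.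
  have lc := @cast2_linear gr_SSmodule _ _ _ _ ek el.
  move: p'; apply: gr_ext => [||H2].
  + exact: (linear_comp (gr_lact_linear _) (gr_hcomp_linr _)).
  + exact: (linear_comp (gr_ract_linear _) (linear_comp lc (gr_hcomp_linl _))).
  move: p; apply: gr_ext => [||H1].
  + exact: (linear_comp (gr_lact_linear _) (gr_hcomp_linl _)).
  + exact: (linear_comp (gr_ract_linear _) (linear_comp lc (gr_hcomp_linr _))).
  rewrite !gr_hcomp_vec gr_lact_vec.
  have [H isoH] := cast2_giso ek el (hcompg H2 H1).
  rewrite (gr_cast_vec ek el isoH) gr_ract_vec.
  exact/graph_vec_eq/swapg.
Qed.

Definition Gr : ProP K := {| ProP_axioms := gr_is_ProP |}.

End GraphProP.

Definition empty_type (T : Type) : Prop := T -> False.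

Definition single_loop k l (G : graph k l) : Prop :=
  [/\ empty_type (vert G), empty_type (edge G), empty_type (inp G),
      empty_type (outp G) & empty_type (thru G)]
  /\ exists x : loop G, forall y, y = x.

(* The graph reduced to a single loop has no vertex, but it is meant to be
   indecomposable: loops are not created by the operations of a ProP, so that
   this graph is a generator.  Hence the alternative in [ind_vert], which makes
   the exception of [ind_loop] effective. *)
Record indecomposable k l (G : graph k l) : Prop := {
  ind_vert : ~ empty_type (vert G) \/ single_loop G;
  ind_thru : empty_type (thru G);
  ind_loop : empty_type (loop G) \/ single_loop G;
  ind_vcomp : forall m (G' : graph m l) (G'' : graph k m),
    giso G (vcompg G' G'') -> empty_type (vert G') \/ empty_type (vert G'');
  ind_hcomp : forall k' l' k'' l'' (G' : graph k' l') (G'' : graph k'' l'')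
      (s : 'S_(l' + l'')) (t : 'S_(k' + k'')),
    giso G (lactg s (ractg (hcompg G' G'') t)) ->
    empty_type (vert G') \/ empty_type (vert G'')
}.

Lemma giso_dim k l k' l' (G : graph k l) (H : graph k' l') :
  giso G H -> k = k' /\ l = l'.
Proof.
move=> [fV [fE [fI [fO [fT [fL [_ _ bI bO bT _ _ _ _ _]]]]]]]; split.
  have [g gK g'K] := inidx_bij G.
  have bg : bijective g by exists (inidx G).
  have := bij_eq_card (bij_comp (inidx_bij H) (bij_comp (sum_map_bij bI bT) bg)).
  by rewrite !card_ord.
have [g gK g'K] := outidx_bij G.
have bg : bijective g by exists (outidx G).
have := bij_eq_card (bij_comp (outidx_bij H) (bij_comp (sum_map_bij bO bT) bg)).
by rewrite !card_ord.
Qed.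

Lemma indecomposable_lactg k l (s : 'S_l) (G : graph k l) :
  indecomposable G -> indecomposable (lactg s G).
Proof.
move=> [hV hT hL hv hh].
have GE (H : graph k l) : giso (lactg s G) H -> giso G (lactg s^-1%g H).
  move=> iG; apply: giso_trans _ (giso_lactg s^-1%g iG).
  apply: giso_sym; apply: giso_trans (giso_sym (lactgM _ _ _)) _.
  by rewrite mulgV; exact: lactg1.
split=> //.
- move=> m G' G'' /GE iG; apply: (hv m (lactg s^-1%g G') G'').
  by apply: giso_trans iG _; exact: lactg_vcompg.
- move=> k' l' k'' l'' G' G'' s' t iG; have [? ?] := giso_dim iG; subst k l.
  apply: (hh _ _ _ _ G' G'' (s' * s^-1)%g t).
  apply: giso_trans (GE _ iG) _; apply: giso_sym; exact: lactgM.
Qed.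

Lemma indecomposable_ractg k l (G : graph k l) (t : 'S_k) :
  indecomposable G -> indecomposable (ractg G t).
Proof.
move=> [hV hT hL hv hh].
have GE (H : graph k l) : giso (ractg G t) H -> giso G (ractg H t^-1%g).
  move=> iG; apply: giso_trans _ (giso_ractg t^-1%g iG).
  apply: giso_sym; apply: giso_trans (giso_sym (ractgM _ _ _)) _.
  by rewrite mulVg; exact: ractg1.
split=> //.
- move=> m G' G'' /GE iG; apply: (hv m G' (ractg G'' t^-1%g)).
  by apply: giso_trans iG _; exact: ractg_vcompg.
- move=> k' l' k'' l'' G' G'' s t' iG; have [? ?] := giso_dim iG; subst k l.
  apply: (hh _ _ _ _ G' G'' s (t^-1 * t')%g).
  apply: giso_trans (GE _ iG) _.
  apply: giso_trans (giso_sym (lractgC _ _ _)) _.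
  by apply: giso_lactg; apply: giso_sym; exact: ractgM.
Qed.

Section Indecomposables.
Variable K : fieldType.

Definition gr_ind_span k l : {pred gr K k l} := fun x =>
  `[< exists2 s : seq (K * graph k l),
        {in s, forall c, indecomposable c.2} &
        x = \sum_(c <- s) c.1 *: graph_vec K c.2 >].

Lemma gr_ind_submod k l : submod_closed (@gr_ind_span k l).
Proof.
split.
  by apply/asboolP; exists [::] => //; rewrite big_nil.
move=> a x y /asboolP[s hs ->] /asboolP[s' hs' ->]; apply/asboolP.
exists ([seq (a * c.1, c.2) | c <- s] ++ s').
  move=> c; rewrite mem_cat => /orP[/mapP[d /hs hd ->] //|]; exact: hs'.
rewrite big_cat big_map /= scaler_sumr; congr (_ + _).
by apply: eq_bigr => c _; rewrite scalerA.
Qed.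

HB.instance Definition _ k l :=
  GRing.isSubmodClosed.Build K (gr K k l) (@gr_ind_span k l) (@gr_ind_submod k l).

Record gr_ind k l := GrInd {
  gr_ind_val :> gr K k l;
  gr_indP : gr_ind_val \in @gr_ind_span k l
}.

HB.instance Definition _ k l := [isSub for @gr_ind_val k l].
HB.instance Definition _ k l := [Choice of gr_ind k l by <:].
HB.instance Definition _ k l := [SubChoice_isSubLmodule of gr_ind k l by <:].

Lemma gr_lact_ind k l (s : 'S_l) (x : gr_ind k l) :
  gr_lact s (gr_ind_val x) \in @gr_ind_span k l.
Proof.
have /asboolP[r hr ->] := gr_indP x; apply/asboolP.
exists [seq (c.1, lactg s c.2) | c <- r].
  by move=> c /mapP[d /hr hd ->]; exact: indecomposable_lactg.
rewrite big_map (linear_sum_eq (@gr_lact_linear K k l s)).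
by apply: eq_bigr => c _; rewrite gr_lact_vec.
Qed.

Lemma gr_ract_ind k l (x : gr_ind k l) (t : 'S_k) :
  gr_ract (gr_ind_val x) t \in @gr_ind_span k l.
Proof.
have /asboolP[r hr ->] := gr_indP x; apply/asboolP.
exists [seq (c.1, ractg c.2 t) | c <- r].
  by move=> c /mapP[d /hr hd ->]; exact: indecomposable_ractg.
rewrite big_map (linear_sum_eq (@gr_ract_linear K k l t)).
by apply: eq_bigr => c _; rewrite gr_ract_vec.
Qed.

Definition gr_ind_lact k l (s : 'S_l) (x : gr_ind k l) : gr_ind k l :=
  GrInd (gr_lact_ind s x).

Definition gr_ind_ract k l (x : gr_ind k l) (t : 'S_k) : gr_ind k l :=
  GrInd (gr_ract_ind x t).

Lemma gr_ind_lact_linear k l s : linear (@gr_ind_lact k l s).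
Proof. by move=> a x y; apply: val_inj; exact: gr_lact_linear. Qed.

Lemma gr_ind_ract_linear k l t : linear ((@gr_ind_ract k l)^~ t).
Proof. by move=> a x y; apply: val_inj; exact: gr_ract_linear. Qed.

Lemma gr_ind_lact1 k l (x : gr_ind k l) : gr_ind_lact 1%g x = x.
Proof. by apply: val_inj; exact: gr_lact1. Qed.

Lemma gr_ind_lactM k l s t (x : gr_ind k l) :
  gr_ind_lact (t * s)%g x = gr_ind_lact s (gr_ind_lact t x).
Proof. by apply: val_inj; exact: gr_lactM. Qed.

Lemma gr_ind_ract1 k l (x : gr_ind k l) : gr_ind_ract x 1%g = x.
Proof. by apply: val_inj; exact: gr_ract1. Qed.

Lemma gr_ind_ractM k l s t (x : gr_ind k l) :
  gr_ind_ract x (t * s)%g = gr_ind_ract (gr_ind_ract x s) t.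
Proof. by apply: val_inj; exact: gr_ractM. Qed.

Lemma gr_ind_lractC k l s t (x : gr_ind k l) :
  gr_ind_lact s (gr_ind_ract x t) = gr_ind_ract (gr_ind_lact s x) t.
Proof. by apply: val_inj; exact: gr_lractC. Qed.

Definition Gr_ind : SSmodule K := {|
  ss_carrier := gr_ind;
  lact_linear := gr_ind_lact_linear;
  ract_linear := gr_ind_ract_linear;
  lact1 := gr_ind_lact1;
  lactM := gr_ind_lactM;
  ract1 := gr_ind_ract1;
  ractM := gr_ind_ractM;
  lractC := gr_ind_lractC
|}.

Definition gr_ind_incl k l (x : Gr_ind k l) : Gr K k l := gr_ind_val x.

End Indecomposables.

Variant scalars := Reals | Complexes.

Definition scalar_field (R : realType) (c : scalars) : fieldType :=
  match c with Reals => R | Complexes => R[i] end.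

(* Main.v *)
(* Let [eval x p] be the smallest relation between Gr and P that contains the
   pairs (C, phi C), C indecomposable, and is compatible with the ProP
   operations.  A ProP morphism extending phi must map x to p whenever
   [eval x p], so one has to show that every graph has exactly one value.

   Existence: after splitting off loops and input-output edges, a graph is
   either indecomposable or, by the very definition, a composition of graphs
   with fewer vertices.

   Uniqueness, by induction on the number of vertices and loops: an evaluation
   of G ends either with one padded generator s.(C * I_n).t, or with a vertical
   composition of two graphs that both have a vertex or a loop.  Padded
   generators are compared through the labels of the edges of C.  A vertical
   composition is the same as a cut of G, that is, a down-closed set of vertices
   with a numbering of the edges that cross it.  Given two cuts c and c', both
   evaluations are compared with the ones passing through the meet and the join
   of c and c'; between the meet and the join, G is a disjoint union A * B up to
   the numberings, and both ways around the square give
   (A * I) o (I * B) = A * B = (I * B) o (A * I). *)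

Require Import Defs.
From mathcomp Require Import all_boot all_algebra perm.
From mathcomp Require Import generic_quotient freeg.
From mathcomp Require Import boolp classical_sets functions cardinality reals.

Set Implicit Arguments.
Unset Strict Implicit.
Unset Printing Implicit Defensive.

Import GRing.Theory.

(** * Wires *)

(** A graph has no canonical decomposition, and composites are known only up to isomorphism, with
    matched pairs as edges. The proof therefore works inside one fixed graph: a part of it is a
    [region], given by predicates and numberings, and [sub] says that a graph realises it. Two
    realisations of a region are isomorphic, so an isomorphism between composites becomes a
    statement about sets of vertices and wires. The evaluation is a relation because a function
    would presuppose that the choices do not matter. The induction for uniqueness counts loops
    together with vertices, as nodes, because a bare loop is a generator and can be a factor on its
    own. Factors without nodes are permutations and are absorbed into the other factor, so that in a
    remaining composition both factors are smaller than the whole. The meet and the join of two cuts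
    may be trivial. Only the four sides of the square and the four given factors must miss a node,
    and they do because each given cut has a node on either side. *)

(* All kinds of edges at once, each with a source and a target that is either a
   vertex or an external index.  Indices are natural numbers, which avoids casts
   between equal but not convertible dimensions. *)
Definition wire k l (G : graph k l) : Set := (edge G + outp G) + (inp G + thru G).

Definition wsrc k l (G : graph k l) (w : wire G) : vert G + nat :=
  match w with
  | inl x => inl (src G x)
  | inr x => inr (nat_of_ord (inidx G x))
  end.

Definition wtgt k l (G : graph k l) (w : wire G) : vert G + nat :=
  match w with
  | inl (inl e) => inl (tgt G (inl e))
  | inl (inr f) => inr (nat_of_ord (outidx G (inl f)))
  | inr (inl e) => inl (tgt G (inr e))
  | inr (inr f) => inr (nat_of_ord (outidx G (inr f)))
  end.

Arguments wsrc {k l} G w.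
Arguments wtgt {k l} G w.

Definition copair (A B T : Type) (f : A -> T) (g : B -> T) (x : A + B) : T :=
  match x with inl y => f y | inr y => g y end.

Lemma copair_inj (A B T : Type) (f : A -> T) (g : B -> T) : injective f ->
  injective g -> (forall x y, f x = g y -> False) -> injective (copair f g).
Proof.
by move=> fi gi fg [x|x] [y|y] /=; [move/fi ->|move/fg|move/esym/fg|move/gi ->].
Qed.

Lemma copair_im (A B T : Type) (f : A -> T) (g : B -> T) (P P1 P2 : T -> Prop) :
  (forall v, P v <-> P1 v \/ P2 v) -> (forall v, P1 v <-> exists x, f x = v) ->
  (forall v, P2 v <-> exists x, g x = v) ->
  forall v, P v <-> exists x, copair f g x = v.
Proof.
move=> h h1 h2 v; rewrite h h1 h2; split.
  by move=> [[x <-]|[x <-]]; [exists (inl x)|exists (inr x)].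
by move=> [[x|x] <-]; [left|right]; exists x.
Qed.

(** The function is total and its values off [A] are junk, so numberings of different sets of wires
    can be compared without subset types. *)
Record labelling (W : Type) n (A : W -> Prop) (lab : W -> nat) : Prop := {
  lab_lt : forall w, A w -> (lab w < n)%N;
  lab_surj : forall i, (i < n)%N -> exists2 w, A w & lab w = i;
  lab_inj : forall w w', A w -> A w' -> lab w = lab w' -> w = w'
}.

(** The value 0 at a vertex is a dummy: numbers are only read at external ends. *)
Definition endlab (V : Type) (x : V + nat) : nat := if x is inr i then i else 0.

Definition outer (V : Type) (x : V + nat) : Prop := if x is inr i then True else False.

Lemma wsrc_labelling k l (G : graph k l) :
  labelling k (fun w => outer (wsrc G w)) (fun w => endlab (wsrc G w)).
Proof.
split.
- by case=> //= x _; exact: ltn_ord.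
- move=> i ik; have [g _ gK] := inidx_bij G.
  by exists (inr (g (Ordinal ik))); rewrite //= gK.
- move=> [//|x] [//|y] _ _ /= /val_inj e; congr inr.
  exact: bij_inj (inidx_bij G) _ _ e.
Qed.

Lemma wtgt_labelling k l (G : graph k l) :
  labelling l (fun w => outer (wtgt G w)) (fun w => endlab (wtgt G w)).
Proof.
split.
- by case=> [[|]|[|]] //= x _; exact: ltn_ord.
- move=> i il; have [g _ gK] := outidx_bij G.
  have e := gK (Ordinal il); case: (g _) e => x e.
    by exists (inl (inr x)) => //=; rewrite e.
  by exists (inr (inr x)) => //=; rewrite e.
- have iG := bij_inj (outidx_bij G).
  by move=> [[x|x]|[x|x]] [[y|y]|[y|y]] //= _ _ /val_inj /iG [] // ->.
Qed.

Definition is_wiso k l k' l' (G : graph k l) (H : graph k' l')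
    (fV : vert G -> vert H) (fL : loop G -> loop H) (fW : wire G -> wire H) :
    Prop :=
  [/\ bijective fV, bijective fL, bijective fW,
      forall w, wsrc H (fW w) = sum_map fV id (wsrc G w) &
      forall w, wtgt H (fW w) = sum_map fV id (wtgt G w)].

(** The kind of a wire can be read off its ends, each being a vertex or an index. A bijection of
    wires that respects the ends therefore restricts to each of the four kinds. *)
Lemma wiso_giso k l k' l' (G : graph k l) (H : graph k' l')
    (fV : vert G -> vert H) (fL : loop G -> loop H) (fW : wire G -> wire H) :
  is_wiso fV fL fW -> giso G H.
Proof.
move=> [bV bL bW Hs Ht]; have iW := bij_inj bW; have [g _ gK] := bW.
have hE e : exists e', fW (inl (inl e)) = inl (inl e').
  move: (Hs (inl (inl e))) (Ht (inl (inl e))).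
  by case: (fW _) => [[x|x]|[x|x]] //= _ _; exists x.
have hO e : exists e', fW (inl (inr e)) = inl (inr e').
  move: (Hs (inl (inr e))) (Ht (inl (inr e))).
  by case: (fW _) => [[x|x]|[x|x]] //= _ _; exists x.
have hI e : exists e', fW (inr (inl e)) = inr (inl e').
  move: (Hs (inr (inl e))) (Ht (inr (inl e))).
  by case: (fW _) => [[x|x]|[x|x]] //= _ _; exists x.
have hT e : exists e', fW (inr (inr e)) = inr (inr e').
  move: (Hs (inr (inr e))) (Ht (inr (inr e))).
  by case: (fW _) => [[x|x]|[x|x]] //= _ _; exists x.
have [fE fEE] := choice hE; have [fO fOE] := choice hO.
have [fI fIE] := choice hI; have [fT fTE] := choice hT.
exists fV, fE, fI, fO, fT, fL; split=> //.
- apply: inj_surj_bij => [x y e|y].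
    by have := fEE x; rewrite e -fEE => /iW [].
  have := gK (inl (inl y)); case: (g _) => [[x|x]|[x|x]]; rewrite ?fEE ?fOE ?fIE ?fTE //.
  by case=> <-; exists x.
- apply: inj_surj_bij => [x y e|y].
    by have := fIE x; rewrite e -fIE => /iW [].
  have := gK (inr (inl y)); case: (g _) => [[x|x]|[x|x]]; rewrite ?fEE ?fOE ?fIE ?fTE //.
  by case=> <-; exists x.
- apply: inj_surj_bij => [x y e|y].
    by have := fOE x; rewrite e -fOE => /iW [].
  have := gK (inl (inr y)); case: (g _) => [[x|x]|[x|x]]; rewrite ?fEE ?fOE ?fIE ?fTE //.
  by case=> <-; exists x.
- apply: inj_surj_bij => [x y e|y].
    by have := fTE x; rewrite e -fTE => /iW [].
  have := gK (inr (inr y)); case: (g _) => [[x|x]|[x|x]]; rewrite ?fEE ?fOE ?fIE ?fTE //.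
  by case=> <-; exists x.
- move=> x; have := Hs (inl x); case: x => x; rewrite ?fEE ?fOE /=; by case.
- move=> [x|x]; [have := Ht (inl (inl x))|have := Ht (inr (inl x))];
    by rewrite ?fEE ?fIE /=; case.
- move=> x; have := Hs (inr x); case: x => x; rewrite ?fIE ?fTE /=; by case.
- move=> [x|x]; [have := Ht (inl (inr x))|have := Ht (inr (inr x))];
    by rewrite ?fOE ?fTE /=; case.
Qed.

Lemma giso_wiso k l k' l' (G : graph k l) (H : graph k' l') : giso G H ->
  exists (fV : vert G -> vert H) (fL : loop G -> loop H) (fW : wire G -> wire H),
    is_wiso fV fL fW.
Proof.
move=> [fV [fE [fI [fO [fT [fL [bV bE bI bO bT bL Hs Ht Hi Ho]]]]]]].
exists fV, fL, (sum_map (sum_map fE fO) (sum_map fI fT)); split=> //.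
- by apply: sum_map_bij; apply: sum_map_bij.
- by case=> x /=; rewrite ?Hs // Hi.
- move=> [[x|x]|[x|x]] /=.
  + by rewrite -(Ht (inl x)).
  + by rewrite -(Ho (inl x)).
  + by rewrite -(Ht (inr x)).
  + by rewrite -(Ho (inr x)).
Qed.

Lemma wire_fin k l (G : graph k l) : finite_set [set: wire G].
Proof.
have [fI fT] := finite_ord_bij (inidx_bij G).
have [fO _] := finite_ord_bij (outidx_bij G).
by apply: finite_sum; apply: finite_sum => //; apply: edge_fin.
Qed.

Lemma labelling_exists (W : Type) (A : W -> Prop) :
  finite_set [set: W] -> exists n lab, labelling n A lab.
Proof.
move=> finW; have : finite_set [set w | A w] by exact: sub_finite_set finW.
case=> n /card_set_bijP [f [f1 f2 f3]]; exists n, f; split.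
- by move=> w Aw; exact: (f1 w Aw).
- by move=> i /f3 [w Aw <-]; exists w.
- by move=> w w' Aw Aw'; apply: f2; rewrite inE.
Qed.

(** Sorting the wires by the nature of their two ends gives the four sets of edges. The numberings
    of the external ends are then the bijections [inidx] and [outidx]. *)
Lemma graph_of_wires (V L W : Set) k l (ws wt : W -> V + nat) :
    finite_set [set: V] -> finite_set [set: L] -> finite_set [set: W] ->
    labelling k (fun w => outer (ws w)) (fun w => endlab (ws w)) ->
    labelling l (fun w => outer (wt w)) (fun w => endlab (wt w)) ->
  exists (G : graph k l) (fV : vert G -> V) (fL : loop G -> L)
      (fW : wire G -> W),
    [/\ bijective fV, bijective fL, bijective fW,
      forall w, ws (fW w) = sum_map fV id (wsrc G w) &
      forall w, wt (fW w) = sum_map fV id (wtgt G w)].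
Proof.
move=> finV finL finW [slt ssurj sinj] [tlt tsurj tinj].
pose lft (x : V + nat) := if x is inl _ then true else false.
pose E : Set := {w | lft (ws w) && lft (wt w)}.
pose O : Set := {w | lft (ws w) && ~~ lft (wt w)}.
pose I : Set := {w | ~~ lft (ws w) && lft (wt w)}.
pose T : Set := {w | ~~ lft (ws w) && ~~ lft (wt w)}.
have sV (x : E + O) : exists v, ws (copair sval sval x) = inl v.
  by case: x => -[w /= /andP[]]; case: (ws w) => // v; exists v.
have tV (x : E + I) : exists v, wt (copair sval sval x) = inl v.
  by case: x => -[w /= /andP[]]; case: (wt w) => // v; exists v.
have sI (x : I + T) : exists i : 'I_k, ws (copair sval sval x) = inr (i : nat).
  by case: x => -[w /= /andP[]]; have := slt w; case: (ws w) => // i /(_ Logic.I) h; exists (Ordinal h).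
have tI (x : O + T) : exists i : 'I_l, wt (copair sval sval x) = inr (i : nat).
  by case: x => -[w /= /andP[]]; have := tlt w; case: (wt w) => // i /(_ Logic.I) h; exists (Ordinal h).
have [s sE] := choice sV; have [t tE] := choice tV.
have [i iE] := choice sI; have [o oE] := choice tI.
have finE : finite_set [set: E].
  by apply: (@finite_inj _ _ sval) => // x y /val_inj.
have bi : bijective i.
  apply: inj_surj_bij => [x y e|j].
    have : copair sval sval x = copair sval sval y.
      by apply: sinj; rewrite !iE //= e.
    case: x e => [x|x]; case: y => [y|y] _ /= exy.
    + by congr inl; apply: val_inj.
    + by have /andP[_] := svalP x; have /andP[_] := svalP y; rewrite exy => /negbTE->.
    + by have /andP[_] := svalP x; have /andP[_ h] := svalP y; rewrite exy h.
    + by congr inr; apply: val_inj.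
  have [w ow ew] := ssurj j (ltn_ord j).
  have sw : ~~ lft (ws w) by case: (ws w) ow.
  case tw: (lft (wt w)).
    have h : ~~ lft (ws w) && lft (wt w) by rewrite sw.
    exists (inl (exist _ w h)); apply: val_inj => /=.
    by rewrite -ew; have := iE (inl (exist _ w h)) => /= ->.
  have h : ~~ lft (ws w) && ~~ lft (wt w) by rewrite sw tw.
  exists (inr (exist _ w h)); apply: val_inj => /=.
  by rewrite -ew; have := iE (inr (exist _ w h)) => /= ->.
have bo : bijective o.
  apply: inj_surj_bij => [x y e|j].
    have : copair sval sval x = copair sval sval y.
      by apply: tinj; rewrite !oE //= e.
    case: x e => [x|x]; case: y => [y|y] _ /= exy.
    + by congr inl; apply: val_inj.
    + by have /andP[] := svalP x; have /andP[] := svalP y; rewrite exy => /negbTE->.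
    + by have /andP[] := svalP x; have /andP[h] := svalP y; rewrite exy h.
    + by congr inr; apply: val_inj.
  have [w ow ew] := tsurj j (ltn_ord j).
  have tw : ~~ lft (wt w) by case: (wt w) ow.
  case sw: (lft (ws w)).
    have h : lft (ws w) && ~~ lft (wt w) by rewrite sw.
    exists (inl (exist _ w h)); apply: val_inj => /=.
    by rewrite -ew; have := oE (inl (exist _ w h)) => /= ->.
  have h : ~~ lft (ws w) && ~~ lft (wt w) by rewrite sw tw.
  exists (inr (exist _ w h)); apply: val_inj => /=.
  by rewrite -ew; have := oE (inr (exist _ w h)) => /= ->.
pose G := @Graph k l V E I O T L s t i o finV finE finL bi bo.
pose fW (x : wire G) : W := match x with
  | inl (inl e) => sval e | inl (inr e) => sval e
  | inr (inl e) => sval e | inr (inr e) => sval e end.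
exists G, id, id, fW; split; try by exists id.
- apply: inj_surj_bij => [x y|w].
    case: x => -[x|x]; case: y => -[y|y] /= e;
      first [by apply: congr1; apply: congr1; exact: val_inj
        |by have := svalP x; have := svalP y; rewrite /= e; case: (lft _); case: (lft _)].
  case sw: (lft (ws w)); case tw: (lft (wt w)).
  + have h : lft (ws w) && lft (wt w) by rewrite sw.
    by exists (inl (inl (exist _ w h))).
  + have h : lft (ws w) && ~~ lft (wt w) by rewrite sw tw.
    by exists (inl (inr (exist _ w h))).
  + have h : ~~ lft (ws w) && lft (wt w) by rewrite sw.
    by exists (inr (inl (exist _ w h))).
  + have h : ~~ lft (ws w) && ~~ lft (wt w) by rewrite sw tw.
    by exists (inr (inr (exist _ w h))).
- by move=> [[x|x]|[x|x]] /=; [rewrite -(sE (inl x))|rewrite -(sE (inr x))|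
    rewrite -(iE (inl x))|rewrite -(iE (inr x))].
- by move=> [[x|x]|[x|x]] /=; [rewrite -(tE (inl x))|rewrite -(oE (inl x))|
    rewrite -(tE (inr x))|rewrite -(oE (inr x))].
Qed.

(** * Subgraphs cut out by regions *)

(* An end of a wire of the subgraph is a vertex of the subgraph, or else it is
   an external end, numbered by [lab], which may lie at a vertex of the ambient
   graph outside of the subgraph. *)
Definition embeds_end (V W V' W' : Type) (a : V -> V') (p : W -> W')
    (lab : W' -> nat) (e : W -> V + nat) (e' : W' -> V' + nat) : Prop :=
  forall w, match e w with
    | inl x => e' (p w) = inl (a x)
    | inr i => lab (p w) = i /\ forall x, e' (p w) <> inl (a x)
    end.

Section EmbedsEnd.
Variables (V W V' W' : Type) (a : V -> V') (p : W -> W').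
Variables (lab : W' -> nat) (e : W -> V + nat) (e' : W' -> V' + nat).
Hypothesis emb : embeds_end a p lab e e'.

Lemma embeds_end_inl w x : e w = inl x -> e' (p w) = inl (a x).
Proof. by move=> h; have := emb w; rewrite h. Qed.

Lemma embeds_end_uniq (V2 W2 : Type) (a2 : V2 -> V') (p2 : W2 -> W')
    (e2 : W2 -> V2 + nat) (f : V -> V2) (g : W -> W2) :
  embeds_end a2 p2 lab e2 e' -> injective a2 ->
  (forall x, a2 (f x) = a x) -> (forall w, p2 (g w) = p w) ->
  (forall y, exists x, f x = y) ->
  forall w, e2 (g w) = sum_map f id (e w).
Proof.
move=> emb2 ia2 fE gE fs w; have := emb w; have := emb2 (g w); rewrite gE.
case: (e w) => [x|i]; case: (e2 _) => [y|j] /=.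
- by move=> -> [h]; congr inl; apply: ia2; rewrite fE.
- by move=> [_ h] /=; rewrite -fE => /h.
- by move=> h [_]; have [x fx] := fs y; move: h; rewrite -fx fE => -> /(_ x).
- by move=> [-> _] [-> _].
Qed.

Lemma embeds_end_labelling n :
  injective p ->
  labelling n (fun w => outer (e w)) (fun w => endlab (e w)) ->
  labelling n (fun h => (exists w, p w = h) /\ forall x, e' h <> inl (a x)) lab.
Proof.
move=> ip [h1 h2 h3].
have oE w : (forall x, e' (p w) <> inl (a x)) -> outer (e w) /\ endlab (e w) = lab (p w).
  by have := emb w; case: (e w) => [x ->|i [-> //]] /(_ x).
split.
- by move=> _ [[w <-] /oE[ow <-]]; exact: h1.
- move=> i /h2 [w ow ew]; exists (p w); last first.
    by move: ow ew; have := emb w; case: (e w) => // j [-> _].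
  by split; [exists w|move: ow; have := emb w; case: (e w) => // j []].
- move=> _ _ [[w <-] /oE[ow ew]] [[w' <-] /oE[ow' ew']] h.
  by congr p; apply: h3 => //; rewrite ew ew'.
Qed.

End EmbedsEnd.

(** Predicates instead of a graph: unions and differences of parts are then plain logic, and a graph
    is produced by [sub_exists] only when an evaluation is wanted. *)
Record region k l (H : graph k l) := Region {
  rV : vert H -> Prop;
  rL : loop H -> Prop;
  rW : wire H -> Prop;
  rin : wire H -> nat;
  rout : wire H -> nat
}.

Definition free_end (V : Type) (A : V -> Prop) (x : V + nat) : Prop :=
  forall v, x = inl v -> ~ A v.

Section Regions.
Variables (k0 l0 : nat) (H : graph k0 l0).
Implicit Type R : region H.

Definition ins R h := rW R h /\ free_end (rV R) (wsrc H h).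
Definition outs R h := rW R h /\ free_end (rV R) (wtgt H h).

Record region_ok k l R : Prop := {
  ok_src : forall h v, wsrc H h = inl v -> rV R v -> rW R h;
  ok_tgt : forall h v, wtgt H h = inl v -> rV R v -> rW R h;
  ok_in : labelling k (ins R) (rin R);
  ok_out : labelling l (outs R) (rout R)
}.

Record is_sub R k l (G : graph k l) (a : vert G -> vert H)
    (b : loop G -> loop H) (p : wire G -> wire H) : Prop := IsSub {
  sub_injV : injective a;
  sub_injL : injective b;
  sub_injW : injective p;
  sub_imV : forall v, rV R v <-> exists x, a x = v;
  sub_imL : forall v, rL R v <-> exists x, b x = v;
  sub_imW : forall v, rW R v <-> exists x, p x = v;
  sub_src : embeds_end a p (rin R) (wsrc G) (wsrc H);
  sub_tgt : embeds_end a p (rout R) (wtgt G) (wtgt H);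
  sub_srcW : forall h v, wsrc H h = inl v -> rV R v -> rW R h;
  sub_tgtW : forall h v, wtgt H h = inl v -> rV R v -> rW R h
}.

Definition sub R k l (G : graph k l) : Prop := exists a b p, @is_sub R k l G a b p.

Lemma labelling_ext (W : Type) n (A A' : W -> Prop) (lab lab' : W -> nat) :
  (forall w, A w <-> A' w) -> (forall w, A w -> lab w = lab' w) ->
  labelling n A lab -> labelling n A' lab'.
Proof.
move=> AA ll [h1 h2 h3]; split.
- by move=> w /AA Aw; rewrite -ll //; exact: h1.
- by move=> i /h2 [w Aw <-]; exists w; [exact/AA|rewrite ll].
- by move=> w w' /AA Aw /AA Aw'; rewrite -!ll //; exact: h3.
Qed.

Lemma sub_ok R k l (G : graph k l) : sub R G -> region_ok k l R.
Proof.
move=> [a [b [p [ia ib ip hV hL hW hs ht hs' ht']]]]; split=> //.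
- apply: (labelling_ext _ _ (embeds_end_labelling hs ip (wsrc_labelling G))) => // h.
  rewrite /ins hW; split=> -[hp hf]; split=> // v.
    by move=> e /hV [x ex]; apply: (hf x); rewrite e ex.
  by move=> e; apply: (hf _ e); apply/hV; exists v.
- apply: (labelling_ext _ _ (embeds_end_labelling ht ip (wtgt_labelling G))) => // h.
  rewrite /outs hW; split=> -[hp hf]; split=> // v.
    by move=> e /hV [x ex]; apply: (hf x); rewrite e ex.
  by move=> e; apply: (hf _ e); apply/hV; exists v.
Qed.

(** With [sub_ok], this shows that [region_ok] is the exact condition for a realisation. A wire
    leaving the region is cut at that end, which becomes external and takes its number from the
    region. *)
Lemma sub_exists R k l : region_ok k l R -> exists G : graph k l, sub R G.
Proof.
move=> [hs ht hi ho].
pose V : Set := {v | `[< rV R v >]}.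
pose L : Set := {v | `[< rL R v >]}.
pose W : Set := {v | `[< rW R v >]}.
pose cut (lab : wire H -> nat) (e : wire H -> vert H + nat) (w : W) : V + nat :=
  match e (sval w) with
  | inl v => if insub v is Some x then inl x else inr (lab (sval w))
  | inr i => inr (lab (sval w))
  end.
have cutE lab e w : match cut lab e w with
    | inl x => e (sval w) = inl (sval x)
    | inr i => lab (sval w) = i /\ free_end (rV R) (e (sval w)) end.
  rewrite /cut; case ew: (e (sval w)) => [v|i]; last by split.
  case: insubP => [x _ <- //|]; move/asboolP => nv; split=> // v' [<-]; exact.
have fin_sub (T : Set) (P : pred T) : finite_set [set: T] -> finite_set [set: {x | P x}].
  by move=> fT; apply: (@finite_inj _ _ sval) => // x y /val_inj.
have lab_ok n lab e : labelling n (fun h => rW R h /\ free_end (rV R) (e h)) lab ->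
    labelling n (fun w => outer (cut lab e w)) (fun w => endlab (cut lab e w)).
  move=> [h1 h2 h3]; split.
  - move=> w; have := cutE lab e w; case: (cut _ _ _) => //= i [<- fw] _.
    by apply: h1; split=> //; apply/asboolP/(svalP w).
  - move=> i /h2 [h [/asboolP Wh fh] <-]; exists (exist _ h Wh).
      have := cutE lab e (exist _ h Wh); case: (cut _ _ _) => //= x ex.
      by exfalso; apply: (fh _ ex); apply/asboolP/(svalP x).
    have := cutE lab e (exist _ h Wh); case: (cut _ _ _) => //= [x ex|j [-> //]].
    by exfalso; apply: (fh _ ex); apply/asboolP/(svalP x).
  - move=> w w'; have := cutE lab e w; have := cutE lab e w'.
    case: (cut _ _ _) => //= i [<- fw]; case: (cut _ _ _) => //= j [<- fw'] _ _ ee.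
    by apply: val_inj; apply: h3 => //; split=> //; apply/asboolP; first [exact: (svalP w)|exact: (svalP w')].
have [G [fV [fL [fW [bV bL bW hs' ht']]]]] :=
  @graph_of_wires V L W k l (cut (rin R) (wsrc H)) (cut (rout R) (wtgt H))
    (fin_sub _ _ (vert_fin H)) (fin_sub _ _ (loop_fin H))
    (fin_sub _ _ (wire_fin H)) (lab_ok _ _ _ hi) (lab_ok _ _ _ ho).
have ends lab e e' : (forall w, cut lab e (fW w) = sum_map fV id (e' w)) ->
    embeds_end (sval \o fV) (sval \o fW) lab e' e.
  move=> h w; have := cutE lab e (fW w); rewrite h; case: (e' w) => //= i [-> ff].
  by split=> // x ex; apply: (ff _ ex); apply/asboolP/(svalP (fV x)).
have im (T T' : Type) (P : T -> Prop) (f : T' -> {x | `[<P x>]}) : bijective f ->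
    forall v, P v <-> exists x, (sval \o f) x = v.
  move=> [g _ gK] v; split=> [/asboolP Pv|[x <-]]; last exact/asboolP/(svalP (f x)).
  by exists (g (exist _ v Pv)); rewrite /= gK.
exists G, (sval \o fV), (sval \o fL), (sval \o fW); split; try exact: im.
- by apply: inj_comp (bij_inj bV) => x y /val_inj.
- by apply: inj_comp (bij_inj bL) => x y /val_inj.
- by apply: inj_comp (bij_inj bW) => x y /val_inj.
- exact: ends.
- exact: ends.
- exact: hs.
- exact: ht.
Qed.

Lemma transfer_inj (A B T : Type) (P : T -> Prop) (f : A -> T) (g : B -> T) :
  injective f -> injective g -> (forall v, P v <-> exists x, f x = v) ->
  (forall v, P v <-> exists x, g x = v) ->
  exists2 h : A -> B, bijective h & forall x, g (h x) = f x.
Proof.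
move=> fi gi fP gP.
have ex x : exists y, g y = f x by apply/gP/fP; exists x.
have [h hE] := choice ex; exists h => //; apply: inj_surj_bij.
  by move=> x y e; apply: fi; rewrite -!hE e.
move=> y; have /fP[x ex'] : P (g y) by apply/gP; exists y.
by exists x; apply: gi; rewrite hE.
Qed.

(** The embeddings of two realisations have the same images and hence differ by bijections. These
    respect the ends because both the vertices and the external numbers are read off the ambient
    graph. *)
Lemma sub_uniq R k l k' l' (G : graph k l) (G' : graph k' l') :
  sub R G -> sub R G' -> giso G G'.
Proof.
move=> [a [b [p [ia ib ip hV hL hW hs ht _ _]]]].
move=> [a' [b' [p' [ia' ib' ip' hV' hL' hW' hs' ht' _ _]]]].
have [fV bV fVE] := transfer_inj ia ia' hV hV'.
have [fL bL fLE] := transfer_inj ib ib' hL hL'.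
have [fW bW fWE] := transfer_inj ip ip' hW hW'.
have sV y : exists x, fV x = y by have [g _ gK] := bV; exists (g y).
apply: (@wiso_giso _ _ _ _ _ _ fV fL fW); split=> //.
  exact: (embeds_end_uniq hs hs').
exact: (embeds_end_uniq ht ht').
Qed.

Lemma sub_ext R R' k l (G : graph k l) :
  (forall v, rV R v <-> rV R' v) -> (forall v, rL R v <-> rL R' v) ->
  (forall h, rW R h <-> rW R' h) ->
  (forall h, ins R h -> rin R h = rin R' h) ->
  (forall h, outs R h -> rout R h = rout R' h) -> sub R G -> sub R' G.
Proof.
move=> eV eL eW ei eo [a [b [p [ia ib ip hV hL hW hs ht h h']]]].
exists a, b, p; split=> //.
- by move=> v; rewrite -eV.
- by move=> v; rewrite -eL.
- by move=> v; rewrite -eW.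
- move=> w; have := hs w; case: (wsrc _ w) => //= i [ei' fh]; split=> //.
  rewrite -ei //; split; first by apply/hW; exists w.
  by move=> v e /hV [x ex]; apply: (fh x); rewrite e ex.
- move=> w; have := ht w; case: (wtgt _ w) => //= i [ei' fh]; split=> //.
  rewrite -eo //; split; first by apply/hW; exists w.
  by move=> v e /hV [x ex]; apply: (fh x); rewrite e ex.
- by move=> w v /h hh /eV /hh /eW.
- by move=> w v /h' hh /eV /hh /eW.
Qed.

End Regions.

(** * Compositions of subgraphs *)

(* The parts in G and in G' of a wire of G' o G: a wire that passes from G to G'
   has both. *)
Section VcompWires.
Variables (k l m : nat) (G' : graph l m) (G : graph k l).

Definition low (c : wire (vcompg G' G)) : option (wire G) :=
  match c with
  | inl (inl (inl (inl e))) => Some (inl (inl e))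
  | inl (inl (inl (inr _))) => None
  | inl (inl (inr fe)) => Some (inl (inr (match_out fe)))
  | inl (inr (inl _)) => None
  | inl (inr (inr fe)) => Some (inl (inr (match_out fe)))
  | inr (inl (inl e)) => Some (inr (inl e))
  | inr (inl (inr fe)) => Some (inr (inr (match_out fe)))
  | inr (inr fe) => Some (inr (inr (match_out fe)))
  end.

Definition up (c : wire (vcompg G' G)) : option (wire G') :=
  match c with
  | inl (inl (inl (inl _))) => None
  | inl (inl (inl (inr e))) => Some (inl (inl e))
  | inl (inl (inr fe)) => Some (inr (inl (match_in fe)))
  | inl (inr (inl f)) => Some (inl (inr f))
  | inl (inr (inr fe)) => Some (inr (inr (match_in fe)))
  | inr (inl (inl _)) => None
  | inr (inl (inr fe)) => Some (inr (inl (match_in fe)))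
  | inr (inr fe) => Some (inr (inr (match_in fe)))
  end.

Lemma low_src c w : low c = Some w ->
  wsrc (vcompg G' G) c = sum_map inl id (wsrc G w).
Proof. by case: c => [[[[x|x]|x]|[x|x]]|[[x|x]|x]] //= [<-]. Qed.

Lemma low_tgt c w v : low c = Some w -> wtgt G w = inl v ->
  wtgt (vcompg G' G) c = inl (inl v).
Proof. by case: c => [[[[x|x]|x]|[x|x]]|[[x|x]|x]] //= [<-] //= [->]. Qed.

Lemma up_tgt c w : up c = Some w ->
  wtgt (vcompg G' G) c = sum_map inr id (wtgt G' w).
Proof. by case: c => [[[[x|x]|x]|[x|x]]|[[x|x]|x]] //= [<-]. Qed.

Lemma up_src c w v : up c = Some w -> wsrc G' w = inl v ->
  wsrc (vcompg G' G) c = inl (inr v).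
Proof. by case: c => [[[[x|x]|x]|[x|x]]|[[x|x]|x]] //= [<-] //= [->]. Qed.

Lemma low_up c w w' : low c = Some w -> up c = Some w' ->
  exists j : nat, wtgt G w = inr j /\ wsrc G' w' = inr j.
Proof.
by case: c => [[[[x|x]|x]|[x|x]]|[[x|x]|x]] //= [<-] [<-] /=;
  have /= -> := matchP x; eexists.
Qed.

Lemma low_None c : low c = None ->
  exists w v, up c = Some w /\ wsrc G' w = inl v.
Proof.
by case: c => [[[[x|x]|x]|[x|x]]|[[x|x]|x]] //= _; do 2!eexists; split.
Qed.

Lemma up_None c : up c = None ->
  exists w v, low c = Some w /\ wtgt G w = inl v.
Proof.
by case: c => [[[[x|x]|x]|[x|x]]|[[x|x]|x]] //= _; do 2!eexists; split.
Qed.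

(** Nothing is lost at the interface: the input numbering of [G'] is onto, so an output of [G] is
    always glued to something. *)
Lemma low_surj w : exists c, low c = Some w.
Proof.
have [g _ gK] := inidx_bij G'.
case: w => [[e|f]|[e|f]].
- by exists (inl (inl (inl (inl e)))).
- have := gK (outidx G (inl f)); case: (g _) => y /esym/eqP p.
    by exists (inl (inl (inr (exist _ (f, y) p)))).
  by exists (inl (inr (inr (exist _ (f, y) p)))).
- by exists (inr (inl (inl e))).
- have := gK (outidx G (inr f)); case: (g _) => y /esym/eqP p.
    by exists (inr (inl (inr (exist _ (f, y) p)))).
  by exists (inr (inr (exist _ (f, y) p))).
Qed.

Lemma up_surj w : exists c, up c = Some w.
Proof.
have [g _ gK] := outidx_bij G.
case: w => [[e|f]|[e|f]].
- by exists (inl (inl (inl (inr e)))).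
- by exists (inl (inr (inl f))).
- have := gK (inidx G' (inl e)); case: (g _) => y /eqP p.
    by exists (inl (inl (inr (exist _ (y, e) p)))).
  by exists (inr (inl (inr (exist _ (y, e) p)))).
- have := gK (inidx G' (inr f)); case: (g _) => y /eqP p.
    by exists (inl (inr (inr (exist _ (y, f) p)))).
  by exists (inr (inr (exist _ (y, f) p))).
Qed.

Lemma low_inj c c' w : low c = Some w -> low c' = Some w -> c = c'.
Proof.
have iG := bij_inj (inidx_bij G').
case: c => [[[[x|x]|x]|[x|x]]|[[x|x]|x]] //= [<-];
case: c' => [[[[y|y]|y]|[y|y]]|[[y|y]|y]] //= [e]; try by rewrite e.
all: have /= px := matchP x; have /= py := matchP y.
all: move: py; rewrite e px => /iG // [ee].
all: by have -> : x = y by apply: matched_eq.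
Qed.

Lemma up_inj c c' w : up c = Some w -> up c' = Some w -> c = c'.
Proof.
have iG := bij_inj (outidx_bij G).
case: c => [[[[x|x]|x]|[x|x]]|[[x|x]|x]] //= [<-];
case: c' => [[[[y|y]|y]|[y|y]]|[[y|y]|y]] //= [e]; try by rewrite e.
all: have /= px := matchP x; have /= py := matchP y.
all: move: py; rewrite e -px => /iG // [ee].
all: by have -> : x = y by apply: matched_eq.
Qed.

End VcompWires.

Section SubVcomp.
Variables (k0 l0 : nat) (H : graph k0 l0).
Variables (k l m : nat) (G1 : graph l m) (G2 : graph k l).
Variables (R R1 R2 : region H).

(** The common wires of the two regions are the inputs of the upper one, [R1], and at the same time
    the outputs of the lower one, [R2]. They carry the same number on both sides, so the composition
    glues exactly the two halves of each. *)
Lemma sub_vcompg :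
  sub R1 G1 -> sub R2 G2 ->
  (forall v, rV R1 v -> rV R2 v -> False) ->
  (forall v, rL R1 v -> rL R2 v -> False) ->
  (forall h, rW R1 h -> free_end (rV R1) (wsrc H h) <-> rW R2 h) ->
  (forall h, rW R2 h -> free_end (rV R2) (wtgt H h) <-> rW R1 h) ->
  (forall h, rW R1 h -> rW R2 h -> rin R1 h = rout R2 h) ->
  (forall v, rV R v <-> rV R1 v \/ rV R2 v) ->
  (forall v, rL R v <-> rL R1 v \/ rL R2 v) ->
  (forall h, rW R h <-> rW R1 h \/ rW R2 h) ->
  (forall h, ins R h -> rin R h = rin R2 h) ->
  (forall h, outs R h -> rout R h = rout R1 h) ->
  sub R (vcompg G1 G2).
Proof.
move=> [a1 [b1 [p1 [ia1 ib1 ip1 hV1 hL1 hW1 hs1 ht1 s1 t1]]]].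
move=> [a2 [b2 [p2 [ia2 ib2 ip2 hV2 hL2 hW2 hs2 ht2 s2 t2]]]].
move=> dV dL e1 e2 e12 eV eL eW ei eo.
have A1 x : rV R1 (a1 x) by apply/hV1; exists x.
have A2 x : rV R2 (a2 x) by apply/hV2; exists x.
have Q1 x : rW R1 (p1 x) by apply/hW1; exists x.
have Q2 x : rW R2 (p2 x) by apply/hW2; exists x.
(* A glued wire is read through its lower part. Its upper part gives the same wire of [H], since
   both halves carry the number of the interface and numbers are injective. *)
pose p (c : wire (vcompg G1 G2)) : option (wire H) :=
  if low c is Some w then Some (p2 w) else omap p1 (up c).
have pE c : exists h, [/\ p c = Some h,
    forall w, low c = Some w -> h = p2 w & forall w, up c = Some w -> h = p1 w].
  rewrite /p; case lc: (low c) => [w|]; last first.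
    by have [w [v [-> _]]] := low_None lc; exists (p1 w); split=> // w' [->].
  exists (p2 w); split=> // [w' [->] //|w' uc].
  have [j [tw sw]] := low_up lc uc.
  have W12 : rW R1 (p2 w).
    apply/(e2 _ (Q2 w)) => v ev /hV2 [x ex]; have := ht2 w; rewrite tw => -[_ /(_ x)].
    by rewrite ev ex.
  have /hW1 [w1 ew1] := W12; rewrite -ew1; congr p1.
  have sw1 : wsrc G1 w1 = inr j.
    have := hs1 w1; case sw1: (wsrc G1 w1) => [x|i]; rewrite ew1.
      move=> ev; exfalso; have /(e1 _ W12) := Q2 w; apply; first exact: ev.
      exact: A1.
    move=> [<- _]; rewrite e12 //; have := ht2 w; rewrite tw => -[-> _] //.
  by apply: (lab_inj (wsrc_labelling G1)); rewrite ?sw ?sw1.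
have [q qE] := choice pE.
have q_low c w : low c = Some w -> q c = p2 w by have [_ + _] := qE c; apply.
have q_up c w : up c = Some w -> q c = p1 w by have [_ _] := qE c; apply.
have lowN c w : low c = None -> q c = p2 w -> False.
  move=> lc qc; have [w' [v [uc sw']]] := low_None lc.
  have e : p2 w = p1 w' by rewrite -qc; exact: q_up.
  have W1 := Q1 w'; have := Q2 w; rewrite e => /(e1 _ W1); apply; last exact: (A1 v).
  exact: embeds_end_inl hs1 _ _ sw'.
exists (copair a2 a1), (copair b2 b1), q; split.
- by apply: copair_inj => // x y e; apply: (dV (a1 y)); rewrite // -e.
- apply: copair_inj => // x y e; apply: (dL (b1 y)); first by apply/hL1; exists y.
  by rewrite -e; apply/hL2; exists x.
- move=> c c' e; case lc: (low c) => [w|]; case lc': (low c') => [w'|].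
  + have ew : w = w' by apply: ip2; rewrite -(q_low _ _ lc) -(q_low _ _ lc').
    by apply: low_inj lc _; rewrite ew.
  + by exfalso; apply: (lowN _ w lc'); rewrite -e; exact: q_low.
  + by exfalso; apply: (lowN _ w' lc); rewrite e; exact: q_low.
  + have [w [v [uc _]]] := low_None lc; have [w' [v' [uc' _]]] := low_None lc'.
    have ew : w = w' by apply: ip1; rewrite -(q_up _ _ uc) -(q_up _ _ uc').
    by apply: up_inj uc _; rewrite ew.
- by apply: copair_im hV2 hV1 => v; rewrite eV; exact: or_comm.
- by apply: copair_im hL2 hL1 => v; rewrite eL; exact: or_comm.
- move=> h; rewrite eW hW1 hW2; split.
    move=> [[w <-]|[w <-]].
      by have [c cw] := up_surj G2 w; exists c; exact: q_up.
    by have [c cw] := low_surj G1 w; exists c; exact: q_low.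
  move=> [c <-]; case lc: (low c) => [w|].
    by right; exists w; rewrite (q_low _ _ lc).
  by have [w [v [uc _]]] := low_None lc; left; exists w; rewrite (q_up _ _ uc).
- move=> c; case lc: (low c) => [w|].
    rewrite (low_src lc) (q_low _ _ lc); have := hs2 w.
    case sw: (wsrc G2 w) => [x|i] //= [<- fx].
    have f1 v : wsrc H (p2 w) = inl v -> ~ (rV R1 v \/ rV R2 v).
      move=> ev [r1|r2].
        have W1 := s1 _ _ ev r1; have := Q2 w => /(e1 _ W1).
        by move=> /(_ _ ev); apply.
      by move/hV2: r2 => [x ex]; apply: (fx x); rewrite ev ex.
    split; last by move=> [x|x] /f1 /=; apply; [right|left].
    apply: ei; split; first by rewrite eW; right.
    by move=> v /f1; rewrite eV.
  have [w [v [uc sw]]] := low_None lc.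
  by rewrite (up_src uc sw) (q_up _ _ uc) /=; exact: embeds_end_inl hs1 _ _ sw.
- move=> c; case uc: (up c) => [w|].
    rewrite (up_tgt uc) (q_up _ _ uc); have := ht1 w.
    case sw: (wtgt G1 w) => [x|i] //= [<- fx].
    have f1 v : wtgt H (p1 w) = inl v -> ~ (rV R1 v \/ rV R2 v).
      move=> ev [r1|r2].
        by move/hV1: r1 => [x ex]; apply: (fx x); rewrite ev ex.
      have W2 := t2 _ _ ev r2; have := Q1 w => /(e2 _ W2).
      by move=> /(_ _ ev); apply.
    split; last by move=> [x|x] /f1 /=; apply; [right|left].
    apply: eo; split; first by rewrite eW; left.
    by move=> v /f1; rewrite eV.
  have [w [v [lc sw]]] := up_None uc.
  by rewrite (low_tgt lc sw) (q_low _ _ lc) /=; exact: embeds_end_inl ht2 _ _ sw.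
- by move=> h v ev; rewrite eV eW => -[/(s1 _ _ ev)|/(s2 _ _ ev)]; [left|right].
- by move=> h v ev; rewrite eV eW => -[/(t1 _ _ ev)|/(t2 _ _ ev)]; [left|right].
Qed.

End SubVcomp.

Definition hcompg_wire k l k' l' (G : graph k l) (G' : graph k' l')
    (w : wire (hcompg G G')) : wire G + wire G' :=
  match w with
  | inl (inl (inl e)) => inl (inl (inl e))
  | inl (inl (inr e)) => inr (inl (inl e))
  | inl (inr (inl e)) => inl (inl (inr e))
  | inl (inr (inr e)) => inr (inl (inr e))
  | inr (inl (inl e)) => inl (inr (inl e))
  | inr (inl (inr e)) => inr (inr (inl e))
  | inr (inr (inl e)) => inl (inr (inr e))
  | inr (inr (inr e)) => inr (inr (inr e))
  end.

Lemma hcompg_wire_inj k l k' l' (G : graph k l) (G' : graph k' l') :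
  injective (@hcompg_wire _ _ _ _ G G').
Proof. by move=> [[[x|x]|[x|x]]|[[x|x]|[x|x]]] [[[y|y]|[y|y]]|[[y|y]|[y|y]]] //= [->]. Qed.

Lemma hcompg_wire_surj k l k' l' (G : graph k l) (G' : graph k' l') x :
  exists w, @hcompg_wire _ _ _ _ G G' w = x.
Proof.
move: x => [[[x|x]|[x|x]]|[[x|x]|[x|x]]].
- by exists (inl (inl (inl x))).
- by exists (inl (inr (inl x))).
- by exists (inr (inl (inl x))).
- by exists (inr (inr (inl x))).
- by exists (inl (inl (inr x))).
- by exists (inl (inr (inr x))).
- by exists (inr (inl (inr x))).
- by exists (inr (inr (inr x))).
Qed.

Lemma hcompg_wsrc k l k' l' (G : graph k l) (G' : graph k' l') w :
  wsrc (hcompg G G') w = match hcompg_wire w with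
    | inl x => sum_map inl id (wsrc G x)
    | inr x => sum_map inr (addn k) (wsrc G' x)
    end.
Proof. by move: w => [[[x|x]|[x|x]]|[[x|x]|[x|x]]]. Qed.

Lemma hcompg_wtgt k l k' l' (G : graph k l) (G' : graph k' l') w :
  wtgt (hcompg G G') w = match hcompg_wire w with
    | inl x => sum_map inl id (wtgt G x)
    | inr x => sum_map inr (addn l) (wtgt G' x)
    end.
Proof. by move: w => [[[x|x]|[x|x]]|[[x|x]|[x|x]]]. Qed.

Section SubHcomp.
Variables (k0 l0 : nat) (H : graph k0 l0).
Variables (k1 l1 k2 l2 : nat) (G1 : graph k1 l1) (G2 : graph k2 l2).
Variables (R R1 R2 : region H).

Lemma sub_hcompg :
  sub R1 G1 -> sub R2 G2 ->
  (forall v, rV R1 v -> rV R2 v -> False) ->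
  (forall v, rL R1 v -> rL R2 v -> False) ->
  (forall h, rW R1 h -> rW R2 h -> False) ->
  (forall v, rV R v <-> rV R1 v \/ rV R2 v) ->
  (forall v, rL R v <-> rL R1 v \/ rL R2 v) ->
  (forall h, rW R h <-> rW R1 h \/ rW R2 h) ->
  (forall h, ins R1 h -> rin R h = rin R1 h) ->
  (forall h, ins R2 h -> rin R h = (k1 + rin R2 h)%N) ->
  (forall h, outs R1 h -> rout R h = rout R1 h) ->
  (forall h, outs R2 h -> rout R h = (l1 + rout R2 h)%N) ->
  sub R (hcompg G1 G2).
Proof.
move=> [a1 [b1 [p1 [ia1 ib1 ip1 hV1 hL1 hW1 hs1 ht1 s1 t1]]]].
move=> [a2 [b2 [p2 [ia2 ib2 ip2 hV2 hL2 hW2 hs2 ht2 s2 t2]]]].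
move=> dV dL dW eV eL eW ei1 ei2 eo1 eo2.
have A1 x : rV R1 (a1 x) by apply/hV1; exists x.
have A2 x : rV R2 (a2 x) by apply/hV2; exists x.
have Q1 x : rW R1 (p1 x) by apply/hW1; exists x.
have Q2 x : rW R2 (p2 x) by apply/hW2; exists x.
have pE : forall h, rW R h <-> exists x, copair p1 p2 x = h by exact: copair_im.
exists (copair a1 a2), (copair b1 b2), (fun w => copair p1 p2 (hcompg_wire w)).
split.
- by apply: copair_inj => // x y e; apply: (dV (a1 x)); rewrite // e.
- apply: copair_inj => // x y e; apply: (dL (b1 x)); first by apply/hL1; exists x.
  by rewrite e; apply/hL2; exists y.
- apply: inj_comp (@hcompg_wire_inj _ _ _ _ _ _).
  by apply: copair_inj => // x y e; apply: (dW (p1 x)); rewrite // e.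
- exact: copair_im.
- exact: copair_im.
- move=> h; rewrite pE; split=> -[x <-]; last by eexists.
  by have [w <-] := hcompg_wire_surj x; exists w.
- move=> w; rewrite hcompg_wsrc; case: (hcompg_wire w) => {}w /=.
    have := hs1 w; case: (wsrc G1 w) => //= i [<- fx]; split.
      apply: ei1; split=> // v ev /hV1 [x ex]; apply: (fx x); rewrite ev ex //.
    case=> [//|x] /= ex; apply: (dW (p1 w)) => //; exact: s2 ex (A2 x).
  have := hs2 w; case: (wsrc G2 w) => //= i [<- fx]; split.
    apply: ei2; split=> // v ev /hV2 [x ex]; apply: (fx x); rewrite ev ex //.
  case=> [x|//] /= ex; apply: (dW (p2 w)) => //; exact: s1 ex (A1 x).
- move=> w; rewrite hcompg_wtgt; case: (hcompg_wire w) => {}w /=.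
    have := ht1 w; case: (wtgt G1 w) => //= i [<- fx]; split.
      apply: eo1; split=> // v ev /hV1 [x ex]; apply: (fx x); rewrite ev ex //.
    case=> [//|x] /= ex; apply: (dW (p1 w)) => //; exact: t2 ex (A2 x).
  have := ht2 w; case: (wtgt G2 w) => //= i [<- fx]; split.
    apply: eo2; split=> // v ev /hV2 [x ex]; apply: (fx x); rewrite ev ex //.
  case=> [x|//] /= ex; apply: (dW (p2 w)) => //; exact: t1 ex (A1 x).
- by move=> h v ev; rewrite eV eW => -[/(s1 _ _ ev)|/(s2 _ _ ev)]; [left|right].
- by move=> h v ev; rewrite eV eW => -[/(t1 _ _ ev)|/(t2 _ _ ev)]; [left|right].
Qed.

(** With neither vertices nor loops only the numbers are left; equal numbers at both ends identify a
    wire with the strand of that number. *)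
Lemma sub_id n :
  (forall v, ~ rV R v) -> (forall v, ~ rL R v) ->
  (forall h, rW R h -> rin R h = rout R h) -> labelling n (rW R) (rin R) ->
  sub R (id_graph n).
Proof.
move=> nV nL io [lt surj inj]; have [hV hE hI hO hL hT] := id_graphP n.
have sE (w : wire (id_graph n)) : exists i : 'I_n,
    wsrc (id_graph n) w = inr (i : nat) /\ wtgt (id_graph n) w = inr (i : nat).
  case: w => [[/hE|/hO]|[/hI|t]] //; exists (inidx (id_graph n) (inr t)) => /=.
  by rewrite hT.
have [i iE] := choice sE.
have pex (w : wire (id_graph n)) : exists h, rW R h /\ rin R h = i w.
  by have [h Wh eh] := surj _ (ltn_ord (i w)); exists h.
have [p pE] := choice pex.
exists (fun v => False_rect _ (hV v)), (fun v => False_rect _ (hL v)), p; split.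
- by move=> x; case: (hV x).
- by move=> x; case: (hL x).
- move=> w w' e; have [_ e1] := pE w; have [_ e2] := pE w'.
  have ei : i w = i w' by apply: val_inj; rewrite /= -e1 -e2 e.
  apply: (lab_inj (wsrc_labelling (id_graph n)));
    by rewrite /= ?(iE w).1 ?(iE w').1 //= ei.
- by move=> v; split=> [/nV //|[x]]; case: (hV x).
- by move=> v; split=> [/nL //|[x]]; case: (hL x).
- move=> h; split=> [Wh|[x <-]]; last by case: (pE x).
  have [w _ ew] := lab_surj (wsrc_labelling (id_graph n)) (lt _ Wh).
  exists w; apply: inj => //; first by case: (pE w).
  by rewrite (pE w).2 -ew (iE w).1.
- move=> w; rewrite (iE w).1; split; first by case: (pE w).
  by move=> x; case: (hV x).
- move=> w; rewrite (iE w).2; split; last by move=> x; case: (hV x).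
  by rewrite -io; case: (pE w).
- by move=> h v _ /nV.
- by move=> h v _ /nV.
Qed.

End SubHcomp.

(** * Cuts and slices *)

(** A loop is attached to no vertex, so the cut has to say on which side it lies. Of [clab] only the
    values on crossing wires matter. *)
Record cut k l (H : graph k l) := Cut {
  cV : vert H -> Prop;
  cL : loop H -> Prop;
  clab : wire H -> nat
}.

Section Cuts.
Variables (k0 l0 : nat) (H : graph k0 l0).
Implicit Types c d : cut H.

(** An external source is an input and lies below every cut; dually, [free_end] places an external
    target above every cut. *)
Definition below (A : vert H -> Prop) (x : vert H + nat) : Prop :=
  forall v, x = inl v -> A v.

Definition crosses c h := below (cV c) (wsrc H h) /\ free_end (cV c) (wtgt H h).

Definition down_closed (A : vert H -> Prop) :=
  forall h v, wtgt H h = inl v -> A v -> below A (wsrc H h).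

Definition cut_ok n c := down_closed (cV c) /\ labelling n (crosses c) (clab c).

Definition cut_le c d :=
  (forall v, cV c v -> cV d v) /\ (forall x, cL c x -> cL d x).

(** Wires that cross both cuts without meeting a vertex in between are included, so that for [c]
    below [d] the inputs are all the wires crossing [c] and the outputs all those crossing [d]. *)
Definition slice c d : region H := {|
  rV := fun v => ~ cV c v /\ cV d v;
  rL := fun x => ~ cL c x /\ cL d x;
  rW := fun h => below (cV d) (wsrc H h) /\ free_end (cV c) (wtgt H h);
  rin := clab c;
  rout := clab d
|}.

Definition cut0 : cut H :=
  Cut (fun=> False) (fun=> False) (fun h => endlab (wsrc H h)).

Definition cut1 : cut H :=
  Cut (fun=> True) (fun=> True) (fun h => endlab (wtgt H h)).

Lemma cut0_le c : cut_le cut0 c. Proof. by split=> v []. Qed.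

Lemma cut1_ge c : cut_le c cut1. Proof. by split=> v cv. Qed.

Lemma cut0_ok : cut_ok k0 cut0.
Proof.
split=> //; apply: (labelling_ext _ _ (wsrc_labelling H)) => // h; split.
  by move=> /= oh; split=> [v e|v e []]; rewrite e in oh.
by case=> [fh _]; case e: (wsrc H h) => [v|//]; have := fh v e.
Qed.

Lemma cut1_ok : cut_ok l0 cut1.
Proof.
split=> //; apply: (labelling_ext _ _ (wtgt_labelling H)) => // h; split.
  by move=> /= oh; split=> [v e //|v e]; rewrite e in oh.
by case=> [_ fh]; case e: (wtgt H h) => [v|//]; case: (fh v e).
Qed.

Lemma cut_exists (A : vert H -> Prop) (B : loop H -> Prop) : down_closed A ->
  exists n lab, cut_ok n (Cut A B lab).
Proof.
move=> dA; have [n [lab hlab]] :=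
  labelling_exists (crosses (Cut A B (fun=> 0))) (wire_fin H).
by exists n, lab.
Qed.

Lemma slice_ins c d h : cut_le c d -> ins (slice c d) h <-> crosses c h.
Proof.
move=> [cd _]; rewrite /ins /=; split.
  move=> [[h1 h2] h3]; split=> // v ev; have := h3 _ ev; have := h1 _ ev.
  by case: (pselect (cV c v)) => // nc dv []; split.
move=> [h1 h2]; split; first by split=> // v /h1 /cd.
by move=> v /h1 cv [].
Qed.

Lemma slice_outs c d h : cut_le c d -> outs (slice c d) h <-> crosses d h.
Proof.
move=> [cd _]; rewrite /outs /=; split.
  move=> [[h1 h2] h3]; split=> // v ev dv.
  by have := h3 _ ev; apply; split=> //; exact: h2 ev.
move=> [h1 h2]; split; first by split=> // v /h2 dv /cd.
by move=> v /h2 dv [].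
Qed.

Lemma slice_exists m n c d : cut_ok m c -> cut_ok n d -> cut_le c d ->
  exists G : graph m n, sub (slice c d) G.
Proof.
move=> [dc lc] [dd ld] cd; apply: sub_exists; split.
- move=> h v ev [ncv dv]; split=> [v'|v' ev' cv' /=]; first by rewrite ev => -[<-].
  by apply: ncv; exact: dc ev' cv' _ ev.
- move=> h v ev [ncv dv]; split=> [|v']; first exact: dd ev dv.
  by rewrite ev => -[<-].
- by apply: (labelling_ext _ _ lc) => // h; rewrite slice_ins.
- by apply: (labelling_ext _ _ ld) => // h; rewrite slice_outs.
Qed.

Lemma slice_out_ok k n c d (G : graph k n) : cut_le c d -> sub (slice c d) G ->
  labelling n (crosses d) (clab d).
Proof.
move=> cd /sub_ok [_ _ _ ho].
by apply: (labelling_ext _ _ ho) => // h; rewrite slice_outs.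
Qed.

Lemma slice_in_ok k n c d (G : graph k n) : cut_le c d -> sub (slice c d) G ->
  labelling k (crosses c) (clab c).
Proof.
move=> cd /sub_ok [_ _ hi _].
by apply: (labelling_ext _ _ hi) => // h; rewrite slice_ins.
Qed.

(** The wires common to both slices are those crossing [d]. By down-closedness a wire that ends
    below [d] also starts below [d], so every wire of the large slice lies in one of the two. *)
Lemma slice_vcompg k l m c d e (G1 : graph l m) (G2 : graph k l) :
  down_closed (cV d) -> cut_le c d -> cut_le d e ->
  sub (slice d e) G1 -> sub (slice c d) G2 -> sub (slice c e) (vcompg G1 G2).
Proof.
move=> dd [cd cdL] [de deL] s1 s2; apply: sub_vcompg s1 s2 _ _ _ _ _ _ _ _ _ _ => //=.
- by move=> v [nd _] [_ /nd].
- by move=> v [nd _] [_ /nd].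
- move=> h [h1 h2]; split.
    move=> h3; split=> [v ev|v ev cv]; last by apply: h2 ev (cd _ cv).
    have := h3 _ ev; have := h1 _ ev.
    by case: (pselect (cV d v)) => // nd ev' []; split.
  by move=> [h3 h4] v /h3 dv [].
- move=> h [h1 h2]; split.
    move=> h3; split=> [v /h1 /de //|v ev dv].
    by apply: (h3 _ ev); split=> //; apply: h2 ev.
  by move=> [h3 h4] v /h4 dv [].
- move=> v; case: (pselect (cV d v)) => dv; split.
  + by move=> [cv ev]; right.
  + by move=> [[] //|[cv _]]; split=> //; exact: de.
  + by move=> [cv ev]; left.
  + by move=> [[_ ev]|[] //]; split=> // /cd.
- move=> v; case: (pselect (cL d v)) => dv; split.
  + by move=> [cv ev]; right.
  + by move=> [[] //|[cv _]]; split=> //; exact: deL.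
  + by move=> [cv ev]; left.
  + by move=> [[_ ev]|[] //]; split=> // /cdL.
- move=> h; split.
    move=> [h1 h2]; case: (pselect (free_end (cV d) (wtgt H h))) => h3; first by left.
    right; split=> //; have [v [ev dv]] : exists v, wtgt H h = inl v /\ cV d v.
      apply: contrapT => nv; apply: h3 => v ev dv; apply: nv; by exists v.
    exact: dd ev dv.
  move=> [[h1 h2]|[h1 h2]]; split=> // v ev; first by move=> /cd; exact: h2.
  by apply: de; exact: h1.
Qed.

Lemma sub_whole : sub (slice cut0 cut1) H.
Proof.
exists id, id, id; split=> //=.
- by move=> v; split=> [_|_]; [exists v|split=> // -[]].
- by move=> v; split=> [_|_]; [exists v|split=> // -[]].
- by move=> v; split=> [_|_]; [exists v|split=> [u|u _ []]].
- by move=> w; rewrite /= /cut0 /=; case: (wsrc H w).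
- by move=> w; rewrite /= /cut1 /=; case: (wtgt H w).
- by move=> h v _ _; split=> [u|u _ []].
- by move=> h v _ _; split=> [u|u _ []].
Qed.

(** The converse of [slice_vcompg]: the cut consists of the nodes of the lower factor, and its wires
    are numbered by the outputs of that factor. *)
Lemma vcompg_cut k l m (G1 : graph l m) (G2 : graph k l) :
  giso H (vcompg G1 G2) ->
  exists c, [/\ cut_ok l c, sub (slice cut0 c) G2 & sub (slice c cut1) G1].
Proof.
move=> /giso_sym/giso_wiso [fV [fL [fW [bV bL bW Hs Ht]]]].
have iV := bij_inj bV; have iL := bij_inj bL; have iW := bij_inj bW.
have [gV gVK fVK] := bV; have [gL gLK fLK] := bL; have [gW gWK fWK] := bW.
have [q qE] := choice (low_surj G1 (G := G2)).
have [r rE] := choice (up_surj G2 (G' := G1)).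
pose A (v : vert H) := exists x, fV (inl x) = v.
pose B (v : loop H) := exists x, fL (inl x) = v.
pose nu h := if low (gW h) is Some w then endlab (wtgt G2 w) else 0.
have nA y : ~ A (fV (inr y)) by move=> [x /iV].
(* Starting below the cut means having a part in the lower factor; [upP] is the dual. A crossing
   wire has both parts, so the default 0 of [nu] never shows. *)
have lowP h : below A (wsrc H h) <-> exists w, low (gW h) = Some w.
  rewrite -[in wsrc _ _](fWK h) Hs; split.
    case lc: (low (gW h)) => [w|] sA; first by exists w.
    have [w [v [uc sw]]] := low_None lc; exfalso.
    by apply: (nA v); apply: sA; rewrite (up_src uc sw).
  move=> [w lc] v; rewrite (low_src lc); case: (wsrc G2 w) => //= x [<-].
  by exists x.
have upP h : free_end A (wtgt H h) <-> exists w, up (gW h) = Some w.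
  rewrite -[in wtgt _ _](fWK h) Ht; split.
    case uc: (up (gW h)) => [w|] sA; first by exists w.
    have [w [v [lc tw]]] := up_None uc; exfalso.
    by apply: (sA (fV (inl v))); [rewrite (low_tgt lc tw)|exists v].
  move=> [w uc] v; rewrite (up_tgt uc); case: (wtgt G1 w) => //= x [<-].
  exact: nA.
have dA : down_closed A.
  move=> h v ev Av; apply/lowP; case uc: (up (gW h)) => [w|].
    by have /upP/(_ v ev) : exists w, up (gW h) = Some w by exists w.
  by have [w [_ [lc _]]] := up_None uc; exists w.
have s2 : sub (slice cut0 (Cut A B nu)) G2.
  exists (fun x => fV (inl x)), (fun x => fL (inl x)), (fun w => fW (q w)); split.
  - by move=> x y /iV [].
  - by move=> x y /iL [].
  - by move=> x y /iW e; have := qE x; rewrite e qE => -[].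
  - by move=> v; split=> [[]|[x <-]] //; split=> //; exists x.
  - by move=> v; split=> [[]|[x <-]] //; split=> //; exists x.
  - move=> h; split=> [[/lowP [w lc] _]|[w <-]].
      by exists w; rewrite (low_inj (qE w) lc) fWK.
    by split; [apply/lowP; exists w; rewrite gWK|move=> v _ []].
  - move=> w; have := Hs (q w); rewrite (low_src (qE w)) /=.
    by case: (wsrc G2 w) => [x|i] /= -> //; split.
  - move=> w /=; case tw: (wtgt G2 w) => [x|i].
      by rewrite Ht (low_tgt (qE w) tw).
    split; first by rewrite /nu gWK qE tw.
    move=> x ex; have : free_end A (wtgt H (fW (q w))); last first.
      by move=> /(_ _ ex); apply; exists x.
    apply/upP; rewrite gWK; case uc: (up (q w)) => [w'|]; first by exists w'.
    have [w' [v [lc tw']]] := up_None uc.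
    by move: lc tw'; rewrite qE => -[<-]; rewrite tw.
  - move=> h v ev [_ Av]; split=> [v'|v' _ []]; by rewrite ev => -[<-].
  - move=> h v ev [_ Av]; split=> [|v' _ []]; exact: dA ev Av.
have rV1 v : rV (slice (Cut A B nu) cut1) v <-> exists x, fV (inr x) = v.
  split=> [[nv _]|[x <-]]; last by split=> // /nA.
  rewrite -(fVK v) in nv *; case: (gV v) nv => x nv; last by exists x.
  by case: nv; exists x.
have s1 : sub (slice (Cut A B nu) cut1) G1.
  exists (fun x => fV (inr x)), (fun x => fL (inr x)), (fun w => fW (r w)); split.
  - by move=> x y /iV [].
  - by move=> x y /iL [].
  - by move=> x y /iW e; have := rE x; rewrite e rE => -[].
  - exact: rV1.
  - move=> v; split=> [[nv _]|[x <-]]; last by split=> // -[y /iL].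
    rewrite -(fLK v) in nv *; case: (gL v) nv => x nv; last by exists x.
    by case: nv; exists x.
  - move=> h; split=> [[_ /upP [w uc]]|[w <-]].
      by exists w; rewrite (up_inj (rE w) uc) fWK.
    by split=> //; apply/upP; exists w; rewrite gWK.
  - move=> w /=; case sw: (wsrc G1 w) => [x|i].
      by rewrite Hs (up_src (rE w) sw).
    have [w' lc] : exists w', low (r w) = Some w'.
      case lc: (low (r w)) => [w'|]; first by exists w'.
      have [w' [v [uc sw']]] := low_None lc.
      by move: uc sw'; rewrite rE => -[<-]; rewrite sw.
    have [j [tw' sw']] := low_up lc (rE w).
    split; first by rewrite /nu gWK lc tw'; move: sw'; rewrite sw => -[].
    move=> x; rewrite Hs (low_src lc); case: (wsrc G2 w') => //= y [/iV //].
  - move=> w; have := Ht (r w); rewrite (up_tgt (rE w)) /=.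
    by case: (wtgt G1 w) => [x|i] /= -> //; split.
  - move=> h v ev [nv _]; split=> [//|v' ev' Av'].
    by apply: nv; apply: dA ev' Av' _ ev.
  - by move=> h v ev [nv _]; split=> // v'; rewrite ev => -[<-].
exists (Cut A B nu); split=> //; split=> //.
exact: slice_out_ok (cut0_le _) s2.
Qed.

End Cuts.

(** * Change of numbering *)

Lemma labelling_card (W : Type) m n (A : W -> Prop) lab lab' :
  labelling m A lab -> labelling n A lab' -> m = n.
Proof.
suff le p q (l1 l2 : W -> nat) : labelling p A l1 -> labelling q A l2 -> p <= q.
  by move=> h1 h2; apply/eqP; rewrite eqn_leq (le _ _ _ _ h1 h2) (le _ _ _ _ h2 h1).
move=> [_ s1 _] [lt2 _ inj2].
have ex (i : 'I_p) : exists w, A w /\ l1 w = i.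
  by have [w Aw ew] := s1 i (ltn_ord i); exists w.
have [w wE] := choice ex.
have lt (i : 'I_p) : l2 (w i) < q by apply: lt2; case: (wE i).
have : injective (fun i => Ordinal (lt i)).
  move=> i j [] /inj2 e; apply: val_inj => /=; have [Ai <-] := wE i; have [Aj <-] := wE j.
  by rewrite e.
by move/leq_card; rewrite !card_ord.
Qed.

Lemma labelling_perm (W : Type) n (A : W -> Prop) lab lab' :
  labelling n A lab -> labelling n A lab' ->
  exists s : 'S_n, forall w (i : 'I_n), A w -> lab w = i -> lab' w = s i.
Proof.
move=> [_ s1 inj1] [lt2 _ inj2].
have ex (i : 'I_n) : exists w, A w /\ lab w = i.
  by have [w Aw ew] := s1 i (ltn_ord i); exists w.
have [w wE] := choice ex.
have lt (i : 'I_n) : lab' (w i) < n by apply: lt2; case: (wE i).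
have inj : injective (fun i => Ordinal (lt i)).
  move=> i j [] /inj2 e; apply: val_inj => /=; have [Ai <-] := wE i; have [Aj <-] := wE j.
  by rewrite e.
exists (perm inj) => v i Av ei; rewrite permE /=; congr lab'.
by have [Ai ei'] := wE i; apply: inj1 => //; rewrite ei ei'.
Qed.

Section Relabel.
Variables (k0 l0 : nat) (H : graph k0 l0).
Implicit Type R : region H.

Lemma sub_lactg R R' k l (s : 'S_l) (G : graph k l) :
  (forall v, rV R v <-> rV R' v) -> (forall v, rL R v <-> rL R' v) ->
  (forall h, rW R h <-> rW R' h) ->
  (forall h, ins R h -> rin R h = rin R' h) ->
  (forall h (i : 'I_l), outs R h -> rout R h = i -> rout R' h = s i) ->
  sub R G -> sub R' (lactg s G).
Proof.
move=> eV eL eW ei eo sR.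
pose R2 := Region (rV R) (rL R) (rW R) (rin R) (rout R').
apply: (@sub_ext _ _ H R2) => //.
move: sR => [a [b [p [ia ib ip hV hL hW hs ht h h']]]].
exists a, b, p; split=> // w; have := ht w.
case: w => [[x|x]|[x|x]] //= [ex fx]; split=> //; apply: eo => //; split.
- by apply/hW; exists (inl (inr x)).
- by move=> v ev /hV [y ey]; apply: (fx y); rewrite ev ey.
- by apply/hW; exists (inr (inr x)).
- by move=> v ev /hV [y ey]; apply: (fx y); rewrite ev ey.
Qed.

Lemma sub_ractg R R' k l (t : 'S_k) (G : graph k l) :
  (forall v, rV R v <-> rV R' v) -> (forall v, rL R v <-> rL R' v) ->
  (forall h, rW R h <-> rW R' h) ->
  (forall h (i : 'I_k), ins R h -> rin R h = i -> rin R' h = (t^-1)%g i) ->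
  (forall h, outs R h -> rout R h = rout R' h) ->
  sub R G -> sub R' (ractg G t).
Proof.
move=> eV eL eW ei eo sR.
pose R2 := Region (rV R) (rL R) (rW R) (rin R') (rout R).
apply: (@sub_ext _ _ H R2) => //.
move: sR => [a [b [p [ia ib ip hV hL hW hs ht h h']]]].
exists a, b, p; split=> // w; have := hs w.
case: w => [x|x] //= [ex fx]; split=> //; apply: ei => //; split.
- by apply/hW; exists (inr x).
- by move=> v ev /hV [y ey]; apply: (fx y); rewrite ev ey.
Qed.

Lemma region_in_ext R R' : (forall v, rV R v <-> rV R' v) ->
  (forall h, rW R h <-> rW R' h) -> forall h, ins R h <-> ins R' h.
Proof.
by move=> eV eW h; rewrite /ins eW; split=> -[Wh f]; split=> // v /f nv /eV.
Qed.

Lemma region_out_ext R R' : (forall v, rV R v <-> rV R' v) ->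
  (forall h, rW R h <-> rW R' h) -> forall h, outs R h <-> outs R' h.
Proof.
by move=> eV eW h; rewrite /outs eW; split=> -[Wh f]; split=> // v /f nv /eV.
Qed.

Lemma sub_dims R R' k l k' l' (G : graph k l) (G' : graph k' l') :
  (forall v, rV R v <-> rV R' v) -> (forall h, rW R h <-> rW R' h) ->
  sub R G -> sub R' G' -> k = k' /\ l = l'.
Proof.
move=> eV eW /sub_ok [_ _ i o] /sub_ok [_ _ i' o']; split.
  apply: labelling_card i _; apply: (labelling_ext _ _ i') => // h.
  by apply: region_in_ext => x; rewrite ?eV ?eW.
apply: labelling_card o _; apply: (labelling_ext _ _ o') => // h.
by apply: region_out_ext => x; rewrite ?eV ?eW.
Qed.

(** Such regions differ only in how inputs and outputs are numbered, and two numberings of one set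
    differ by a permutation. *)
Lemma sub_perm R R' k l (G G' : graph k l) :
  (forall v, rV R v <-> rV R' v) -> (forall v, rL R v <-> rL R' v) ->
  (forall h, rW R h <-> rW R' h) ->
  sub R G -> sub R' G' -> exists s t, giso G' (lactg s (ractg G t)).
Proof.
move=> eV eL eW sR sR'.
have [_ _ i o] := sub_ok sR; have [_ _ i' o'] := sub_ok sR'.
have [s sE] : exists s : 'S_l, forall w (i : 'I_l), outs R w -> rout R w = i ->
    rout R' w = s i.
  apply: labelling_perm o _; apply: (labelling_ext _ _ o') => // h.
  by apply: region_out_ext => x; rewrite ?eV ?eW.
have [t tE] : exists t : 'S_k, forall w (i : 'I_k), ins R w -> rin R w = i ->
    rin R' w = t i.
  apply: labelling_perm i _; apply: (labelling_ext _ _ i') => // h.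
  by apply: region_in_ext => x; rewrite ?eV ?eW.
exists s, (t^-1)%g; apply: sub_uniq sR' _.
pose R2 := Region (rV R) (rL R) (rW R) (rin R') (rout R).
apply: (@sub_lactg R2) => //.
by apply: sub_ractg sR => // h j; rewrite invgK; exact: tE.
Qed.

End Relabel.

Definition nodeless k l (G : graph k l) : Prop :=
  empty_type (vert G) /\ empty_type (loop G).

Lemma nodeless_giso k l k' l' (G : graph k l) (G' : graph k' l') :
  giso G G' -> nodeless G -> nodeless G'.
Proof.
move=> /giso_sym/giso_wiso [fV [fL [_ _]]] [nV nL].
by split=> [/fV /nV|/fL /nL].
Qed.

(** Every wire runs from an input to an output. Numbering both ends by the input turns the graph
    into an identity, and a permutation on the right of an identity can be moved to its left. *)
Lemma nodeless_perm k l (G : graph k l) : nodeless G ->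
  exists (e : k = l) (s : 'S_l), giso G (lactg s (id_graph l)).
Proof.
move=> [nV nL]; have sG := sub_whole G; have [_ _ hi ho] := sub_ok sG.
pose R := Region (fun=> False) (fun=> False) (fun=> True)
  (fun h => endlab (wsrc G h)) (fun h => endlab (wsrc G h)).
have sR : sub R (id_graph k).
  apply: sub_id => //; apply: (labelling_ext _ _ hi) => // h; split=> // _.
  by split=> [|v]; [split=> v; case: (nV v)|case: (nV v)].
have e : k = l.
  have [|h|_ ->//] := sub_dims _ _ sR sG; first by move=> v; case: (nV v).
  by split=> // _; split=> v; case: (nV v).
exists e; subst l.
have [|v|h|s [t st]] := sub_perm _ _ _ sR sG.
- by move=> v; case: (nV v).
- by case: (nL v).
- by split=> // _; split=> v; case: (nV v).
exists (t * s)%g; apply: giso_trans st _; apply: giso_sym.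
apply: giso_trans (lactgM _ _ _) _; apply: giso_lactg.
apply: giso_trans (giso_sym (vcomp_idg _ (id_graphP k))) _.
apply: giso_trans (giso_sym (vcompg_act _ _ _)) _.
exact: vcompg_id (id_graphP k).
Qed.

(** * Evaluation of graphs *)

(** An upper bound passes along injections, which suits an induction on the size and avoids counting
    disjoint unions. *)
Definition at_most (T : Type) n : Prop := exists f : T -> 'I_n, injective f.

Lemma at_most_inj (T U : Type) (f : T -> U) n :
  injective f -> at_most U n -> at_most T n.
Proof. by move=> fi [g gi]; exists (g \o f); exact: inj_comp. Qed.

Lemma at_most_strict (T U : Type) (f : T -> U) u n :
  injective f -> (forall t, f t <> u) -> at_most U n.+1 -> at_most T n.
Proof.
move=> fi fu [g gi].
have ex t : exists j, g (f t) = fintype.lift (g u) j.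
  have /unlift_some [j -> _] : g u != g (f t).
    by apply/eqP => /gi /esym /fu.
  by exists j.
have [h hE] := choice ex; exists h => t t' e.
by apply/fi/gi; rewrite !hE e.
Qed.

Lemma at_most_finite (T : Type) : finite_set [set: T] -> exists n, at_most T n.
Proof.
move=> fT; have [n [lab [lt _ inj]]] := labelling_exists (fun=> True) fT.
exists n, (fun t => Ordinal (lt t Logic.I)) => t t' [] e; exact: inj.
Qed.

Lemma cast2_id (K : fieldType) (M : SSmodule K) k l (ek : k = k) (el : l = l)
  (x : M k l) : cast2 ek el x = x.
Proof. by rewrite (eq_irrelevance ek erefl) (eq_irrelevance el erefl). Qed.

Lemma labelling0 (W : Type) (A : W -> Prop) lab :
  (forall w, ~ A w) -> labelling 0 A lab.
Proof. by move=> nA; split=> // [w|w w'] /[dup] Aw; case: (nA _ Aw). Qed.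

Section GraphVec.
Variable K : fieldType.

Lemma graph_vec_inj k l (G H : graph k l) :
  graph_vec K G = graph_vec K H -> giso G H.
Proof.
move=> e; apply/iso_classP; apply/eqP; have := congr1 (coeff (iso_class G)) e.
rewrite /graph_vec !coeffU eqxx !mul1r eq_sym; case: eqP => //= _ /eqP.
by rewrite oner_eq0.
Qed.

Lemma cast2_vec_giso k l k' l' (ek : k = k') (el : l = l') (G : graph k l)
    (H : graph k' l') :
  graph_vec K H = @cast2 K (Gr K) _ _ _ _ ek el (graph_vec K G) -> giso H G.
Proof. by move: H; case: k' / ek; case: l' / el => H; exact: graph_vec_inj. Qed.

Lemma indecomposable_span k l (C : graph k l) : indecomposable C ->
  graph_vec K C \in @gr_ind_span K k l.
Proof.
move=> hC; apply/asboolP; exists [:: (1%R, C)]; last by rewrite big_seq1 scale1r.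
by move=> c; rewrite inE => /eqP ->.
Qed.

Definition ind_vec k l (C : graph k l) (hC : indecomposable C) : Gr_ind K k l :=
  GrInd (indecomposable_span hC).

End GraphVec.

Section Evaluation.
Variables (K : fieldType) (P : ProP K).
Variable phi : forall k l, Gr_ind K k l -> P k l.

(** The relation lives on vectors of [Gr], where the axioms of a ProP are equations, so that one
    calculation can be run in [Gr] and in [P] at the same time. *)
Inductive eval : forall k l, Gr K k l -> P k l -> Prop :=
| eval_gen k l (C : graph k l) (hC : indecomposable C) :
    eval (graph_vec K C : Gr K k l) (phi (ind_vec K hC))
| eval_unit0 : eval (unit0 : Gr K 0 0) unit0
| eval_unit1 : eval (unit1 : Gr K 1 1) unit1
| eval_lact k l s (x : Gr K k l) p : eval x p -> eval (lact s x) (lact s p)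
| eval_ract k l t (x : Gr K k l) p : eval x p -> eval (ract x t) (ract p t)
| eval_hcomp k l k' l' (x : Gr K k l) (y : Gr K k' l') p q :
    eval x p -> eval y q -> eval (hcomp x y) (hcomp p q)
| eval_vcomp k l m (x : Gr K l m) (y : Gr K k l) p q :
    eval x p -> eval y q -> eval (vcomp x y) (vcomp p q).

Definition evalg k l (G : graph k l) (p : P k l) : Prop :=
  eval (graph_vec K G : Gr K k l) p.

Lemma evalg_giso k l (G H : graph k l) p : giso G H -> evalg G p -> evalg H p.
Proof. by rewrite /evalg => /(graph_vec_eq K) ->. Qed.

Lemma evalg_lact k l s (G : graph k l) p : evalg G p -> evalg (lactg s G) (lact s p).
Proof. by move=> /(eval_lact s); rewrite /evalg -gr_lact_vec. Qed.

Lemma evalg_ract k l t (G : graph k l) p : evalg G p -> evalg (ractg G t) (ract p t).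
Proof. by move=> /(eval_ract t); rewrite /evalg -gr_ract_vec. Qed.

Lemma evalg_hcomp k l k' l' (G : graph k l) (G' : graph k' l') p p' :
  evalg G p -> evalg G' p' -> evalg (hcompg G G') (hcomp p p').
Proof. by move=> e e'; have := eval_hcomp e e'; rewrite /evalg -gr_hcomp_vec. Qed.

Lemma evalg_vcomp k l m (G : graph l m) (G' : graph k l) p p' :
  evalg G p -> evalg G' p' -> evalg (vcompg G G') (vcomp p p').
Proof. by move=> e e'; have := eval_vcomp e e'; rewrite /evalg -gr_vcomp_vec. Qed.

Lemma evalg_id n : evalg (id_graph n) (unitn P n).
Proof.
by elim: n => [|n IH]; [exact: eval_unit0|exact: evalg_hcomp eval_unit1 IH].
Qed.

Definition evaluable k l (G : graph k l) : Prop := exists p, evalg G p.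

Lemma evaluable_giso k l (G H : graph k l) : giso G H -> evaluable G -> evaluable H.
Proof. by move=> gh [p ep]; exists p; exact: evalg_giso ep. Qed.

Lemma nodeless_evaluable k l (G : graph k l) : nodeless G -> evaluable G.
Proof.
move=> /nodeless_perm [e [s gs]]; subst l; apply: evaluable_giso (giso_sym gs) _.
by exists (lact s (unitn P k)); apply/evalg_lact/evalg_id.
Qed.

Lemma single_loop_indecomposable k l (G : graph k l) :
  single_loop G -> indecomposable G.
Proof.
move=> sG; have [[hV hE hI hO hT] [x hx]] := sG.
have nV k' l' (G' : graph k' l') : giso G G' -> empty_type (vert G').
  by move=> /giso_sym/giso_wiso [fV _] v; exact: hV (fV v).
split; [by right|by []|by right| |].
- by move=> m G' G'' /nV h; left=> v; exact: h (inr v).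
- by move=> k' l' k'' l'' G' G'' s t /nV h; left=> v; exact: h (inl v).
Qed.

(** Each loop is a generator of its own; they are juxtaposed one at a time, in the order of the
    labels [f]. *)
Lemma loops_evaluable k0 l0 (H : graph k0 l0) n (f : loop H -> nat) lin lout
    (G : graph 0 0) :
  injective f ->
  sub (Region (fun=> False) (fun x => f x < n) (fun=> False) lin lout) G ->
  evaluable G.
Proof.
move=> fi; elim: n G => [|n IH] G sG.
  apply: nodeless_evaluable; have [a [b [_ [_ _ _ hV hL _ _ _ _ _]]]] := sG.
  split=> x; first by have /(_ (ex_intro _ x erefl)) := (hV (a x)).2.
  by have /(_ (ex_intro _ x erefl)) := (hL (b x)).2.
have sn : region_ok 0 0 (Region (fun=> False) (fun x => f x < n) (fun=> False) lin lout).
  by split=> //; apply: labelling0 => h [].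
have [G1 sG1] := sub_exists sn; have [p ep] := IH _ sG1.
(* The map [f] is only injective, so the label [n] may be vacant; the region then stays the same. *)
have [[x ex]|nx] := pselect (exists x, f x = n); last first.
  exists p; apply: evalg_giso ep; apply: sub_uniq sG.
  apply: sub_ext sG1 => //= x; split=> [/leqW //|]; rewrite ltnS leq_eqVlt => /orP[/eqP ex|//].
  by case: nx; exists x.
have sx : region_ok 0 0 (Region (fun=> False) (eq^~ x) (fun=> False) lin lout).
  by split=> //; apply: labelling0 => h [].
have [G2 sG2] := sub_exists sx.
have iG2 : indecomposable G2.
  apply: single_loop_indecomposable; have [a [b [q [_ ib _ hV hL hW _ _ _ _]]]] := sG2.
  split; last first.
    have /hL [y ey] : rL (Region (fun=> False) (eq^~ x) (fun=> False) lin lout) x by [].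
    exists y => z; apply: ib; rewrite ey.
    by apply: (hL (b z)).2; exists z.
  have nW (w : wire G2) : False by have /(_ (ex_intro _ w erefl)) := (hW (q w)).2.
  split=> y.
  - by have /(_ (ex_intro _ y erefl)) := (hV (a y)).2.
  - exact: nW (inl (inl y)).
  - exact: nW (inr (inl y)).
  - exact: nW (inl (inr y)).
  - exact: nW (inr (inr y)).
exists (hcomp (phi (ind_vec K iG2)) p).
apply: evalg_giso (evalg_hcomp (eval_gen iG2) ep); apply: sub_uniq sG.
apply: sub_hcompg sG2 sG1 _ _ _ _ _ _ _ _ _ _ => //=.
- by move=> y -> ; rewrite ex ltnn.
- by move=> y; split=> [[]|[]].
- move=> y; split.
    by rewrite ltnS leq_eqVlt => /orP[/eqP|]; [left; apply: fi; rewrite ex|right].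
  by move=> [->|/leqW //]; rewrite ex.
- by move=> y; split=> [[]|[]].
Qed.

End Evaluation.

(** * Existence of a value *)

Section Total.
Variables (K : fieldType) (P : ProP K).
Variable phi : forall k l, Gr_ind K k l -> P k l.

Definition through k l (G : graph k l) (h : wire G) : Prop :=
  outer (wsrc G h) /\ outer (wtgt G h).

Lemma outer_free_end (V : Type) (A : V -> Prop) (x : V + nat) :
  (forall v, A v) -> free_end A x <-> outer x.
Proof.
move=> hA; split; last by case: x => // i _ v.
by case: x => // v /(_ v erefl (hA v)).
Qed.

(** Up to permutations, [G] is a juxtaposition of the part [GA] around its vertices, its loops [GL],
    and identity strands. The last two can always be evaluated, and [GA] falls under the
    hypothesis. *)
Lemma evaluable_reduce N :
  (forall k l (G : graph k l), at_most (vert G) N -> empty_type (loop G) ->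
    empty_type (thru G) -> evaluable phi G) ->
  forall k l (G : graph k l), at_most (vert G) N -> evaluable phi G.
Proof.
move=> base k l G aG.
have [ka [la hla]] := labelling_exists (fun h => ~ through h /\ outer (wsrc G h)) (wire_fin G).
have [kb [mu hmu]] := labelling_exists (fun h => ~ through h /\ outer (wtgt G h)) (wire_fin G).
have [n [nu hnu]] := labelling_exists (@through _ _ G) (wire_fin G).
have [N' [f fi]] := at_most_finite (loop_fin G).
pose RA := @Region _ _ G (fun=> True) (fun=> False) (fun h => ~ through h) la mu.
pose RL := @Region _ _ G (fun=> False) (fun=> True) (fun=> False) la mu.
pose RT := @Region _ _ G (fun=> False) (fun=> False) (@through _ _ G) nu nu.
have okA : region_ok ka kb RA.
  split=> //=.
  - by move=> h v ev _ []; rewrite ev.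
  - by move=> h v ev _ []; rewrite ev.
  - by apply: (labelling_ext _ _ hla) => // h; rewrite /ins /= outer_free_end.
  - by apply: (labelling_ext _ _ hmu) => // h; rewrite /outs /= outer_free_end.
have [GA sA] := sub_exists okA.
have okL : region_ok 0 0 RL by split=> //; apply: labelling0 => h [].
have [GL sL] := sub_exists okL.
have [pA eA] : evaluable phi GA.
  have [a [b [q [ia ib _ hV hL hW hs ht _ _]]]] := sA.
  apply: base; first exact: at_most_inj ia aG.
    by move=> x; have /(_ (ex_intro _ x erefl)) := (hL (b x)).2.
  move=> t; have /(_ (ex_intro _ (inr (inr t)) erefl)) := (hW (q (inr (inr t)))).2.
  have aV v : exists x, a x = v by apply/hV.
  case; split.
    have := hs (inr (inr t)) => /= -[_ h]; case: (wsrc _ _) h => // v.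
    by have [x <-] := aV v => /(_ x).
  have := ht (inr (inr t)) => /= -[_ h]; case: (wtgt _ _) h => // v.
  by have [x <-] := aV v => /(_ x).
have [pL eL] : evaluable phi GL.
  apply: (@loops_evaluable _ _ _ _ _ G N' (fun x => f x) la mu).
    by move=> x y /val_inj /fi.
  apply: sub_ext sL => //= x; split=> // _.
have sT : sub RT (id_graph n) by apply: sub_id => // x [].
have sAL : sub (Region (fun=> True) (fun=> True) (fun h => ~ through h) la mu) (hcompg GA GL).
  apply: sub_hcompg sA sL _ _ _ _ _ _ _ _ _ _ => //=.
  - by move=> v; split=> // _; left.
  - by move=> v; split=> // _; right.
  - by move=> v; split=> [|[]//]; left.
  - by move=> v [].
  - by move=> v [].
(* The strands come last, hence the offsets; the summand 0 is the contribution of [GL], which has no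
   external ends. *)
pose R := @Region _ _ G (fun=> True) (fun=> True) (fun=> True)
  (fun h => if `[< through h >] then (ka + 0 + nu h)%N else la h)
  (fun h => if `[< through h >] then (kb + 0 + nu h)%N else mu h).
have sR : sub R (hcompg (hcompg GA GL) (id_graph n)).
  apply: sub_hcompg sAL sT _ _ _ _ _ _ _ _ _ _ => //=.
  - by move=> v; split=> // _; left.
  - by move=> v; split=> // _; left.
  - by move=> h; split=> // _; case: (pselect (through h)); [right|left].
  - by move=> h [/= nh _]; case: asboolP.
  - by move=> h [/= th _]; case: asboolP.
  - by move=> h [/= nh _]; case: asboolP.
  - by move=> h [/= th _]; case: asboolP.
have eVW : (forall v, True <-> rV (slice (@cut0 _ _ G) (@cut1 _ _ G)) v) /\
    (forall x, True <-> rL (slice (@cut0 _ _ G) (@cut1 _ _ G)) x) /\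
    (forall h, True <-> rW (slice (@cut0 _ _ G) (@cut1 _ _ G)) h).
  by do 2?split=> //; move=> h; split=> // _; split=> // v _ [].
have [eV [eL' eW]] := eVW.
have sG := sub_whole G.
have [ek el] := sub_dims (R := R) eV eW sR sG; subst k l.
have [s [t st]] := sub_perm (R := R) eV eL' eW sR sG.
exists (lact s (ract (hcomp (hcomp pA pL) (unitn P n)) t)).
apply: evalg_giso (giso_sym st) _.
apply: evalg_lact; apply: evalg_ract; apply: evalg_hcomp; last exact: evalg_id.
exact: evalg_hcomp.
Qed.

(** After the reduction, a graph with a vertex can fail to be indecomposable only by splitting with
    vertices in both factors. The factors may again have loops or input-output edges, so the
    reduction is repeated at every level of the induction. *)
Lemma all_evaluable k l (G : graph k l) : evaluable phi G.
Proof.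
have [N] := at_most_finite (vert_fin G); elim: N k l G => [|N IH] k l G.
  move: k l G; apply: evaluable_reduce => k l G [f _] nL _.
  by apply: nodeless_evaluable; split=> // v; case: (f v).
move: k l G; apply: evaluable_reduce => k l G aG nL nT.
have [nV|nV] := pselect (empty_type (vert G)); first exact: nodeless_evaluable.
have [iG|niG] := pselect (indecomposable G).
  by exists (phi (ind_vec K iG)); exact: eval_gen.
have nonempty T : ~ empty_type T -> exists x : T, True.
  by move=> nT'; apply: contrapT => h; apply: nT' => x; apply: h; exists x.
have smaller (A B : Type) : at_most (A + B) N.+1 -> ~ empty_type A ->
    ~ empty_type B -> at_most A N /\ at_most B N.
  move=> aAB /nonempty[x _] /nonempty[y _]; split.
    by apply: (at_most_strict (f := inl) (u := inr y)) aAB => // t t' [].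
  by apply: (at_most_strict (f := inr) (u := inl x)) aAB => // t t' [].
have [[m [G' [G'' [iso n' n'']]]]|nv] := pselect (exists m (G' : graph m l)
    (G'' : graph k m), [/\ giso G (vcompg G' G''), ~ empty_type (vert G') &
    ~ empty_type (vert G'')]).
  have [fV [_ [_ [bV _ _ _ _]]]] := giso_wiso (giso_sym iso).
  have /smaller[] // := at_most_inj (bij_inj bV) aG.
  move=> /IH[p'' e''] /IH[p' e']; apply: evaluable_giso (giso_sym iso) _.
  by exists (vcomp p' p''); exact: evalg_vcomp.
have [[k' [l' [k'' [l'' [G' [G'' [s [t [iso n' n'']]]]]]]]]|nh] := pselect (exists
    k' l' k'' l'' (G' : graph k' l') (G'' : graph k'' l'') s t,
    [/\ giso G (lactg s (ractg (hcompg G' G'') t)), ~ empty_type (vert G') &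
    ~ empty_type (vert G'')]).
  have [fV [_ [_ [bV _ _ _ _]]]] := giso_wiso (giso_sym iso).
  have /smaller[] // := at_most_inj (bij_inj bV) aG.
  move=> /IH[p' e'] /IH[p'' e'']; have [? ?] := giso_dim iso; subst k l.
  apply: evaluable_giso (giso_sym iso) _.
  exists (lact s (ract (hcomp p' p'') t)).
  by apply: evalg_lact; apply: evalg_ract; apply: evalg_hcomp.
have either (A B : Prop) : ~ (~ A /\ ~ B) -> A \/ B.
  by move=> h; apply: contrapT => h'; apply: h; split=> a; apply: h'; [left|right].
case: niG; split=> //; first by left.
- by left.
- by move=> m G' G'' iso; apply: either => -[h h']; apply: nv; exists m, G', G''.
- move=> k' l' k'' l'' G' G'' s t iso; apply: either => -[h h']; apply: nh.
  by exists k', l', k'', l'', G', G'', s, t.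
Qed.

End Total.

(** * The last step of an evaluation *)

Section ProPTheory.
Variables (K : fieldType) (Q : ProP K).
Let ax := ProP_axioms Q.

Lemma unitn_add m n : hcomp (unitn Q m) (unitn Q n) = unitn Q (m + n).
Proof.
elim: m => [|m IH]; first exact: (hcomp0p ax).
apply: etrans (esym (hcompA ax unit1 (unitn Q m) (unitn Q n))) _.
by rewrite IH; exact: cast2_id.
Qed.

Lemma unitn1 : unitn Q 1 = unit1.
Proof. by rewrite -[RHS](hcompp0 ax); exact: (esym (cast2_id _ _ _)). Qed.

Lemma ract_unitn n t : ract (unitn Q n) t = lact t (unitn Q n).
Proof.
by rewrite -[LHS](vcompp1 ax) (vcomp_act ax) (vcomp1p ax).
Qed.

Definition padded k l (c : Q k l) n (s : 'S_(l + n)) (t : 'S_(k + n)) :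
  Q (k + n) (l + n) := lact s (ract (hcomp c (unitn Q n)) t).

Lemma lact_padded k l (c : Q k l) n s t (s' : 'S_(l + n)) :
  lact s' (padded c s t) = padded c (s * s')%g t.
Proof. by rewrite /padded lactM. Qed.

Lemma ract_padded k l (c : Q k l) n s t (t' : 'S_(k + n)) :
  ract (padded c s t) t' = padded c s (t' * t)%g.
Proof. by rewrite /padded -lractC -ractM. Qed.

Lemma padded0 k l (c : Q k l) :
  cast2 (addn0 k) (addn0 l) (padded c (n := 0) 1%g 1%g) = c.
Proof. by rewrite /padded lact1 ract1 (hcompp0 ax). Qed.

Lemma hcomp_swap k l k' l' (p : Q k l) (q : Q k' l') :
  hcomp p q = lact (swap_perm l l')^-1%g
    (ract (cast2 (addnC k' k) (addnC l' l) (hcomp q p)) (swap_perm k k')).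
Proof. by rewrite -(hcompC ax) -lactM mulgV lact1. Qed.

Lemma hcomp_lact_unitn k l (p : Q k l) n (s : 'S_n) :
  hcomp p (lact s (unitn Q n)) = lact (tensor_perm 1 s) (hcomp p (unitn Q n)).
Proof. by rewrite -(lact_hcomp ax) lact1. Qed.

Lemma hcomp_vcomp_unitn k l m n (p : Q l m) (q : Q k l) :
  hcomp (vcomp p q) (unitn Q n) = vcomp (hcomp p (unitn Q n)) (hcomp q (unitn Q n)).
Proof. by rewrite (Defs.interchange ax) (vcompp1 ax). Qed.

Lemma hcomp_factor k l k' l' (p : Q k l) (q : Q k' l') :
  hcomp p q = vcomp (hcomp p (unitn Q l')) (hcomp (unitn Q k) q).
Proof. by rewrite (Defs.interchange ax) (vcompp1 ax) (vcomp1p ax). Qed.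

Lemma hcomp_factor' k l k' l' (p : Q k l) (q : Q k' l') :
  hcomp p q = vcomp (hcomp (unitn Q l) q) (hcomp p (unitn Q k')).
Proof. by rewrite (Defs.interchange ax) (vcompp1 ax) (vcomp1p ax). Qed.

Lemma vcomp_lact_unitn k l (p : Q k l) (s : 'S_k) :
  vcomp p (lact s (unitn Q k)) = ract p s.
Proof. by rewrite -(vcomp_act ax) (vcompp1 ax). Qed.

Lemma lact_unitn_vcomp k l (p : Q k l) (s : 'S_l) :
  vcomp (lact s (unitn Q l)) p = lact s p.
Proof. by rewrite -(lact_vcomp ax) (vcomp1p ax). Qed.

Lemma padded_unit0 n (s t : 'S_(0 + n)) :
  padded unit0 s t = lact ((t * s)%g : 'S_n) (unitn Q n).
Proof.
rewrite /padded (hcomp0p ax).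
by rewrite (lactM s t (unitn Q n)); congr lact; exact: ract_unitn.
Qed.

End ProPTheory.

Arguments padded {K} Q {k l} c {n} s t.

Section CastAct.
Variable K : fieldType.

(** The permutations are chosen before the ProP [Q], so that the same ones serve a graph in [Gr] and
    its value in [P]. The next lemma is uniform in [Q] for the same reason. *)
Lemma act_cast k l k' l' (ek : k = k') (el : l = l') (s : 'S_l') (t : 'S_k') :
  exists (s' : 'S_l) (t' : 'S_k), forall (Q : ProP K) (x : Q k l),
    lact s (ract (cast2 ek el x) t) = cast2 ek el (lact s' (ract x t')).
Proof. by move: s t; case: k' / ek; case: l' / el => s t; exists s, t. Qed.

Lemma hcomp_padded k l n (s : 'S_(l + n)) (t : 'S_(k + n)) m :
  exists (ek : (k + (n + m) = k + n + m)%N) (el : (l + (n + m) = l + n + m)%N)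
      (s' : 'S_(l + (n + m))) (t' : 'S_(k + (n + m))),
    forall (Q : ProP K) (c : Q k l),
      hcomp (padded Q c s t) (unitn Q m) = cast2 ek el (padded Q c s' t').
Proof.
have [s' [t' h]] := act_cast (addnA k n m) (addnA l n m)
  (tensor_perm s 1%g) (tensor_perm t 1%g).
exists (addnA k n m), (addnA l n m), s', t' => Q c; have ax := ProP_axioms Q.
rewrite /padded -h -unitn_add (hcompA ax).
by rewrite -(ract_hcomp ax) -(lact_hcomp ax) ract1 lact1.
Qed.

End CastAct.

(** * Atomic and composite evaluations *)

Section Forms.
Variables (K : fieldType) (P : ProP K).
Variable phi : forall k l, Gr_ind K k l -> P k l.

Definition nodal k l (x : Gr K k l) : Prop :=
  exists2 G, x = graph_vec K G & ~ nodeless G.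

Lemma nodal_vec k l (G : graph k l) : nodal (graph_vec K G) <-> ~ nodeless G.
Proof.
split=> [[G' /graph_vec_inj gg nG'] nG|nG]; last by exists G.
by apply: nG'; exact: nodeless_giso nG.
Qed.

Lemma eval_vec k l (x : Gr K k l) p : eval phi x p ->
  exists G, x = graph_vec K G.
Proof.
elim=> {k l x p}.
- by move=> k l C _; exists C.
- by exists empty_graph.
- by exists edge_graph.
- by move=> k l s _ p _ [G ->]; exists (lactg s G); exact: gr_lact_vec.
- by move=> k l t _ p _ [G ->]; exists (ractg G t); exact: gr_ract_vec.
- move=> k l k' l' _ _ p q _ [G ->] _ [G' ->]; exists (hcompg G G').
  exact: gr_hcomp_vec.
- move=> k l m _ _ p q _ [G ->] _ [G' ->]; exists (vcompg G G').
  exact: gr_vcomp_vec.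
Qed.

(* The empty graph is included so that permutations are atomic, too. *)
Definition gen k l (C : graph k l) (c : P k l) : Prop :=
  (exists hC : indecomposable C, c = phi (ind_vec K hC)) \/
  (exists (ek : 0 = k) (el : 0 = l),
     giso empty_graph C /\ c = cast2 ek el unit0).

Definition atomic k l (x : Gr K k l) (p : P k l) : Prop :=
  exists k' l' (C : graph k' l') c n (ek : (k' + n = k)%N) (el : (l' + n = l)%N) s t,
    [/\ gen C c, x = cast2 ek el (padded (Gr K) (graph_vec K C : Gr K k' l') s t)
      & p = cast2 ek el (padded P c s t)].

(** A node in each factor makes both factors strictly smaller than the composite, as the induction
    on the size requires. *)
Definition composite k l (x : Gr K k l) (p : P k l) : Prop :=
  exists m (x1 : Gr K m l) (x2 : Gr K k m) p1 p2,
    [/\ eval phi x1 p1, eval phi x2 p2, nodal x1, nodal x2 &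
        x = vcomp x1 x2 /\ p = vcomp p1 p2].

Definition form k l (x : Gr K k l) (p : P k l) : Prop :=
  atomic x p \/ composite x p.

Lemma form_cast k l k' l' (ek : k = k') (el : l = l') (x : Gr K k l) p :
  form x p -> form (cast2 ek el x) (cast2 ek el p).
Proof. by case: k' / ek; case: l' / el. Qed.

Lemma lact_nodal k l s (x : Gr K k l) : nodal x -> nodal (lact s x).
Proof. by move=> [G -> nG]; exists (lactg s G) => //; exact: gr_lact_vec. Qed.

Lemma ract_nodal k l t (x : Gr K k l) : nodal x -> nodal (ract x t).
Proof. by move=> [G -> nG]; exists (ractg G t) => //; exact: gr_ract_vec. Qed.

Lemma hcomp_nodal k l k' l' (x : Gr K k l) (G : graph k' l') :
  nodal x -> nodal (hcomp x (graph_vec K G : Gr K k' l')).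
Proof.
move=> [G' -> nG]; exists (hcompg G' G); first exact: gr_hcomp_vec.
by move=> [nV nL]; apply: nG; split=> v; [apply: (nV (inl v))|apply: (nL (inl v))].
Qed.

Lemma hcomp_nodal' k l k' l' (x : Gr K k l) (G : graph k' l') :
  nodal x -> nodal (hcomp (graph_vec K G : Gr K k' l') x).
Proof.
move=> [G' -> nG]; exists (hcompg G G'); first exact: gr_hcomp_vec.
by move=> [nV nL]; apply: nG; split=> v; [apply: (nV (inr v))|apply: (nL (inr v))].
Qed.

Lemma form_lact k l s (x : Gr K k l) p : form x p -> form (lact s x) (lact s p).
Proof.
case.
  move=> [k' [l' [C [c [n [ek [el [s' [t [gc -> ->]]]]]]]]]]; left.
  subst k l; exists k', l', C, c, n, erefl, erefl, (s' * s)%g, t.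
  by split; rewrite ?cast2_id ?lact_padded.
move=> [m [x1 [x2 [p1 [p2 [e1 e2 n1 n2 [-> ->]]]]]]]; right.
exists m, (lact s x1), x2, (lact s p1), p2; split=> //.
- exact: eval_lact.
- exact: lact_nodal.
- by rewrite !(lact_vcomp (ProP_axioms _)).
Qed.

Lemma form_ract k l t (x : Gr K k l) p : form x p -> form (ract x t) (ract p t).
Proof.
case.
  move=> [k' [l' [C [c [n [ek [el [s [t' [gc -> ->]]]]]]]]]]; left.
  subst k l; exists k', l', C, c, n, erefl, erefl, s, (t * t')%g.
  by split; rewrite ?cast2_id ?ract_padded.
move=> [m [x1 [x2 [p1 [p2 [e1 e2 n1 n2 [-> ->]]]]]]]; right.
exists m, x1, (ract x2 t), p1, (ract p2 t); split=> //.
- exact: eval_ract.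
- exact: ract_nodal.
- by rewrite !(ract_vcomp (ProP_axioms _)).
Qed.

Lemma eval_unitn n : eval phi (unitn (Gr K) n) (unitn P n).
Proof. by rewrite gr_unitn; exact: evalg_id. Qed.

Lemma form_hcomp_unitn k l (x : Gr K k l) p m :
  form x p -> form (hcomp x (unitn (Gr K) m)) (hcomp p (unitn P m)).
Proof.
case.
  move=> [k' [l' [C [c [n [ek [el [s [t [gc -> ->]]]]]]]]]]; left.
  subst k l; have [ek [el [s' [t' h]]]] := hcomp_padded K s t m.
  exists k', l', C, c, (n + m), ek, el, s', t'; split=> //; exact: h.
move=> [m' [x1 [x2 [p1 [p2 [e1 e2 n1 n2 [-> ->]]]]]]]; right.
exists (m' + m), (hcomp x1 (unitn (Gr K) m)), (hcomp x2 (unitn (Gr K) m)),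
  (hcomp p1 (unitn P m)), (hcomp p2 (unitn P m)); split.
- exact: eval_hcomp e1 (eval_unitn m).
- exact: eval_hcomp e2 (eval_unitn m).
- by rewrite gr_unitn; exact: hcomp_nodal.
- by rewrite gr_unitn; exact: hcomp_nodal.
- by rewrite !hcomp_vcomp_unitn.
Qed.

Lemma indecomposable_nodal k l (C : graph k l) : indecomposable C -> ~ nodeless C.
Proof. by move=> [[nV|[_ [x _]]] _ _ _ _] [hV hL]; [exact: nV|exact: hL x]. Qed.

Lemma padded_vec k l (C : graph k l) n s t :
  padded (Gr K) (graph_vec K C : Gr K k l) s t =
  graph_vec K (lactg s (ractg (hcompg C (id_graph n)) t)).
Proof.
rewrite /padded gr_unitn.
have -> : hcomp (graph_vec K C : Gr K k l) (graph_vec K (id_graph n) : Gr K n n) =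
  graph_vec K (hcompg C (id_graph n)) by exact: gr_hcomp_vec.
apply: etrans (gr_lact_vec K s _); congr gr_lact; exact: gr_ract_vec.
Qed.

(** A composite contains a node, and so does a padded indecomposable. What remains is the padded
    empty graph, for which one permutation [s] describes both the graph and its value. *)
Lemma form_nodeless k l (x : Gr K k l) p : form x p -> ~ nodal x ->
  exists n (ek : n = k) (el : n = l) s,
    x = cast2 ek el (lact s (unitn (Gr K) n)) /\
    p = cast2 ek el (lact s (unitn P n)).
Proof.
case; last first.
  move=> [m [x1 [x2 [p1 [p2 [e1 e2 [G1 -> n1] [G2 -> n2] [-> ->]]]]]]] [].
  exists (vcompg G1 G2); first exact: gr_vcomp_vec.
  by move=> [nV nL]; apply: n1; split=> v; [apply: (nV (inr v))|apply: (nL (inr v))].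
move=> [k' [l' [C [c [n [ek [el [s [t [gc -> ->]]]]]]]]]]; subst k l => /= nx.
case: gc => [[iC _]|[ek [el [gC ->]]]].
  exfalso; apply: nx; rewrite padded_vec nodal_vec => -[nV nL].
  by apply: (indecomposable_nodal iC); split=> v; [apply: (nV (inl v))|apply: (nL (inl v))].
subst k' l'; exists n, erefl, erefl, (t * s)%g.
rewrite -(graph_vec_eq K gC); split.
  exact: (padded_unit0 (Gr K)).
exact: padded_unit0.
Qed.

(** Induction on the evaluation. Factors without nodes act as permutations or extra strands; a
    horizontal product with nodes on both sides becomes composite by sliding one factor above the
    other. *)
Lemma eval_form k l (x : Gr K k l) p : eval phi x p -> form x p.
Proof.
elim=> {k l x p}.
- move=> k l C hC; left; exists k, l, C, (phi (ind_vec K hC)), 0.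
  exists (addn0 k), (addn0 l), 1%g, 1%g; rewrite !padded0; split=> //.
  by left; exists hC.
- left; exists 0, 0, empty_graph, unit0, 0, (addn0 0), (addn0 0), 1%g, 1%g.
  rewrite !padded0; split=> //; right; exists erefl, erefl; split=> //.
  exact: giso_refl.
(* The unit strand is the empty graph padded with one strand. *)
- left; exists 0, 0, empty_graph, unit0, 1, erefl, erefl, 1%g, 1%g; split.
  + by right; exists erefl, erefl; split=> //; exact: giso_refl.
  + rewrite cast2_id -[unit1](unitn1 (Gr K)).
    by apply: etrans (esym (padded_unit0 (Gr K) 1%g 1%g)); rewrite mulg1 lact1.
  + by rewrite cast2_id padded_unit0 mulg1 lact1 unitn1.
- by move=> k l s x p _; exact: form_lact.
- by move=> k l t x p _; exact: form_ract.
- move=> k l k' l' x y p q ex fx ey fy.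
  have [ny|ny] := pselect (nodal y); last first.
    have [n [ek [el [s [-> ->]]]]] := form_nodeless fy ny; subst k' l'.
    by rewrite !cast2_id !hcomp_lact_unitn; apply/form_lact/form_hcomp_unitn.
  have [nx|nx] := pselect (nodal x); last first.
    have [n [ek [el [s [-> ->]]]]] := form_nodeless fx nx; subst k l.
    (* Padding only allows strands on the right, so the factor without nodes is first swapped to
       that side. *)
    rewrite !cast2_id (hcomp_swap _ y) (hcomp_swap _ q) !hcomp_lact_unitn.
    by apply/form_lact/form_ract/form_cast/form_lact/form_hcomp_unitn.
  right; rewrite (hcomp_factor x) (hcomp_factor p).
  do 5!eexists; split; [| | | |by split].
  + exact: eval_hcomp ex (eval_unitn _).
  + exact: eval_hcomp (eval_unitn _) ey.
  + by rewrite gr_unitn; exact: hcomp_nodal.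
  + by rewrite gr_unitn; exact: hcomp_nodal'.
- move=> k l m x y p q ex fx ey fy.
  have [ny|ny] := pselect (nodal y); last first.
    have [n [ek [el [s [-> ->]]]]] := form_nodeless fy ny; subst k l.
    by rewrite !cast2_id !vcomp_lact_unitn; exact: form_ract.
  have [nx|nx] := pselect (nodal x); last first.
    have [n [ek [el [s [-> ->]]]]] := form_nodeless fx nx; subst l m.
    by rewrite !cast2_id !lact_unitn_vcomp; exact: form_lact.
  by right; exists l, x, y, p, q.
Qed.

End Forms.

(** * Uniqueness of the value *)

(** As [C] has no input-output edge, the through wires of [H] are exactly the strands of the
    padding. Thus [H] alone determines where [C] sits, and [s] and [t] can be read off the external
    numbers. *)
Lemma sub_padded k0 l0 (H : graph k0 l0) k l (C : graph k l) n
    (s : 'S_(l + n)) (t : 'S_(k + n)) :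
  empty_type (thru C) -> giso H (lactg s (ractg (hcompg C (id_graph n)) t)) ->
  exists la mu nu,
    [/\ sub (@Region _ _ H (fun=> True) (fun=> True) (fun h => ~ through h) la mu) C,
        labelling n (@through _ _ H) nu,
        forall h (i : 'I_k), ~ through h -> outer (wsrc H h) -> la h = i ->
          endlab (wsrc H h) = (t^-1)%g (lshift n i),
        forall h (i : 'I_l), ~ through h -> outer (wtgt H h) -> mu h = i ->
          endlab (wtgt H h) = s (lshift n i) &
        forall h (i : 'I_n), through h -> nu h = i ->
          endlab (wsrc H h) = (t^-1)%g (rshift k i) /\
          endlab (wtgt H h) = s (rshift l i)].
Proof.
move=> nT; set G := lactg _ _ => /giso_sym/giso_wiso [fV [fL [fW [bV bL bW Hs Ht]]]].
have [jV jE jI jO jL jT] := id_graphP n.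
have iV := bij_inj bV; have iL := bij_inj bL; have iW := bij_inj bW.
have [gV _ fVK] := bV; have [gL _ fLK] := bL; have [gW gWK fWK] := bW.
pose u (w : wire C) : wire G := match w with
  | inl (inl e) => inl (inl (inl e))
  | inl (inr e) => inl (inr (inl e))
  | inr (inl e) => inr (inl (inl e))
  | inr (inr e) => inr (inr (inl e))
  end.
pose v (x : thru (id_graph n)) : wire G := inr (inr (inr x)).
have uv w : (exists w', w = u w') \/ (exists x, w = v x).
  move: w => [[[x|x]|[x|x]]|[[x|x]|[x|x]]].
  - by left; exists (inl (inl x)).
  - by case: (jE x).
  - by left; exists (inl (inr x)).
  - by case: (jO x).
  - by left; exists (inr (inl x)).
  - by case: (jI x).
  - by case: (nT x).
  - by right; exists x.
have thu w : ~ through (fW (u w)).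
  by rewrite /through Hs Ht; case: w => [[x|x]|[x|x]] //= [].
have thv x : through (fW (v x)) by rewrite /through Hs Ht.
pose la h := if hcompg_wire (gW h : wire (hcompg C (id_graph n))) is inl w
  then endlab (wsrc C w) else 0.
pose mu h := if hcompg_wire (gW h : wire (hcompg C (id_graph n))) is inl w
  then endlab (wtgt C w) else 0.
pose nu h := if hcompg_wire (gW h : wire (hcompg C (id_graph n))) is inr w
  then endlab (wsrc (id_graph n) w) else 0.
have lau w : la (fW (u w)) = endlab (wsrc C w).
  by rewrite /la gWK; case: w => [[x|x]|[x|x]].
have muu w : mu (fW (u w)) = endlab (wtgt C w).
  by rewrite /mu gWK; case: w => [[x|x]|[x|x]].
have nuv x : nu (fW (v x)) = inidx (id_graph n) (inr x) by rewrite /nu gWK.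
exists la, mu, nu; split.
- exists (fun x => fV (inl x)), (fun x => fL (inl x)), (fun w => fW (u w)); split=> //.
  + by move=> x y /iV [].
  + by move=> x y /iL [].
  + by move=> [[x|x]|[x|x]] [[y|y]|[y|y]] /iW // [->].
  + move=> x /=; split=> // _; case e: (gV x) => [y|y]; last by case: (jV y).
    by exists y; rewrite -e.
  + move=> x /=; split=> // _; case e: (gL x) => [y|y]; last by case: (jL y).
    by exists y; rewrite -e.
  + move=> h /=; split; last by move=> [w <-]; exact: thu.
    rewrite -{1}(fWK h); have [[w e] _|[x ->]] := uv (gW h); last by case.
    by exists w; rewrite -e.
  + move=> w; rewrite /= lau Hs; by case: w => [[x|x]|[x|x]].
  + move=> w; rewrite /= muu Ht; by case: w => [[x|x]|[x|x]].
  + move=> h x ex _ [] /=; by rewrite ex.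
  + move=> h x ex _ [] /=; by rewrite ex.
- have vP h : through h <-> exists x, fW (v x) = h.
    split; last by move=> [x <-].
    rewrite -{1}(fWK h); have [[w ->]|[x e] _] := uv (gW h); first by move/thu.
    by exists x; rewrite -e.
  have [g _ gK] := inidx_bij (id_graph n).
  split.
  + by move=> h /vP [x <-]; rewrite nuv.
  + move=> i lt; have := gK (Ordinal lt); case: (g _) => x ex; first by case: (jI x).
    by exists (fW (v x)) => //; rewrite nuv ex.
  + move=> h h' /vP [x <-] /vP [y <-]; rewrite !nuv => /val_inj e.
    by have [->] := bij_inj (inidx_bij (id_graph n)) e.
- move=> h i; rewrite -{1 2 3 4}(fWK h).
  have [[w ->]|[x ->]] := uv (gW h); last by move=> /(_ (thv x)).
  rewrite lau Hs => _; case: w => [[x|x]|[x|x]] //= _ e.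
  by congr (nat_of_ord ((t^-1)%g _)); apply: val_inj.
- move=> h i; rewrite -{1 2 3 4}(fWK h).
  have [[w ->]|[x ->]] := uv (gW h); last by move=> /(_ (thv x)).
  rewrite muu Ht => _; case: w => [[x|x]|[x|x]] //= _ e.
  by congr (nat_of_ord (s _)); apply: val_inj.
- move=> h i; rewrite -{1 2 3 4}(fWK h).
  have [[w ->] /thu//|[x ->] _] := uv (gW h).
  rewrite nuv Hs Ht /= => e; split; congr (nat_of_ord _); congr (_ _).
    by congr (rshift _ _); apply: val_inj.
  by congr (rshift _ _); apply: val_inj; rewrite /= -e jT.
Qed.

Section Atomic.
Variables (K : fieldType) (P : ProP K).
Variable phi : forall k l, Gr_ind K k l -> P k l.
Hypothesis phiP : SS_morphism phi.

Lemma gen_thru k l (C : graph k l) c : gen phi C c -> empty_type (thru C).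
Proof.
move=> [[[]] //|[ek [el [/giso_sym]]]]; case: k / ek C c; case: l / el => C c.
by move=> [_ [_ [_ [_ [fT _]]]]] _ /fT.
Qed.

(** The equivariance of [phi] settles the case of two indecomposables. The mixed cases are excluded
    because an indecomposable has a node and the empty graph has none. *)
Lemma gen_uniq k l (C C' : graph k l) c c' s t :
  gen phi C c -> gen phi C' c' -> giso C' (lactg s (ractg C t)) ->
  c' = lact s (ract c t).
Proof.
move=> gC gC' CC'.
have nl (D : graph k l) : (exists (ek : 0 = k) (el : 0 = l),
    giso empty_graph D) -> nodeless D.
  by move=> [_ [_ gD]]; apply: nodeless_giso gD _; split=> -[].
case: gC gC' => [[iC ->]|[ek [el [eC ->]]]] [[iC' ->]|[ek' [el' [eC' ->]]]].
- rewrite -(ss_mor_ract phiP) -(ss_mor_lact phiP); congr phi; apply: val_inj => /=.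
  by rewrite gr_ract_vec gr_lact_vec; exact: graph_vec_eq.
- exfalso; apply: (indecomposable_nodal iC).
  have nC : nodeless (lactg s (ractg C t)).
    by apply: nodeless_giso CC' _; apply: nl; exists ek', el'.
  exact: nC.
- exfalso; apply: (indecomposable_nodal iC').
  apply: nodeless_giso (giso_sym CC') _.
  have nC : nodeless C by apply: nl; exists ek, el.
  exact: nC.
- subst k l; rewrite !cast2_id.
  have -> : s = 1%g by apply/permP => -[].
  have -> : t = 1%g by apply/permP => -[].
  by rewrite ract1 lact1.
Qed.

(** Both generators occupy the complement of the through wires of [H], so they differ by
    renumberings [sg] and [tu], and the strands by [rh]. In the value, [rh] and its inverse cancel
    across the identity strands. *)
Lemma atomic_uniq k l (x : Gr K k l) p p' :
  atomic phi x p -> atomic phi x p' -> p = p'.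
Proof.
move=> [k1 [l1 [C [c [n [ek [el [s [t [gC xE ->]]]]]]]]]].
move=> [k2 [l2 [C' [c' [n' [ek' [el' [s' [t' [gC' xE' ->]]]]]]]]]].
subst k l; rewrite cast2_id; move: xE xE'; rewrite cast2_id => -> /esym.
rewrite !padded_vec => /esym /cast2_vec_giso HH'.
set H := lactg s _ in HH'.
have [la [mu [nu [sC hnu inC outC thC]]]] := sub_padded (gen_thru gC) (giso_refl H).
have [la' [mu' [nu' [sC' hnu' inC' outC' thC']]]] := sub_padded (gen_thru gC') HH'.
have [? ?] : k1 = k2 /\ l1 = l2 by apply: sub_dims sC sC'.
subst k2 l2.
have ? := labelling_card hnu hnu'; subst n'.
rewrite cast2_id.
have [_ _ i1 o1] := sub_ok sC; have [_ _ i2 o2] := sub_ok sC'.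
have [sg sgE] := labelling_perm o1 o2.
have [tu tuE] := labelling_perm i1 i2.
have [rh rhE] := labelling_perm hnu hnu'.
have CC' : giso C' (lactg sg (ractg C (tu^-1)%g)).
  apply: sub_uniq sC' _.
  apply: (@sub_lactg _ _ H (Region (fun=> True) (fun=> True) (fun h => ~ through h) la' mu)) => //.
  by apply: sub_ractg sC => //= h i; rewrite invgK; exact: tuE.
have c'E := gen_uniq gC gC' CC'.
(* Every output ends a wire of [C] or a strand; comparing its external number in the two
   descriptions determines [s]. The same argument on inputs gives [tE]. *)
have sE : s = (tensor_perm sg rh * s')%g.
  apply/permP => j; rewrite permM; case: (split_ordP j) => i ->.
    rewrite tensor_perm_lshift.
    have [h [nh fh] hi] := lab_surj o1 (ltn_ord i).
    have oh : outer (wtgt H h) by move: fh; rewrite /= outer_free_end.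
    apply: val_inj => /=; rewrite -(outC h i nh oh hi).
    by apply: (outC' h _ nh oh); apply: sgE.
  rewrite tensor_perm_rshift; have [h th hi] := lab_surj hnu (ltn_ord i).
  apply: val_inj => /=; rewrite -(thC h i th hi).2.
  by apply: (thC' h _ th _).2; apply: rhE.
have tE : (t^-1 = tensor_perm tu rh * t'^-1)%g.
  apply/permP => j; rewrite permM; case: (split_ordP j) => i ->.
    rewrite tensor_perm_lshift.
    have [h [nh fh] hi] := lab_surj i1 (ltn_ord i).
    have oh : outer (wsrc H h) by move: fh; rewrite /= outer_free_end.
    apply: val_inj => /=; rewrite -(inC h i nh oh hi).
    by apply: (inC' h _ nh oh); apply: tuE.
  rewrite tensor_perm_rshift; have [h th hi] := lab_surj hnu (ltn_ord i).
  apply: val_inj => /=; rewrite -(thC h i th hi).1.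
  by apply: (thC' h _ th _).1; apply: rhE.
have {tE} tE : (t = t' * tensor_perm tu^-1 rh^-1)%g.
  by rewrite -[t]invgK tE invgM invgK tensor_permV.
have ax := ProP_axioms P.
rewrite sE tE -ract_padded -lact_padded c'E.
have -> : padded P c (tensor_perm sg rh) (tensor_perm tu^-1 rh^-1) =
    hcomp (lact sg (ract c (tu^-1)%g)) (unitn P n).
  rewrite /padded -(ract_hcomp ax) -(lact_hcomp ax) ract_unitn -lactM.
  by rewrite mulVg lact1.
by rewrite /padded [RHS]lractC.
Qed.

(** All nodes of [H] belong to [C], so a cut of [H] with nodes on both sides restricts to such a cut
    of [C]. The empty graph has no node and a single loop cannot lie on both sides; otherwise all
    nodes are vertices, and the restricted cut contradicts the vertical clause of
    indecomposability. *)
Lemma atomic_composite k l (x : Gr K k l) p q :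
  atomic phi x p -> composite phi x q -> False.
Proof.
move=> [k1 [l1 [C [c [n [ek [el [s [t [gC xE _]]]]]]]]]].
move=> [m [x1 [x2 [p1 [p2 [_ _ [G1 e1 n1] [G2 e2 n2] [xE' _]]]]]]].
subst k l; move: xE xE'; rewrite cast2_id padded_vec e1 e2 => -> /esym.
set H := lactg s _ => HH.
have gH : giso H (vcompg G1 G2).
  by apply: (@graph_vec_inj K); rewrite -HH; exact: gr_vcomp_vec.
have [la [mu [nu [sC _ _ _ _]]]] := sub_padded (gen_thru gC) (giso_refl H).
have [a [b [u [_ ib _ hV hL _ us ut _ _]]]] := sC.
have {}hV v : exists x, a x = v by apply/hV.
have {}hL v : exists x, b x = v by apply/hL.
have [d [[dd _] s2 s1]] := vcompg_cut gH.
have node A : ~ nodeless A -> (exists v : vert A, True) \/ (exists v : loop A, True).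
  move=> nA; apply: contrapT => h; apply: nA; split=> v; apply: h;
    by [left; exists v|right; exists v].
have nG2 : (exists v, cV d (a v)) \/ (exists v, cL d (b v)).
  have [a' [b' [_ [_ _ _ hV' hL' _ _ _ _ _]]]] := s2.
  case: (node _ _ _ n2) => -[v _].
    left; have [w ew] := hV (a' v); exists w; rewrite ew.
    by have [] := (hV' (a' v)).2 (ex_intro _ v erefl).
  right; have [w ew] := hL (b' v); exists w; rewrite ew.
  by have [] := (hL' (b' v)).2 (ex_intro _ v erefl).
have nG1 : (exists v, ~ cV d (a v)) \/ (exists v, ~ cL d (b v)).
  have [a' [b' [_ [_ _ _ hV' hL' _ _ _ _ _]]]] := s1.
  case: (node _ _ _ n1) => -[v _].
    left; have [w ew] := hV (a' v); exists w; rewrite ew.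
    by have [] := (hV' (a' v)).2 (ex_intro _ v erefl).
  right; have [w ew] := hL (b' v); exists w; rewrite ew.
  by have [] := (hL' (b' v)).2 (ex_intro _ v erefl).
case: gC => [[iC _]|[ek' [el' [eC _]]]]; last first.
  have [] : nodeless C by apply: nodeless_giso eC _; split=> -[].
  move=> hVC hLC.
  by case: nG1 => -[v _]; [exact: hVC v|exact: hLC v].
case: (ind_loop iC) => [nLC|[[nVC _ _ _ _] [x0 hx0]]]; last first.
  case: nG1 => -[v dv]; first exact: nVC v.
  case: nG2 => -[w dw]; first exact: nVC w.
  by move: dv dw; rewrite (hx0 v) (hx0 w).
case: nG1 => -[v dv]; last exact: nLC v.
case: nG2 => -[w dw]; last exact: nLC w.
have dC : down_closed (fun x => cV d (a x)).
  move=> h v1 ev1 dv1 v2 ev2; apply: (dd (u h) (a v1)) => //.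
    exact: (embeds_end_inl ut ev1).
  exact: (embeds_end_inl us ev2).
have [r [lab okd]] := cut_exists (fun x => cL d (b x)) dC.
have [D2 sD2] := slice_exists (cut0_ok C) okd (cut0_le _).
have [D1 sD1] := slice_exists okd (cut1_ok C) (cut1_ge _).
have CD : giso C (vcompg D1 D2).
  apply: sub_uniq (sub_whole C) _.
  exact: slice_vcompg okd.1 (cut0_le _) (cut1_ge _) sD1 sD2.
case: (ind_vcomp iC CD) => nD.
  have [a' [_ [_ [_ _ _ hV' _ _ _ _ _ _]]]] := sD1.
  by have /hV' [y _] : rV (slice (Cut (fun x => cV d (a x)) (fun x => cL d (b x)) lab)
    (@cut1 _ _ C)) v by []; exact: nD y.
have [a' [_ [_ [_ _ _ hV' _ _ _ _ _ _]]]] := sD2.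
by have /hV' [y _] : rV (slice (@cut0 _ _ C)
  (Cut (fun x => cV d (a x)) (fun x => cL d (b x)) lab)) w by split=> // -[]; exact: nD y.
Qed.

End Atomic.

Lemma belowE k l (H : graph k l) (A : vert H -> Prop) x :
  below A x = (if x is inl v then A v else True).
Proof. by apply: propext; case: x => [v|i]; split=> // [/(_ v erefl)|Av _ [<-]]. Qed.

Lemma free_endE (V : Type) (A : V -> Prop) x :
  free_end A x = (if x is inl v then ~ A v else True).
Proof. by apply: propext; case: x => [v|i]; split=> // [/(_ v erefl)|Av _ [<-]]. Qed.

Definition touches (V : Type) (A : V -> Prop) (x : V + nat) : Prop :=
  if x is inl v then A v else False.

(** * Two cuts, their meet and their join *)

Section Square.
Variables (K : fieldType) (P : ProP K).
Variable phi : forall k l, Gr_ind K k l -> P k l.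
Variables (k0 l0 N : nat) (H : graph k0 l0).
Hypothesis small : at_most (vert H + loop H) N.+1.
Hypothesis uniq : forall k l (G : graph k l), at_most (vert G + loop G) N ->
  forall p q, evalg phi G p -> evalg phi G q -> p = q.
Implicit Types c d e : cut H.

Definition slice_value c d m n (p : P m n) : Prop :=
  exists2 G : graph m n, sub (slice c d) G & evalg phi G p.

(** Missing a node of [H] brings a slice under the induction hypothesis [uniq]. *)
Definition proper c d : Prop :=
  (exists v, ~ rV (slice c d) v) \/ (exists x, ~ rL (slice c d) x).

Lemma slice_value_uniq c d m n (p q : P m n) :
  proper c d -> slice_value c d p -> slice_value c d q -> p = q.
Proof.
move=> pr [G sG ep] [G' sG' eq']; apply: uniq ep _; last first.
  exact: evalg_giso (sub_uniq sG' sG) eq'.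
have [a [b [_ [ia ib _ hV hL _ _ _ _ _]]]] := sG.
have i : injective (sum_map a b) by move=> [x|x] [y|y] //= [] => [/ia|/ib] ->.
case: pr => -[v nv].
  apply: (at_most_strict (u := inl v)) i _ small => -[x|x] //= [ex].
  by apply/nv/hV; exists x.
apply: (at_most_strict (u := inr v)) i _ small => -[x|x] //= [ex].
by apply/nv/hL; exists x.
Qed.

Lemma slice_value_vcomp c d e k l m (p : P l m) (q : P k l) :
  down_closed (cV d) -> cut_le c d -> cut_le d e ->
  slice_value d e p -> slice_value c d q -> slice_value c e (vcomp p q).
Proof.
move=> dd cd de [G sG ep] [G' sG' eq']; exists (vcompg G G').
  exact: slice_vcompg sG sG'.
exact: evalg_vcomp.
Qed.

Lemma slice_value_exists c d m n : cut_ok m c -> cut_ok n d -> cut_le c d ->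
  exists p : P m n, slice_value c d p.
Proof.
move=> oc od cd; have [G sG] := slice_exists oc od cd.
by have [p ep] := all_evaluable phi G; exists p, G.
Qed.

Lemma slice_value_id c n : cut_ok n c -> slice_value c c (unitn P n).
Proof.
move=> [_ lc]; exists (id_graph n); last exact: evalg_id.
by apply: sub_id => //= v [].
Qed.

Section Cuts.
Variables c c' : cut H.
Hypotheses (dc : down_closed (cV c)) (dc' : down_closed (cV c')).
Variables dlab elab : wire H -> nat.

Let d := @Cut _ _ H (fun v => cV c v /\ cV c' v) (fun x => cL c x /\ cL c' x) dlab.
Let e := @Cut _ _ H (fun v => cV c v \/ cV c' v) (fun x => cL c x \/ cL c' x) elab.

(* X lies above the meet d and below c only, Y above d and below c' only; a wire
   between d and the join e that does not touch X is counted with Y. *)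
Let X v := cV c v /\ ~ cV c' v.
Let Y v := cV c' v /\ ~ cV c v.
Let XW h := touches X (wsrc H h) \/ touches X (wtgt H h).
Let YW h :=
  (below (cV e) (wsrc H h) /\ free_end (cV d) (wtgt H h)) /\ ~ XW h.

(** Once each end of [h] is known to be a vertex or external, the claims are propositional in the
    memberships of these vertices in [c] and [c']; down-closedness supplies the implications from
    target to source. *)
Ltac wires h :=
  let v := fresh in let w := fresh in let i := fresh in let j := fresh in
  rewrite /XW /YW /XW ?belowE ?free_endE /touches /X /Y /d /e /=;
  move: (dc (h := h)) (dc' (h := h));
  case: (wsrc H h) => [v|i]; case: (wtgt H h) => [w|j] /=;
  [move=> /(_ w erefl) + /(_ w erefl); rewrite !belowE|move=> _ _
  |move=> _ _|move=> _ _];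
  try (case: (pselect (cV c v)); case: (pselect (cV c' v)));
  try (case: (pselect (cV c w)); case: (pselect (cV c' w)));
  tauto.


Let XL x := cL c x /\ ~ cL c' x.
Let YL x := cL c' x /\ ~ cL c x.

Lemma XW_src h v : wsrc H h = inl v -> X v -> XW h.
Proof. by move=> ev Xv; left; rewrite ev. Qed.

Lemma XW_tgt h v : wtgt H h = inl v -> X v -> XW h.
Proof. by move=> ev Xv; right; rewrite ev. Qed.

(** No wire joins [X] and [Y]: its target would lie in one of the two cuts and its source outside of
    that cut, against down-closedness. *)
Lemma YW_src h : touches Y (wsrc H h) -> YW h.
Proof. wires h. Qed.

Lemma YW_tgt h : touches Y (wtgt H h) -> YW h.
Proof. wires h. Qed.

(** Between [d] and [c] only [X] is traversed, and the wires entering [Y] pass by as strands. The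
    next three lemmas treat the other sides of the square. *)
Lemma wires_dc h : below (cV c) (wsrc H h) /\ free_end (cV d) (wtgt H h) <->
  XW h \/ (YW h /\ free_end Y (wsrc H h)).
Proof. wires h. Qed.

Lemma wires_ce h : below (cV e) (wsrc H h) /\ free_end (cV c) (wtgt H h) <->
  (XW h /\ free_end X (wtgt H h)) \/ YW h.
Proof. wires h. Qed.

Lemma wires_dc' h : below (cV c') (wsrc H h) /\ free_end (cV d) (wtgt H h) <->
  (XW h /\ free_end X (wsrc H h)) \/ YW h.
Proof. wires h. Qed.

Lemma wires_c'e h : below (cV e) (wsrc H h) /\ free_end (cV c') (wtgt H h) <->
  XW h \/ (YW h /\ free_end Y (wtgt H h)).
Proof. wires h. Qed.

Lemma YW_XW h : YW h -> XW h -> False.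
Proof. by case. Qed.

Lemma square m n k l (p1 : P n l) (p2 : P k n) (q1 : P m l) (q2 : P k m) :
  cut_ok k d -> cut_ok n c -> cut_ok m c' -> cut_ok l e ->
  proper c e -> proper d c -> proper c' e -> proper d c' ->
  slice_value c e p1 -> slice_value d c p2 ->
  slice_value c' e q1 -> slice_value d c' q2 ->
  vcomp p1 p2 = vcomp q1 q2.
Proof.
move=> okd okc okc' oke pce pdc pc'e pdc' v1 v2 w1 w2.
have [ka [la hla]] := labelling_exists (fun h => XW h /\ free_end X (wsrc H h)) (wire_fin H).
have [oa [ma hma]] := labelling_exists (fun h => XW h /\ free_end X (wtgt H h)) (wire_fin H).
have [kb [lb hlb]] := labelling_exists (fun h => YW h /\ free_end Y (wsrc H h)) (wire_fin H).
have [ob [mb hmb]] := labelling_exists (fun h => YW h /\ free_end Y (wtgt H h)) (wire_fin H).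
have okA : region_ok ka oa (Region X XL XW la ma).
  by split=> //; [exact: XW_src|exact: XW_tgt].
have okB : region_ok kb ob (Region Y YL YW lb mb).
  split=> //= h v ev Yv; first by apply: YW_src; rewrite ev.
  by apply: YW_tgt; rewrite ev.
have [A sA] := sub_exists okA; have [a ea] := all_evaluable phi A.
have [B sB] := sub_exists okB; have [b eb] := all_evaluable phi B.
have wire_id n' W lab : labelling n' W lab ->
    sub (@Region _ _ H (fun=> False) (fun=> False) W lab lab) (id_graph n').
  by move=> hl; apply: sub_id => // v [].
have iA := wire_id _ _ _ hla; have oA := wire_id _ _ _ hma.
have iB := wire_id _ _ _ hlb; have oB := wire_id _ _ _ hmb.
(* With these numberings the four slices become A * I or I * B. *)
pose relab (f : cut H) s (f1 f2 : wire H -> nat) := Cut (cV f) (cL f)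
  (fun h => if `[< XW h >] then f1 h else (s + f2 h)%N).
pose d1 := relab d ka la lb; pose c1 := relab c oa ma lb.
pose c1' := relab c' ka la mb; pose e1 := relab e oa ma mb.
have s_dc : sub (slice d1 c1) (hcompg A (id_graph kb)).
  apply: sub_hcompg sA iB _ _ _ _ _ _ _ _ _ _ => //=.
  - by move=> h Xh [/YW_XW].
  - by move=> v; rewrite /X; case: (pselect (cV c' v)); tauto.
  - by move=> v; rewrite /XL; case: (pselect (cL c' v)); tauto.
  - exact: wires_dc.
  - by move=> h [/= Xh _]; case: asboolP.
  - by move=> h [/= [[_ nX] _] _]; case: asboolP.
  - by move=> h [/= Xh _]; case: asboolP.
  - by move=> h [/= [[_ nX] _] _]; case: asboolP.
have s_ce : sub (slice c1 e1) (hcompg (id_graph oa) B).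
  apply: sub_hcompg oA sB _ _ _ _ _ _ _ _ _ _ => //=.
  - by move=> h [Xh _] /YW_XW.
  - by move=> v; rewrite /Y; tauto.
  - by move=> v; rewrite /YL; tauto.
  - exact: wires_ce.
  - by move=> h [/= [Xh _] _]; case: asboolP.
  - by move=> h [/= [_ nX] _]; case: asboolP.
  - by move=> h [/= [Xh _] _]; case: asboolP.
  - by move=> h [/= [_ nX] _]; case: asboolP.
have s_dc' : sub (slice d1 c1') (hcompg (id_graph ka) B).
  apply: sub_hcompg iA sB _ _ _ _ _ _ _ _ _ _ => //=.
  - by move=> h [Xh _] /YW_XW.
  - by move=> v; rewrite /Y; case: (pselect (cV c v)); tauto.
  - by move=> v; rewrite /YL; case: (pselect (cL c v)); tauto.
  - exact: wires_dc'.
  - by move=> h [/= [Xh _] _]; case: asboolP.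
  - by move=> h [/= [_ nX] _]; case: asboolP.
  - by move=> h [/= [Xh _] _]; case: asboolP.
  - by move=> h [/= [_ nX] _]; case: asboolP.
have s_c'e : sub (slice c1' e1) (hcompg A (id_graph ob)).
  apply: sub_hcompg sA oB _ _ _ _ _ _ _ _ _ _ => //=.
  - by move=> h Xh [/YW_XW].
  - by move=> v; rewrite /X; tauto.
  - by move=> v; rewrite /XL; tauto.
  - exact: wires_c'e.
  - by move=> h [/= Xh _]; case: asboolP.
  - by move=> h [/= [[_ nX] _] _]; case: asboolP.
  - by move=> h [/= Xh _]; case: asboolP.
  - by move=> h [/= [[_ nX] _] _]; case: asboolP.
have led : cut_le d c by split=> v [].
have led' : cut_le d c' by split=> v [].
have lee : cut_le c e by split=> v; left.
have lee' : cut_le c' e by split=> v; right.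
have relab_le f s f1 f2 : cut_le f (relab f s f1 f2) /\ cut_le (relab f s f1 f2) f.
  by split; split=> v.
have okd1 : cut_ok (ka + kb) d1 by split; [exact: okd.1|exact: slice_in_ok s_dc].
have okc1 : cut_ok (oa + kb) c1 by split; [exact: okc.1|exact: slice_out_ok s_dc].
have okc1' : cut_ok (ka + ob) c1' by split; [exact: okc'.1|exact: slice_out_ok s_dc'].
have oke1 : cut_ok (oa + ob) e1 by split; [exact: oke.1|exact: slice_out_ok s_c'e].
(* These slices contain no node; their values translate between the given numberings of the cuts and
   the adapted ones. *)
have [ud hud] := slice_value_exists okd okd1 (relab_le _ _ _ _).1.
have [ue hue] := slice_value_exists oke1 oke (relab_le _ _ _ _).2.
have [uc huc] := slice_value_exists okc okc1 (relab_le _ _ _ _).1.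
have [vc hvc] := slice_value_exists okc1 okc (relab_le _ _ _ _).2.
have [uc' huc'] := slice_value_exists okc' okc1' (relab_le _ _ _ _).1.
have [vc' hvc'] := slice_value_exists okc1' okc' (relab_le _ _ _ _).2.
have p1E : p1 = vcomp ue (vcomp (hcomp (unitn P oa) b) uc).
  apply: (slice_value_uniq pce v1); apply: (slice_value_vcomp (d := e1)) hue _ => //.
  - exact: oke.1.
  - apply: (slice_value_vcomp (d := c1)) huc => //.
    by exists (hcompg (id_graph oa) B) => //; apply: evalg_hcomp eb; exact: evalg_id.
have p2E : p2 = vcomp vc (vcomp (hcomp a (unitn P kb)) ud).
  apply: (slice_value_uniq pdc v2); apply: (slice_value_vcomp (d := c1)) hvc _ => //.
  apply: (slice_value_vcomp (d := d1)) hud => //; first exact: okd.1.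
    by exists (hcompg A (id_graph kb)) => //; apply: evalg_hcomp ea _; exact: evalg_id.
have q1E : q1 = vcomp ue (vcomp (hcomp a (unitn P ob)) uc').
  apply: (slice_value_uniq pc'e w1); apply: (slice_value_vcomp (d := e1)) hue _ => //.
  - exact: oke.1.
  - apply: (slice_value_vcomp (d := c1')) huc' => //.
    by exists (hcompg A (id_graph ob)) => //; apply: evalg_hcomp ea _; exact: evalg_id.
have q2E : q2 = vcomp vc' (vcomp (hcomp (unitn P ka) b) ud).
  apply: (slice_value_uniq pdc' w2); apply: (slice_value_vcomp (d := c1')) hvc' _ => //.
  apply: (slice_value_vcomp (d := d1)) hud => //; first exact: okd.1.
    by exists (hcompg (id_graph ka) B) => //; apply: evalg_hcomp eb; exact: evalg_id.
(* Going from [c1] to [c] and back is a slice without nodes, which is also realised by an identity.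
   Any node of [H] makes it proper, and [pce] supplies one. *)
have cancel_c : vcomp uc vc = unitn P _.
  apply: (@slice_value_uniq c1 c1); last exact: slice_value_id.
    by case: pce => -[v _]; [left|right]; exists v => -[].
  exact: slice_value_vcomp okc.1 (relab_le _ _ _ _).2 (relab_le _ _ _ _).1 huc hvc.
have cancel_c' : vcomp uc' vc' = unitn P _.
  apply: (@slice_value_uniq c1' c1'); last exact: slice_value_id.
    by case: pce => -[v _]; [left|right]; exists v => -[].
  exact: slice_value_vcomp okc'.1 (relab_le _ _ _ _).2 (relab_le _ _ _ _).1 huc' hvc'.
have ax := ProP_axioms P.
(* Both sides become [hcomp a b] between [ue] and [ud]. *)
rewrite p1E p2E q1E q2E -!(vcompA ax); congr vcomp; rewrite !(vcompA ax).
rewrite -(vcompA ax _ uc vc) cancel_c (vcompp1 ax) -hcomp_factor'.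
by rewrite -(vcompA ax _ uc' vc') cancel_c' (vcompp1 ax) -hcomp_factor.
Qed.

End Cuts.
End Square.

(** * The free ProP *)

Section Extension.
Variables (K : fieldType) (P : ProP K).
Variable phi : forall k l, Gr_ind K k l -> P k l.
Hypothesis phiP : SS_morphism phi.

Lemma not_nodeless k l (G : graph k l) : ~ nodeless G ->
  (exists v : vert G, True) \/ (exists x : loop G, True).
Proof.
move=> nG; apply: contrapT => h; apply: nG; split=> v; apply: h;
  by [left; exists v|right; exists v].
Qed.

Lemma evalg_uniq N k l (G : graph k l) p q : at_most (vert G + loop G) N ->
  evalg phi G p -> evalg phi G q -> p = q.
Proof.
elim: N k l G p q => [|N IH] k l G p q aG /eval_form fp /eval_form fq.
all: case: fp fq => [ap|cp] [aq|cq]; [exact: atomic_uniq ap aq|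
  by case: (atomic_composite ap cq)|by case: (atomic_composite aq cp)|].
  (* A composite has a node in each factor, which is impossible for a graph of size 0. *)
  case: cp aG => m [_ [_ [_ [_ [_ _ [G1 -> n1] [G2 -> _] [GE _]]]]]] [f _].
  have gG : giso G (vcompg G1 G2).
    by apply: (@graph_vec_inj K); rewrite GE; exact: gr_vcomp_vec.
  exfalso; apply: n1.
  have [nV nL] : nodeless (vcompg G1 G2).
    by apply: nodeless_giso gG _; split=> v; [case: (f (inl v))|case: (f (inr v))].
  by split=> v; [exact: nV (inr v)|exact: nL (inr v)].
have cutE m (x1 : Gr K m l) (x2 : Gr K k m) p1 p2 : eval phi x1 p1 ->
    eval phi x2 p2 -> nodal x1 -> nodal x2 -> (graph_vec K G : Gr K k l) = vcomp x1 x2 ->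
    exists c : cut G, [/\ cut_ok m c, slice_value phi (cut0 G) c p2,
      slice_value phi c (cut1 G) p1,
      (exists v, cV c v) \/ (exists x, cL c x) &
      (exists v, ~ cV c v) \/ (exists x, ~ cL c x)].
  move=> e1 e2 [G1 x1E n1] [G2 x2E n2] GE; subst x1 x2.
  have gG : giso G (vcompg G1 G2).
    by apply: (@graph_vec_inj K); rewrite GE; exact: gr_vcomp_vec.
  have [c [okc s2 s1]] := vcompg_cut gG; exists c; split=> //.
  - by exists G2.
  - by exists G1.
  - have [a [b [_ [_ _ _ hV hL _ _ _ _ _]]]] := s2.
    case: (not_nodeless n2) => -[v _].
      by left; exists (a v); have [] := (hV (a v)).2 (ex_intro _ v erefl).
    by right; exists (b v); have [] := (hL (b v)).2 (ex_intro _ v erefl).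
  - have [a [b [_ [_ _ _ hV hL _ _ _ _ _]]]] := s1.
    case: (not_nodeless n1) => -[v _].
      by left; exists (a v); have [] := (hV (a v)).2 (ex_intro _ v erefl).
    by right; exists (b v); have [] := (hL (b v)).2 (ex_intro _ v erefl).
move: cp => [m [x1 [x2 [p1 [p2 [ex1 ex2 nx1 nx2 [xE ->]]]]]]].
move: cq => [n [y1 [y2 [q1 [q2 [ey1 ey2 ny1 ny2 [yE ->]]]]]]].
have [c [okc v0c vc1 inc outc]] := cutE _ _ _ _ _ ex1 ex2 nx1 nx2 xE.
have [c' [okc' v0c' vc'1 inc' outc']] := cutE _ _ _ _ _ ey1 ey2 ny1 ny2 yE.
have dd : down_closed (fun v => cV c v /\ cV c' v).
  by move=> h v ev [cv cv'] u eu; split; [exact: okc.1 ev cv u eu|exact: okc'.1 ev cv' u eu].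
have de : down_closed (fun v => cV c v \/ cV c' v).
  by move=> h v ev [cv|cv] u eu; [left; exact: okc.1 ev cv u eu|right; exact: okc'.1 ev cv u eu].
have [nd [dlab okd]] := cut_exists (fun x => cL c x /\ cL c' x) dd.
have [ne [elab oke]] := cut_exists (fun x => cL c x \/ cL c' x) de.
set d := Cut _ _ dlab in okd; set e := Cut _ _ elab in oke.
have led : cut_le d c by split=> v [].
have led' : cut_le d c' by split=> v [].
have lee : cut_le c e by split=> v; left.
have lee' : cut_le c' e by split=> v; right.
have [r0 h0] := slice_value_exists (P := P) phi (cut0_ok G) okd (cut0_le _).
have [r1 h1] := slice_value_exists (P := P) phi oke (cut1_ok G) (cut1_ge _).
have [p3 hp3] := slice_value_exists (P := P) phi okd okc led.
have [p4 hp4] := slice_value_exists (P := P) phi okc oke lee.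
have [q3 hq3] := slice_value_exists (P := P) phi okd okc' led'.
have [q4 hq4] := slice_value_exists (P := P) phi okc' oke lee'.
have uniq k' l' (G' : graph k' l') : at_most (vert G' + loop G') N ->
    forall r s, evalg phi G' r -> evalg phi G' s -> r = s.
  by move=> aG' r s; exact: IH.
(* The part below [c] is proper because the upper factor has a node. The values [r0] below the meet
   and [r1] above the join are shared by both evaluations, so only the square in between remains to
   be compared. *)
have p2E : p2 = vcomp p3 r0.
  apply: (slice_value_uniq aG uniq _ v0c).
    by case: outc => -[v nv]; [left|right]; exists v => -[].
  exact: slice_value_vcomp okd.1 (cut0_le _) led hp3 h0.
have p1E : p1 = vcomp r1 p4.
  apply: (slice_value_uniq aG uniq _ vc1).
    by case: inc => -[v nv]; [left|right]; exists v => -[].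
  exact: slice_value_vcomp oke.1 lee (cut1_ge _) h1 hp4.
have q2E : q2 = vcomp q3 r0.
  apply: (slice_value_uniq aG uniq _ v0c').
    by case: outc' => -[v nv]; [left|right]; exists v => -[].
  exact: slice_value_vcomp okd.1 (cut0_le _) led' hq3 h0.
have q1E : q1 = vcomp r1 q4.
  apply: (slice_value_uniq aG uniq _ vc'1).
    by case: inc' => -[v nv]; [left|right]; exists v => -[].
  exact: slice_value_vcomp oke.1 lee' (cut1_ge _) h1 hq4.
have sq : vcomp p4 p3 = vcomp q4 q3.
  apply: (square aG uniq okc.1 okc'.1 okd okc okc' oke) => //.
  - by case: inc => -[v nv]; [left|right]; exists v => -[].
  - by case: outc => -[v nv]; [left|right]; exists v => -[].
  - by case: inc' => -[v nv]; [left|right]; exists v => -[].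
  - by case: outc' => -[v nv]; [left|right]; exists v => -[].
have ax := ProP_axioms P.
rewrite p1E p2E q1E q2E -!(vcompA ax); congr vcomp; rewrite !(vcompA ax).
by rewrite sq.
Qed.

Lemma eval_uniq k l (x : Gr K k l) p q : eval phi x p -> eval phi x q -> p = q.
Proof.
move=> ep; have [G xE] := eval_vec ep; subst x => eq'.
have [N aG] := at_most_finite (finite_sum (vert_fin G) (loop_fin G)).
exact: evalg_uniq aG ep eq'.
Qed.

(** Representatives and values are chosen arbitrarily here; [eval_uniq] makes the result independent
    of them. *)
Definition extension k l (x : Gr K k l) : P k l :=
  lin_ext (fun c => projT1 (cid (all_evaluable phi (repr c)))) x.

Lemma extension_linear k l : linear (@extension k l).
Proof. exact: lin_ext_linear. Qed.

Lemma eval_extension_vec k l (G : graph k l) :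
  eval phi (graph_vec K G : Gr K k l) (extension (graph_vec K G)).
Proof.
rewrite /extension lin_ext_vec; case: cid => p ep /=.
exact: evalg_giso (repr_iso_class G) ep.
Qed.

Lemma eval_extension k l (x : Gr K k l) p : eval phi x p -> extension x = p.
Proof.
move=> ep; have [G xE] := eval_vec ep; subst x.
exact: eval_uniq (eval_extension_vec G) ep.
Qed.

(** By linearity each identity is checked on graphs, where it is a constructor of [eval] followed by
    uniqueness of the value. *)
Lemma extension_morphism : ProP_morphism extension.
Proof.
have ax := ProP_axioms P; have gax := ProP_axioms (Gr K).
split; last 4 first.
- move=> k l k' l' x y.
  move: x; apply: (@gr_ext K) => [||G].
  + exact: linear_comp (@extension_linear _ _) (hcomp_linl gax y).
  + exact: linear_comp (hcomp_linl ax _) (@extension_linear _ _).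
  move: y; apply: (@gr_ext K) => [||G'].
  + exact: linear_comp (@extension_linear _ _) (hcomp_linr gax _).
  + exact: linear_comp (hcomp_linr ax _) (@extension_linear _ _).
  apply: eval_extension; apply: eval_hcomp; exact: eval_extension_vec.
- move=> k l m x y.
  move: x; apply: (@gr_ext K) => [||G].
  + exact: linear_comp (@extension_linear _ _) (vcomp_linl gax y).
  + exact: linear_comp (vcomp_linl ax _) (@extension_linear _ _).
  move: y; apply: (@gr_ext K) => [||G'].
  + exact: linear_comp (@extension_linear _ _) (vcomp_linr gax _).
  + exact: linear_comp (vcomp_linr ax _) (@extension_linear _ _).
  apply: eval_extension; apply: eval_vcomp; exact: eval_extension_vec.
- exact/eval_extension/eval_unit0.
- exact/eval_extension/eval_unit1.
split; first exact: extension_linear.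
- move=> k l s; apply: (@gr_ext K) => [||G].
  + exact: linear_comp (@extension_linear _ _) (@lact_linear _ (Gr K) _ _ s).
  + exact: linear_comp (@lact_linear _ P _ _ s) (@extension_linear _ _).
  by apply: eval_extension; apply: eval_lact; exact: eval_extension_vec.
- move=> k l x t; move: x; apply: (@gr_ext K) => [||G].
  + exact: linear_comp (@extension_linear _ _) (@ract_linear _ (Gr K) _ _ t).
  + exact: linear_comp (@ract_linear _ P _ _ t) (@extension_linear _ _).
  by apply: eval_extension; apply: eval_ract; exact: eval_extension_vec.
Qed.

Lemma extension_ind k l (x : Gr_ind K k l) : extension (gr_ind_incl x) = phi x.
Proof.
have lin0 (U V : lmodType K) (f : U -> V) : linear f -> f 0%R = 0%R.
  by move=> lf; have := lf (- 1)%R 0%R 0%R; rewrite scaler0 addr0 scaleN1r addNr.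
have lin := ss_mor_linear phiP; have extlin := @extension_linear k l.
have /asboolP[s] := gr_indP x.
elim: s x => [|[a C] s IH] x hs; rewrite ?big_nil ?big_cons => xE.
  have -> : x = 0%R by exact: val_inj.
  by rewrite (lin0 _ _ _ (lin k l)); exact: (lin0 _ _ _ extlin).
have hC : indecomposable C by apply: (hs (a, C)); rewrite inE eqxx.
have hs' : {in s, forall c, indecomposable c.2}.
  by move=> c cs; apply: hs; rewrite inE cs orbT.
have ys : (\sum_(c <- s) c.1 *: graph_vec K c.2)%R \in @gr_ind_span K k l.
  by apply/asboolP; exists s.
have -> : x = (a *: ind_vec K hC + GrInd ys)%R by apply: val_inj.
rewrite lin -(IH (GrInd ys)) // -(eval_extension (eval_gen phi hC)).
exact: extlin.
Qed.

Lemma morphism_eval (Psi : forall k l, Gr K k l -> P k l) :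
  ProP_morphism Psi -> (forall k l (x : Gr_ind K k l), Psi k l (gr_ind_incl x) = phi x) ->
  forall k l (x : Gr K k l) p, eval phi x p -> Psi k l x = p.
Proof.
move=> mor ext k l x p; elim=> {k l x p}.
- by move=> k l C hC; rewrite -ext.
- exact: (prop_mor_unit0 mor).
- exact: (prop_mor_unit1 mor).
- by move=> k l s x p _ <-; rewrite (ss_mor_lact mor).
- by move=> k l t x p _ <-; rewrite (ss_mor_ract mor).
- by move=> k l k' l' x y p q _ <- _ <-; rewrite (prop_mor_hcomp mor).
- by move=> k l m x y p q _ <- _ <-; rewrite (prop_mor_vcomp mor).
Qed.

End Extension.

Theorem theorem3p11 (R : realType) (c : scalars)
    (P : ProP (scalar_field R c))
    (phi : forall k l, Gr_ind (scalar_field R c) k l -> P k l) :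
  SS_morphism phi ->
  exists! Phi : (forall k l, Gr (scalar_field R c) k l -> P k l),
    ProP_morphism Phi
    /\ forall k l (x : Gr_ind (scalar_field R c) k l),
         Phi k l (gr_ind_incl x) = phi k l x.
Proof.
move=> phiP; exists (extension phi); split.
  by split; [exact: extension_morphism|exact: extension_ind].
move=> Psi [mor ext].
apply: functional_extensionality_dep => k; apply: functional_extensionality_dep => l.
apply: funext; apply: gr_ext; first exact: extension_linear.
  exact: (ss_mor_linear mor).
by move=> G; apply/esym/(morphism_eval mor ext)/eval_extension_vec.
Qed.
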